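(* Let $f$ be a polynomial in $z$ and $\bar z$ on $\mathbb{C}^N$. Then $f=B(u)$ on $\mathbb{B}_N$ for some $u\in L^1(\mathbb{B}_N)$ if and only if for all $1\le j,\ell\le N$ the derivative $\partial_{z_j}\bar\partial_{z_\ell}f$ has total degree at most $2N-1$. As a consequence, if $w_1,\dots,w_s\in\mathbb{B}_N$ and $Q_1,\dots,Q_s\in\mathbb{C}[z,\bar z]$ have total degrees at most $2N+1$, then there exists $u\in L^1(\mathbb{B}_N)$ with $B(u)=\sum_{j=1}^s Q_j\circ\varphi_{w_j}$.
   Context: $\mathbb{B}_N$ is the unit ball of $\mathbb{C}^N$, $dV$ normalized volume measure, $\langle z,w\rangle=\sum_j z_j\bar w_j$. The Berezin transform of $u\in L^1(\mathbb{B}_N)$ is $B(u)(z)=(1-|z|^2)^{N+1}\int_{\mathbb{B}_N}\frac{u(\xi)}{|1-\langle z,\xi\rangle|^{2(N+1)}}dV(\xi)$. For $w\in\mathbb{B}_N$, $\varphi_w$ is the involutive automorphism $\varphi_w(z)=\frac{w-P_wz-\sqrt{1-|w|^2}\,(z-P_wz)}{1-\langle z,w\rangle}$, with $P_wz=\frac{\langle z,w\rangle}{|w|^2}w$ for $w\neq0$ and $\varphi_0(z)=-z$; $Q\circ\varphi_w(z)$ means $Q$ evaluated at $\varphi_w(z)$ and $\overline{\varphi_w(z)}$. *)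

(* Defs.v *)
From mathcomp Require Import all_boot all_order all_algebra.
From mathcomp Require Import all_classical all_reals all_analysis.
From mathcomp Require Import complex.
From mathcomp Require mpoly.



Unset Printing Implicit Defensive.

Import Order.TTheory GRing.Theory Num.Theory.
Local Open Scope classical_set_scope.
Local Open Scope ring_scope.
Local Open Scope complex_scope.

Section Berezin.
Variable R : realType.

Definition cvec (N : nat) := 'I_N -> R[i].

Definition absC2 (c : R[i]) : R := (@complex.Re R c) ^+ 2 + (@complex.Im R c) ^+ 2.

Definition normsq {N} (z : cvec N) : R := \sum_(j < N) absC2 (z j).

Definition inner {N} (z w : cvec N) : R[i] := \sum_(j < N) z j * (w j)^*.

Definition ball_N (N : nat) : set (cvec N) := [set z | normsq z < 1].

Definition lebC : set (R * R) -> \bar R :=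
  @product_measure1 _ _ R R R (@lebesgue_measure R) (@lebesgue_measure R).

(** Lebesgue measure on C^n, realised on n.-tuple (R * R) (with the product
    sigma-algebra, i.e. the Borel sets of R^(2n)), as the iterated product
    measure. *)
Fixpoint lebCn (n : nat) : set (n.-tuple (R * R)) -> \bar R :=
  match n with
  | 0 => \d_([tuple] : 0.-tuple (R * R))
  | n'.+1 => fun A => @product_measure1 _ _ (R * R)%type (n'.-tuple (R * R)) R
                 lebC (lebCn n')
                 ((fun p : (R * R) * n'.-tuple (R * R) => cons_tuple p.1 p.2) @^-1` A)
  end.

Definition toC {n} (x : n.-tuple (R * R)) : cvec n :=
  fun j => (tnth x j).1 +i* (tnth x j).2.

Definition ballT n : set (n.-tuple (R * R)) := (@toC n) @^-1` (ball_N n).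

Definition dV n : set (n.-tuple (R * R)) -> \bar R :=
  fun A => (((fine (lebCn n (ballT n)))^-1)%:E * lebCn n A)%E.

(** Real-valued integral (as Rintegral, but for an arbitrary set function). *)
Definition Rint {n} (D : set (n.-tuple (R * R))) (f : n.-tuple (R * R) -> R) : R :=
  fine (integral (dV n) D (fun x => (f x)%:E)).

Definition L1ball {N} (u : cvec N -> R[i]) : Prop :=
  (dV N).-integrable (ballT N) (fun x => (@complex.Re R (u (toC x)))%:E) /\
  (dV N).-integrable (ballT N) (fun x => (@complex.Im R (u (toC x)))%:E).

Definition berezin {N} (u : cvec N -> R[i]) (z : cvec N) : R[i] :=
  let K := fun xi : cvec N =>
    (1 - normsq z) ^+ N.+1 / (absC2 (1 - inner z xi)) ^+ N.+1 in
  (Rint (ballT N) (fun x => K (toC x) * @complex.Re R (u (toC x))))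
  +i* (Rint (ballT N) (fun x => K (toC x) * @complex.Im R (u (toC x)))).

(** Polynomials in z and zbar on C^N: polynomials in 2N variables, variable
    [lshift N j] standing for z_j and [rshift N j] for zbar_j. *)
Definition zpoly N := mpoly.mpoly (N + N) R[i].

Definition evalz {N} (f : zpoly N) (z : cvec N) : R[i] :=
  mpoly.meval (fun i : 'I_(N + N) =>
                 match @fintype.split N N i with inl j => z j | inr j => (z j)^* end) f.

Definition dz {N} (j : 'I_N) (f : zpoly N) : zpoly N := mpoly.mderiv (lshift N j) f.
Definition dzbar {N} (l : 'I_N) (f : zpoly N) : zpoly N := mpoly.mderiv (rshift N l) f.

Definition tdeg_le {N} (f : zpoly N) (d : nat) : Prop :=
  forall m : mpoly.multinom (N + N),
    mpoly.mcoeff m f != 0 -> (mpoly.mdeg m <= d)%N.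

(** The involutive automorphism phi_w of B_N. *)
Definition phi {N} (w z : cvec N) : cvec N :=
  if normsq w == 0 then (fun j => - z j)
  else
    let Pwz := fun j => (inner z w / (normsq w)%:C) * w j in
    let s := (Num.sqrt (1 - normsq w))%:C in
    fun j => (w j - Pwz j - s * (z j - Pwz j)) / (1 - inner z w).

End Berezin.

Arguments absC2 {R}.
Arguments normsq {R N}.
Arguments inner {R N}.
Arguments ball_N {R}.
Arguments lebCn {R}.
Arguments toC {R n}.
Arguments ballT {R}.
Arguments dV {R}.
Arguments Rint {R n}.
Arguments L1ball {R N}.
Arguments berezin {R N}.
Arguments evalz {R N}.
Arguments dz {R N}.
Arguments dzbar {R N}.
Arguments tdeg_le {R N}.
Arguments phi {R N}.

(* Main.v *)
(* Expanding the kernel in powers of [<z, xi>] and its conjugate, [f = B(u)] means that, for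
   all [a, b] and [zeta], [C(N+a,N) C(N+b,N)] times the integral of
   [u(xi) <zeta,xi>^a <xi,zeta>^b] is the coefficient of [x^a y^b] in
   [f(x zeta, y conj(zeta)) (1 - |zeta|^2 x y)^(-N-1)].

   Sufficiency. Let [f] be a monomial of bidegree [(p, q)], and let [W_i], of bidegree
   [(p-i, q-i)], be the components of its Wick ordering. The sum of the [W_i] has the required
   pairings with [<zeta,xi>^a <xi,zeta>^b] for the Gaussian measure. The volume moments of
   bidegree [(n, n)] are [N!/(n+N)!] times the Gaussian ones, so each [W_i] has to be multiplied
   by a radial function whose moments are
   [(k+p+q-i)! k! / ((k+p)! (k+q)!)], [k = N+a-p = N+b-q]. This is a rational function of [k]; its
   partial fractions are the moments of a constant and of integrals of powers of the radius,
   and these are integrable against [W_i] when [p + q <= 2N + 1].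

   Necessity. On the unit sphere the component of bidegree [(q+d, q)] of [f], with values
   [c_q], satisfies
   [C(Y+d,N) C(Y,N) int u lam^d |lam|^(2(Y-N)) = sum_q c_q C(Y-q,N)], [lam = <zeta, xi>].
   If [q0] is the largest [q], the [n]-th finite difference in [Y] from [Y = q0 - 1] leaves
   only [c_q0] on the right, up to sign, while the left side tends to [0] by dominated
   convergence when [2 q0 + d >= 2N + 2].

   The construction of [u] uses only the kernel integrals of the volume. These are the same
   for the image under [phi_w] of the volume weighted by
   [((1-|w|^2) / |1-<xi,w>|^2)^(N+1)], so that composing [u] with [phi_w] yields a function
   whose Berezin transform is the polynomial composed with [phi_w]. *)
From HB Require Import structures.
Require Import Defs.
From mathcomp Require Import all_boot all_order all_algebra.
From mathcomp Require Import all_classical all_reals all_analysis.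
From mathcomp Require Import complex.
From mathcomp Require mpoly.
From mathcomp Require Import measurable_realfun.
From mathcomp Require Import ring lra zify.
Import Order.TTheory GRing.Theory Num.Theory.
Import numFieldNormedType.Exports.
Local Open Scope classical_set_scope.
Local Open Scope ring_scope.
Local Open Scope complex_scope.
Set Implicit Arguments.
Unset Strict Implicit.

(* [x^*] parses as [Num.conj], which is convertible to [conjc]. *)
Reserved Notation "x ^^*" (at level 1, left associativity, format "x ^^*").
Notation "x ^^*" := (@conjc _ x) : ring_scope.

(** * Complex moduli and componentwise convergence *)

(** The Jacobian of [phi_w] is never computed. Comparing coefficients of [x] and its conjugate along
    the discs [x zeta], the kernel integrals give the pairings with all powers of [<zeta,xi>] and
    [<xi,zeta>]; polarization turns these into all polynomial moments, and limits of polynomials in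
    [|xi|^2] into moments over concentric balls. Each radial function used is an integral of ball
    indicators, so Fubini applies.

    Threshold in sufficiency: the worst power is [rho^(-s)] with [s = 2(p+q-i) - 1], while [W_i] has
    order [p+q-2i] at the origin and the ball of radius [rho] has mass [rho^(2N)]; [s <= p+q-2i+2N]
    means [p+q <= 2N+1]. If [p] or [q] is 0, the rational function of [k] is 1 and no such power
    occurs.

    Threshold in necessity: with [r = q0 - 1], expanding the two binomials in the basis [C(y,j)]
    turns the n-th difference into a combination of [lam^d |lam|^(2(j+r-N)) C(n,j)
    (1-|lam|^2)^(n-j)]. The condition [2N <= 2r+d] bounds each by the binomial probability
    [C(n,j) t^j (1-t)^(n-j)], [t = |lam|^2], which is at most 1 and tends to 0. *)

Section Cabs.
Variable R : realType.
Implicit Types x y : R[i].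
Local Notation Re := (@complex.Re R).
Local Notation Im := (@complex.Im R).

(** A modulus with values in [R], unlike the norm of [R[i]], so that it can be integrated and
    compared with real bounds. *)
Definition cabs x : R := Num.sqrt (absC2 x).

Lemma absC2_ge0 x : 0 <= absC2 x.
Proof. by rewrite addr_ge0 ?sqr_ge0. Qed.

Lemma absC2M x y : absC2 (x * y) = absC2 x * absC2 y.
Proof. by case: x y => [a b] [c e]; rewrite /absC2 /=; ring. Qed.

Lemma absC2_conj x : absC2 (x^^*) = absC2 x.
Proof. by case: x => [a b]; rewrite /absC2 /= sqrrN. Qed.

Lemma absC2N x : absC2 (- x) = absC2 x.
Proof. by case: x => [a b]; rewrite /absC2 /= !sqrrN. Qed.

Lemma absC2E x : (absC2 x)%:C = x * x^^*.
Proof.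
by case: x => [a b]; apply/eqP; rewrite eq_complex /absC2 /=; apply/andP; split;
  apply/eqP; ring.
Qed.

Lemma absC2_real (a : R) : absC2 (a%:C) = a ^+ 2.
Proof. by rewrite /absC2 /=; ring. Qed.

Lemma absC2X x n : absC2 (x ^+ n) = absC2 x ^+ n.
Proof.
elim: n => [|n IH]; last by rewrite !exprS absC2M IH.
by rewrite !expr0 /absC2 /=; ring.
Qed.

Lemma absC2_eq0 x : (absC2 x == 0) = (x == 0).
Proof.
case: x => [a b]; rewrite /absC2 /= paddr_eq0 ?sqr_ge0// !sqrf_eq0.
by rewrite eq_complex.
Qed.

Lemma absC2V x : absC2 x^-1 = (absC2 x)^-1.
Proof.
have [->|x0] := eqVneq x 0; first by rewrite invr0 /absC2 /= expr0n /= addr0 invr0.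
have h : absC2 x != 0 by rewrite absC2_eq0.
apply: (mulfI h); rewrite -absC2M !divff//.
by rewrite (_ : 1 = 1%:C)// absC2_real expr1n.
Qed.

Lemma cabs_ge0 x : 0 <= cabs x. Proof. exact: sqrtr_ge0. Qed.

Lemma cabs_sqr x : cabs x ^+ 2 = absC2 x.
Proof. by rewrite sqr_sqrtr ?absC2_ge0. Qed.

Lemma cabsM x y : cabs (x * y) = cabs x * cabs y.
Proof. by rewrite /cabs absC2M sqrtrM ?absC2_ge0. Qed.

Lemma cabs_real (a : R) : cabs a%:C = `|a|.
Proof. by rewrite /cabs absC2_real sqrtr_sqr. Qed.

Lemma cabs0 : cabs 0 = 0. Proof. by rewrite (_ : 0 = 0%:C)// cabs_real normr0. Qed.
Lemma cabs1 : cabs 1 = 1. Proof. by rewrite (_ : 1 = 1%:C)// cabs_real normr1. Qed.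

Lemma cabsX x n : cabs (x ^+ n) = cabs x ^+ n.
Proof. by elim: n => [|n IH]; rewrite ?expr0 ?cabs1// !exprS cabsM IH. Qed.

Lemma cabs_conj x : cabs (x^^*) = cabs x.
Proof. by rewrite /cabs absC2_conj. Qed.

Lemma cabsN x : cabs (- x) = cabs x.
Proof. by rewrite /cabs absC2N. Qed.

Lemma cabs_eq0 x : (cabs x == 0) = (x == 0).
Proof. by rewrite sqrtr_eq0 -absC2_eq0 eq_le absC2_ge0 andbT. Qed.

Lemma natcE n : (n%:R : R[i]) = (n%:R : R)%:C.
Proof. by rewrite rmorph_nat. Qed.

Lemma cabs_nat n : cabs n%:R = n%:R.
Proof. by rewrite natcE cabs_real normr_nat. Qed.

Lemma normr_Re_le x : `|Re x| <= cabs x.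
Proof.
rewrite -sqrtr_sqr ler_sqrt ?absC2_ge0// /absC2.
by rewrite lerDl sqr_ge0.
Qed.

Lemma normr_Im_le x : `|Im x| <= cabs x.
Proof.
rewrite -sqrtr_sqr ler_sqrt ?absC2_ge0// /absC2.
by rewrite lerDr sqr_ge0.
Qed.

Lemma cabs_le x : cabs x <= `|Re x| + `|Im x|.
Proof.
rewrite -(@ler_pXn2r _ 2)// ?nnegrE ?cabs_ge0 ?addr_ge0//.
rewrite cabs_sqr /absC2 sqrrD !real_normK ?num_real//.
by rewrite addrAC lerDl mulrn_wge0// mulr_ge0.
Qed.

Lemma cabsD x y : cabs (x + y) <= cabs x + cabs y.
Proof.
rewrite -(@ler_pXn2r _ 2)// ?nnegrE ?cabs_ge0 ?addr_ge0 ?cabs_ge0//.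
rewrite sqrrD !cabs_sqr.
suff : Re (x * y^^*) <= cabs x * cabs y.
  by case: x y => [a b] [c e] /=; rewrite /absC2 /=; lra.
rewrite (le_trans (ler_norm _))// (le_trans (normr_Re_le _))//.
by rewrite cabsM cabs_conj.
Qed.

Lemma cabsB x y : cabs (x - y) <= cabs x + cabs y.
Proof. by rewrite (le_trans (cabsD _ _))// cabsN. Qed.

Lemma cabs_distrC x y : cabs (x - y) = cabs (y - x).
Proof. by rewrite -cabsN opprB. Qed.

Lemma cabs_sum (I : Type) (r : seq I) (P : pred I) (F : I -> R[i]) :
  cabs (\sum_(i <- r | P i) F i) <= \sum_(i <- r | P i) cabs (F i).
Proof.
elim/big_ind2 : _ => [|x1 x2 y1 y2 h1 h2|//]; first by rewrite cabs0.
by rewrite (le_trans (cabsD _ _))// lerD.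
Qed.

Lemma ReD x y : Re (x + y) = Re x + Re y. Proof. by case: x y => [? ?] []. Qed.
Lemma ImD x y : Im (x + y) = Im x + Im y. Proof. by case: x y => [? ?] []. Qed.
Lemma ReN x : Re (- x) = - Re x. Proof. by case: x. Qed.
Lemma ImN x : Im (- x) = - Im x. Proof. by case: x. Qed.
Lemma ReM x y : Re (x * y) = Re x * Re y - Im x * Im y.
Proof. by case: x y => [? ?] []. Qed.
Lemma ImM x y : Im (x * y) = Re x * Im y + Im x * Re y.
Proof. by case: x y => [? ?] []. Qed.
Lemma complex_eq x y : Re x = Re y -> Im x = Im y -> x = y.
Proof. by case: x y => [? ?] [? ?] /= -> ->. Qed.

Lemma conjM x y : (x * y)^^* = x^^* * y^^*. Proof. exact: (rmorphM (@conjc R)). Qed.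
Lemma conjB x y : (x - y)^^* = x^^* - y^^*. Proof. exact: (rmorphB (@conjc R)). Qed.
Lemma conjX x n : (x ^+ n)^^* = (x^^*) ^+ n. Proof. exact: (rmorphXn (@conjc R)). Qed.
Lemma conjV x : (x^-1)^^* = (x^^*)^-1. Proof. exact: (fmorphV (@conjc R)). Qed.
Lemma conj1 : (1 : R[i])^^* = 1. Proof. exact: conjc1. Qed.
Lemma conj_sum (I : Type) (r : seq I) (P : pred I) (F : I -> R[i]) :
  (\sum_(i <- r | P i) F i)^^* = \sum_(i <- r | P i) (F i)^^*.
Proof. exact: (rmorph_sum (@conjc R)). Qed.
(** Componentwise, so that the real limit and convergence theorems apply to each part. *)
Definition ccvg (u : nat -> R[i]) (l : R[i]) :=
  Re (u n) @[n --> \oo] --> Re l /\ Im (u n) @[n --> \oo] --> Im l.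

Lemma ccvg_unique u l m : ccvg u l -> ccvg u m -> l = m.
Proof.
by move=> [a b] [c e]; apply: complex_eq; [apply: (cvg_unique _ a c)|
  apply: (cvg_unique _ b e)].
Qed.

Lemma ccvgD u v l m : ccvg u l -> ccvg v m -> ccvg (fun n => u n + v n) (l + m).
Proof.
move=> [a b] [c e]; split.
  by under eq_fun do rewrite ReD; rewrite ReD; exact: cvgD.
by under eq_fun do rewrite ImD; rewrite ImD; exact: cvgD.
Qed.

Lemma ccvgM u v l m : ccvg u l -> ccvg v m -> ccvg (fun n => u n * v n) (l * m).
Proof.
move=> [a b] [c e]; split.
  by under eq_fun do rewrite ReM; rewrite ReM; apply: cvgB; exact: cvgM.
by under eq_fun do rewrite ImM; rewrite ImM; apply: cvgD; exact: cvgM.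
Qed.

Lemma ccvg_cst l : ccvg (fun=> l) l.
Proof. by split; exact: cvg_cst. Qed.

Lemma ccvgN u l : ccvg u l -> ccvg (fun n => - u n) (- l).
Proof.
move=> [a b]; split.
  by under eq_fun do rewrite ReN; rewrite ReN; exact: cvgN.
by under eq_fun do rewrite ImN; rewrite ImN; exact: cvgN.
Qed.

Lemma ccvgB u v l m : ccvg u l -> ccvg v m -> ccvg (fun n => u n - v n) (l - m).
Proof. by move=> a b; apply: ccvgD => //; exact: ccvgN. Qed.

Lemma ccvg_sum (I : Type) (r : seq I) (P : pred I) (F : I -> nat -> R[i]) (l : I -> R[i]) :
  (forall i, P i -> ccvg (F i) (l i)) ->
  ccvg (fun n => \sum_(i <- r | P i) F i n) (\sum_(i <- r | P i) l i).
Proof.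
move=> h; elim: r => [|i r IH].
  rewrite big_nil; under [X in ccvg X _]eq_fun do rewrite big_nil.
  exact: ccvg_cst.
rewrite big_cons; under [X in ccvg X _]eq_fun do rewrite big_cons.
by case: ifPn => // Pi; apply: ccvgD => //; exact: h.
Qed.

Lemma ccvg_squeeze u l (v : nat -> R) :
  (forall n, cabs (u n - l) <= v n) -> v @ \oo --> (0 : R) -> ccvg u l.
Proof.
move=> uv v0; split.
  apply/cvgrPdist_le => e e0; move/cvgrPdist_le : v0 => /(_ _ e0).
  apply: filterS => n; rewrite sub0r normrN => vn.
  rewrite (le_trans _ vn)// (le_trans _ (ler_norm _))// (le_trans _ (uv n))//.
  by rewrite cabs_distrC (le_trans _ (normr_Re_le _))// ReD ReN.
apply/cvgrPdist_le => e e0; move/cvgrPdist_le : v0 => /(_ _ e0).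
apply: filterS => n; rewrite sub0r normrN => vn.
rewrite (le_trans _ vn)// (le_trans _ (ler_norm _))// (le_trans _ (uv n))//.
by rewrite cabs_distrC (le_trans _ (normr_Im_le _))// ImD ImN.
Qed.

Lemma ccvg_cabs_le u l (M : R) :
  (forall n, cabs (u n) <= M) -> ccvg u l -> cabs l <= M.
Proof.
move=> uM [a b].
have M0 : 0 <= M by rewrite (le_trans (cabs_ge0 (u 0%N))).
have h : absC2 (u n) @[n --> \oo] --> absC2 l.
  by rewrite /absC2; apply: cvgD; rewrite expr2;
     under eq_fun do rewrite expr2; exact: cvgM.
rewrite -(@ler_pXn2r _ 2)// ?nnegrE ?cabs_ge0// cabs_sqr.
rewrite -(cvg_lim _ h)//; apply: limr_le; first by apply/cvg_ex; eexists; exact: h.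
apply: nearW => n; rewrite -cabs_sqr ler_pXn2r ?nnegrE ?cabs_ge0//.
Qed.

End Cabs.

(** * Complex-valued integration *)

Section Cint.
Context d (T : measurableType d) (R : realType).
Implicit Types (D : set T) (f g : T -> R[i]).
Local Notation Re := (@complex.Re R).
Local Notation Im := (@complex.Im R).

Definition cmeas D f :=
  measurable_fun D (fun x => Re (f x)) /\ measurable_fun D (fun x => Im (f x)).

Lemma cmeas_cst D c : cmeas D (fun=> c).
Proof. by split; exact: measurable_cst. Qed.

Lemma cmeasD D f g : cmeas D f -> cmeas D g -> cmeas D (fun x => f x + g x).
Proof.
move=> [a b] [c e]; split.
  by under eq_fun do rewrite ReD; exact: measurable_funD.
by under eq_fun do rewrite ImD; exact: measurable_funD.
Qed.

Lemma cmeasN D f : cmeas D f -> cmeas D (fun x => - f x).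
Proof.
move=> [a b]; split.
  by under eq_fun do rewrite ReN; exact: measurableT_comp.
by under eq_fun do rewrite ImN; exact: measurableT_comp.
Qed.

Lemma cmeasB D f g : cmeas D f -> cmeas D g -> cmeas D (fun x => f x - g x).
Proof. by move=> a b; apply: cmeasD => //; exact: cmeasN. Qed.

Lemma cmeasM D f g : cmeas D f -> cmeas D g -> cmeas D (fun x => f x * g x).
Proof.
move=> [a b] [c e]; split.
  by under eq_fun do rewrite ReM; apply: measurable_funB; exact: measurable_funM.
by under eq_fun do rewrite ImM; apply: measurable_funD; exact: measurable_funM.
Qed.

Lemma cmeas_conj D f : cmeas D f -> cmeas D (fun x => (f x)^^*).
Proof.
move=> [a b]; split.
  by rewrite (_ : (fun x => Re _) = fun x => Re (f x))//; apply/funext => x; by case: (f x).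
rewrite (_ : (fun x => Im _) = fun x => - Im (f x)); first exact: measurableT_comp.
by apply/funext => x; by case: (f x).
Qed.

Lemma cmeasX D f n : cmeas D f -> cmeas D (fun x => f x ^+ n).
Proof.
move=> mf; elim: n => [|n IH]; first exact: cmeas_cst.
by under eq_fun do rewrite exprS; exact: cmeasM.
Qed.

Lemma cmeas_sum D (I : Type) (r : seq I) (P : pred I) (F : I -> T -> R[i]) :
  (forall i, P i -> cmeas D (F i)) -> cmeas D (fun x => \sum_(i <- r | P i) F i x).
Proof.
move=> h; elim: r => [|i r IH].
  by under eq_fun do rewrite big_nil; exact: cmeas_cst.
have [Pi|/negbTE Pi] := boolP (P i); under eq_fun do rewrite big_cons Pi; last by [].
by apply: cmeasD => //; exact: h.
Qed.

Lemma cmeas_prod D (I : Type) (r : seq I) (P : pred I) (F : I -> T -> R[i]) :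
  (forall i, P i -> cmeas D (F i)) -> cmeas D (fun x => \prod_(i <- r | P i) F i x).
Proof.
move=> h; elim: r => [|i r IH].
  by under eq_fun do rewrite big_nil; exact: cmeas_cst.
have [Pi|/negbTE Pi] := boolP (P i); under eq_fun do rewrite big_cons Pi; last by [].
by apply: cmeasM => //; exact: h.
Qed.

Lemma cmeas_real D (f : T -> R) : measurable_fun D f -> cmeas D (fun x => (f x)%:C).
Proof. by move=> mf; split => //=; exact: measurable_cst. Qed.

Lemma measurable_absC2 D f : cmeas D f -> measurable_fun D (fun x => absC2 (f x)).
Proof. by move=> [a b]; apply: measurable_funD; exact: measurable_funX. Qed.

Lemma cmeas_inv D f : cmeas D f -> cmeas D (fun x => (f x)^-1).
Proof.
move=> mf; have -> : (fun x => (f x)^-1) = (fun x => ((absC2 (f x))^-1)%:C * (f x)^^*).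
  apply/funext => x; have [->|fx0] := eqVneq (f x) 0;
    first by rewrite invr0 [X in _ * X](rmorph0 (@conjc R)) mulr0.
  apply: (mulfI fx0); rewrite divff// mulrCA -absC2E -rmorphM mulVf//.
  by rewrite absC2_eq0.
apply: cmeasM; last exact: cmeas_conj.
apply: cmeas_real.
(* The power with exponent -1 agrees with the inverse on nonnegative reals, 0 included. *)
rewrite (_ : (fun x => _) = (@powR R ^~ (-1)) \o (fun x => absC2 (f x))).
  by apply: measurableT_comp; [exact: measurable_powR|exact: measurable_absC2].
by apply/funext => x /=; rewrite powR_inv1// absC2_ge0.
Qed.

Lemma measurable_cabs D f : cmeas D f -> measurable_fun D (fun x => cabs (f x)).
Proof.
move=> mf; apply: (@measurableT_comp _ _ _ _ _ _ (@Num.sqrt R)).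
  by apply: continuous_measurable_fun; exact: sqrt_continuous.
exact: measurable_absC2.
Qed.

Lemma cmeas_subset D D' f : measurable D' -> D `<=` D' -> cmeas D' f -> cmeas D f.
Proof. by move=> mD DD' [a b]; split; apply: measurable_funS; eauto. Qed.

Variable mu : {measure set T -> \bar R}.

Definition cintegrable D f :=
  mu.-integrable D (fun x => (Re (f x))%:E) /\ mu.-integrable D (fun x => (Im (f x))%:E).

Definition cint D f : R[i] :=
  (Rintegral mu D (fun x => Re (f x))) +i* (Rintegral mu D (fun x => Im (f x))).

Lemma cintegrable_cmeas D f : cintegrable D f -> cmeas D f.
Proof.
by move=> [/measurable_int/measurable_EFinP a /measurable_int/measurable_EFinP b].
Qed.

Lemma cintegrable_le D f (g : T -> R) : measurable D -> cmeas D f ->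
  mu.-integrable D (fun x => (g x)%:E) -> (forall x, D x -> cabs (f x) <= g x) ->
  cintegrable D f.
Proof.
move=> mD [mr mi] ig fg; split; apply: (le_integrable mD _ _ ig).
- exact/measurable_EFinP.
- move=> x Dx /=; rewrite lee_fin (le_trans (normr_Re_le _))//.
  by rewrite (le_trans (fg _ Dx))// ler_norm.
- exact/measurable_EFinP.
- move=> x Dx /=; rewrite lee_fin (le_trans (normr_Im_le _))//.
  by rewrite (le_trans (fg _ Dx))// ler_norm.
Qed.

Lemma integrable_cabs D f : measurable D -> cintegrable D f ->
  mu.-integrable D (fun x => (cabs (f x))%:E).
Proof.
move=> mD cf; have mf := cintegrable_cmeas cf; case: cf => a b.
have := integrableD mD (integrable_abse a) (integrable_abse b).
apply: le_integrable => //; first exact/measurable_EFinP/measurable_cabs.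
move=> x Dx /=; rewrite lee_fin ger0_norm ?cabs_ge0//.
by rewrite (le_trans (cabs_le _))// ler_norm.
Qed.

Lemma cintegrableD D f g : measurable D -> cintegrable D f -> cintegrable D g ->
  cintegrable D (fun x => f x + g x).
Proof.
move=> mD [a b] [c e]; split.
  under eq_fun do rewrite ReD EFinD; exact: integrableD.
under eq_fun do rewrite ImD EFinD; exact: integrableD.
Qed.

Lemma cintegrable_bounded D f g (M : R) : measurable D -> cintegrable D f ->
  cmeas D g -> (forall x, D x -> cabs (g x) <= M) ->
  cintegrable D (fun x => f x * g x).
Proof.
move=> mD cf mg gM.
apply: (@cintegrable_le _ _ (fun x => M * cabs (f x))) => //.
- by apply: cmeasM => //; exact: cintegrable_cmeas cf.
- under eq_fun do rewrite EFinM; apply: integrableZl => //; exact: integrable_cabs.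
- by move=> x Dx; rewrite cabsM mulrC ler_wpM2r ?cabs_ge0// gM.
Qed.

Lemma cintegrableZ D f c : measurable D -> cintegrable D f ->
  cintegrable D (fun x => c * f x).
Proof.
move=> mD cf; under eq_fun do rewrite mulrC.
by apply: (@cintegrable_bounded _ _ _ (cabs c)) => //; exact: cmeas_cst.
Qed.

Lemma cintegrableB D f g : measurable D -> cintegrable D f -> cintegrable D g ->
  cintegrable D (fun x => f x - g x).
Proof.
move=> mD cf cg; apply: cintegrableD => //; rewrite (_ : (fun x => _) = (fun x => -1 * g x)).
  exact: cintegrableZ.
by apply/funext => x; rewrite mulN1r.
Qed.

Lemma cintegrable0 D : measurable D -> cintegrable D (fun=> 0).
Proof. by move=> mD; split; exact: integrable0. Qed.

Lemma cintegrable_sum D (I : Type) (r : seq I) (P : pred I) (F : I -> T -> R[i]) :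
  measurable D -> (forall i, P i -> cintegrable D (F i)) ->
  cintegrable D (fun x => \sum_(i <- r | P i) F i x).
Proof.
move=> mD h; elim: r => [|i r IH].
  by under eq_fun do rewrite big_nil; exact: cintegrable0.
have [Pi|/negbTE Pi] := boolP (P i); under eq_fun do rewrite big_cons Pi; last by [].
by apply: cintegrableD => //; exact: h.
Qed.

Lemma eq_cint D f g : (forall x, D x -> f x = g x) -> cint D f = cint D g.
Proof.
move=> fg; rewrite /cint; congr (_ +i* _); apply: eq_Rintegral => x; rewrite inE => Dx;
  by rewrite fg.
Qed.

Lemma eq_cintegrable D f g : measurable D -> (forall x, D x -> f x = g x) ->
  cintegrable D f -> cintegrable D g.
Proof.
move=> mD fg [a b]; split.
  by apply: eq_integrable a => // x; rewrite inE => Dx; rewrite fg.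
by apply: eq_integrable b => // x; rewrite inE => Dx; rewrite fg.
Qed.

Lemma cintD D f g : measurable D -> cintegrable D f -> cintegrable D g ->
  cint D (fun x => f x + g x) = cint D f + cint D g.
Proof.
move=> mD [a b] [c e]; apply: complex_eq => /=.
  rewrite -RintegralD//.
  by apply: eq_Rintegral => x _; rewrite ReD.
rewrite -RintegralD//.
by apply: eq_Rintegral => x _; rewrite ImD.
Qed.

Lemma cintZ D f c : measurable D -> cintegrable D f ->
  cint D (fun x => c * f x) = c * cint D f.
Proof.
move=> mD [a b].
have iz k (g : T -> R) : mu.-integrable D (fun x => (g x)%:E) ->
    mu.-integrable D (EFin \o (fun x => k * g x)) by exact: integrableZl.
apply: complex_eq; rewrite ?ReM ?ImM /=.
  rewrite -!RintegralZl// -RintegralB//; [|exact: iz..].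
  by apply: eq_Rintegral => x _; rewrite ReM.
rewrite -!RintegralZl// -RintegralD//; [|exact: iz..].
by apply: eq_Rintegral => x _; rewrite ImM.
Qed.

Lemma cintB D f g : measurable D -> cintegrable D f -> cintegrable D g ->
  cint D (fun x => f x - g x) = cint D f - cint D g.
Proof.
move=> mD cf cg; rewrite -(mulN1r (cint D g)) -cintZ// -cintD//; last exact: cintegrableZ.
by apply: eq_cint => x _; rewrite mulN1r.
Qed.

Lemma cint0 D : cint D (fun=> 0) = 0.
Proof. by apply: complex_eq; rewrite /= /Rintegral integral0. Qed.

Lemma cint_sum D (I : Type) (r : seq I) (P : pred I) (F : I -> T -> R[i]) :
  measurable D -> (forall i, P i -> cintegrable D (F i)) ->
  cint D (fun x => \sum_(i <- r | P i) F i x) = \sum_(i <- r | P i) cint D (F i).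
Proof.
move=> mD h; elim: r => [|i r IH].
  by rewrite big_nil; under eq_cint do rewrite big_nil; exact: cint0.
have [Pi|/negbTE Pi] := boolP (P i); rewrite big_cons Pi.
  under eq_cint do rewrite big_cons Pi.
  by rewrite cintD ?IH//; [exact: h|exact: cintegrable_sum].
by under eq_cint do rewrite big_cons Pi.
Qed.

Lemma cint_conj D f : measurable D -> cintegrable D f ->
  cint D (fun x => (f x)^^*) = (cint D f)^^*.
Proof.
move=> mD [a b]; apply: complex_eq => /=.
  by apply: eq_Rintegral => x _; case: (f x).
rewrite -mulN1r -RintegralZl//; apply: eq_Rintegral => x _.
by case: (f x) => ? ? /=; rewrite mulN1r.
Qed.

(** The factor 2 comes from estimating the real and the imaginary part separately. *)
Lemma cabs_cint_le D f : measurable D -> cintegrable D f ->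
  cabs (cint D f) <= 2 * Rintegral mu D (fun x => cabs (f x)).
Proof.
move=> mD cf; have ic := integrable_cabs mD cf; case: cf => a b.
rewrite (le_trans (cabs_le _))//= mulr2n mulrDl mul1r lerD//.
  rewrite (le_trans (le_normr_Rintegral mD a))//.
  apply: le_Rintegral => //; first exact: integrable_abse a.
  by move=> x Dx; exact: normr_Re_le.
rewrite (le_trans (le_normr_Rintegral mD b))//.
apply: le_Rintegral => //; first exact: integrable_abse b.
by move=> x Dx; exact: normr_Im_le.
Qed.

Lemma cint_dominated D (F : nat -> T -> R[i]) f (g : T -> R) : measurable D ->
  (forall n, cmeas D (F n)) -> cmeas D f ->
  {ae mu, forall x, D x -> ccvg (F ^~ x) (f x)} ->
  mu.-integrable D (fun x => (g x)%:E) ->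
  (forall n x, D x -> cabs (F n x) <= g x) ->
  cintegrable D f /\ ccvg (fun n => cint D (F n)) (cint D f).
Proof.
move=> mD mF [mfr mfi] Ff ig Fg.
have Fint n : cintegrable D (F n) by apply: cintegrable_le ig _ => //; exact: Fg.
(* Real dominated convergence is applied twice, with [p] the real and the imaginary part. *)
have key (p : R[i] -> R) : (forall x, `|p x| <= cabs x) ->
    (forall n, measurable_fun D (fun x => p (F n x))) ->
    measurable_fun D (fun x => p (f x)) ->
    {ae mu, forall x, D x -> p (F n x) @[n --> \oo] --> p (f x)} ->
    mu.-integrable D (fun x => (p (f x))%:E) /\
    Rintegral mu D (fun x => p (F n x)) @[n --> \oo] --> Rintegral mu D (fun x => p (f x)).
  move=> ple mpF mpf cpF.
  have h1 n : measurable_fun D (fun x => (p (F n x))%:E) by exact/measurable_EFinP.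
  have h2 : measurable_fun D (fun x => (p (f x))%:E) by exact/measurable_EFinP.
  have h3 : {ae mu, forall x, D x -> (p (F n x))%:E @[n --> \oo] --> (p (f x))%:E}.
    apply: filterS cpF => x h Dx; apply: cvg_EFin; first exact: nearW.
    exact: h.
  have h4 : {ae mu, forall x n, D x -> (`|(p (F n x))%:E| <= (g x)%:E)%E}.
    apply: aeW => x n Dx /=; rewrite lee_fin (le_trans (ple _))//; exact: Fg.
  have [ip _ cp] := dominated_convergence mD h1 h2 h3 ig h4.
  split => //; apply: fine_cvg; rewrite fineK//.
  exact: integrable_fin_num.
have [||ir cr] := key _ (@normr_Re_le R) _ mfr; first by move=> n; case: (mF n).
  by apply: filterS Ff => x h Dx; case: (h Dx).
have [||ii ci] := key _ (@normr_Im_le R) _ mfi; first by move=> n; case: (mF n).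
  by apply: filterS Ff => x h Dx; case: (h Dx).
by split; split.
Qed.

End Cint.

(** * Fubini and image measures for complex-valued integrals *)

Section Fubini.
Context d1 d2 (T1 : measurableType d1) (T2 : measurableType d2) (R : realType).
Variables (m1 : {sigma_finite_measure set T1 -> \bar R}).
Variables (m2 : {sigma_finite_measure set T2 -> \bar R}).
Local Notation Re := (@complex.Re R).
Local Notation Im := (@complex.Im R).
Let m12 := (m1 \x m2)%E.

(** The inner integral of Fubini is extended real; being finite almost everywhere, it may be
    replaced by its [fine] under the outer integral. *)
Let fine_ae d (T : measurableType d) (m : {measure set T -> \bar R}) (F : T -> \bar R) :
  m.-integrable setT F ->
  m.-integrable setT (fun x => (fine (F x))%:E) /\
  fine (\int[m]_x (F x))%E = Rintegral m setT (fun x => fine (F x)).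
Proof.
move=> iF; have mF := measurable_int _ iF.
have mf : measurable_fun setT (fun x => (fine (F x))%:E).
  by apply/measurable_EFinP; exact: measurableT_comp.
split.
  apply: le_integrable iF => // x _.
  by case: (F x) => [r| |] /=; rewrite ?normr0 ?lexx ?leey.
rewrite /Rintegral; congr fine; apply: ae_eq_integral => //.
have := integrable_ae measurableT iF; apply: filterS => x h _.
by rewrite fineK// h.
Qed.

Lemma Rintegral_fubini1 (f : T1 * T2 -> R) : m12.-integrable setT (fun x => (f x)%:E) ->
  m1.-integrable setT (fun x => (Rintegral m2 setT (fun y => f (x, y)))%:E) /\
  Rintegral m12 setT f = Rintegral m1 setT (fun x => Rintegral m2 setT (fun y => f (x, y))).
Proof.
move=> if_; have [a b] := fine_ae (integrable_fubini_F if_).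
split; first exact: a.
by rewrite /Rintegral -(integral12_prod_meas1 if_) b.
Qed.

Lemma Rintegral_fubini2 (f : T1 * T2 -> R) : m12.-integrable setT (fun x => (f x)%:E) ->
  m2.-integrable setT (fun y => (Rintegral m1 setT (fun x => f (x, y)))%:E) /\
  Rintegral m12 setT f = Rintegral m2 setT (fun y => Rintegral m1 setT (fun x => f (x, y))).
Proof.
move=> if_; have [|a b] := @fine_ae _ _ m2 (fubini_G m1 (fun x => (f x)%:E)).
  apply/integrableP; split; first exact: measurable_fubini_G if_.
  have mf := measurable_int _ if_.
  have := ((@integrable21ltyP _ _ _ _ _ m1 m2 _ mf).1) if_; apply: le_lt_trans.
  apply: ge0_le_integral => //.
  - by apply: measurableT_comp => //; exact: measurable_fubini_G if_.
  - apply: (@measurable_fun_fubini_tonelli_G _ _ _ _ _ m1 (fun z => `|(f z)%:E|%E)) => //.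
    exact: measurableT_comp.
  - move=> y _; apply: le_abse_integral => //.
    exact: (measurableT_comp mf (pair2_measurable y)).
split; first exact: a.
by rewrite /Rintegral -(integral21_prod_meas1 if_) b.
Qed.

Lemma cint_mkcond d (T : measurableType d) (m : {measure set T -> \bar R}) (D : set T)
  (f : T -> R[i]) : cint m D f = cint m setT (fun x => if x \in D then f x else 0).
Proof.
rewrite /cint; congr (_ +i* _); rewrite Rintegral_mkcond; apply: eq_Rintegral => x _;
  by rewrite patchE; case: ifPn.
Qed.

Lemma cintegrable_mkcond d (T : measurableType d) (m : {measure set T -> \bar R})
  (D : set T) (f : T -> R[i]) : measurable D ->
  cintegrable m D f <-> cintegrable m setT (fun x => if x \in D then f x else 0).
Proof.
move=> mD; rewrite /cintegrable !(integrable_mkcond _ mD).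
rewrite (_ : (_ \_ D) = (fun x => (Re (if x \in D then f x else 0))%:E)); last first.
  by apply/funext => x; rewrite patchE; case: ifPn.
rewrite (_ : (_ \_ D) = (fun x => (Im (if x \in D then f x else 0))%:E))//.
by apply/funext => x; rewrite patchE; case: ifPn.
Qed.

Lemma cint_fubini1 (D : set (T1 * T2)) (f : T1 * T2 -> R[i]) : measurable D ->
  cintegrable m12 D f ->
  cintegrable m1 setT (fun x => cint m2 [set y | D (x, y)] (fun y => f (x, y))) /\
  cint m12 D f = cint m1 setT (fun x => cint m2 [set y | D (x, y)] (fun y => f (x, y))).
Proof.
move=> mD /(cintegrable_mkcond _ _ mD)[/Rintegral_fubini1[a b] /Rintegral_fubini1[c e]].
have E x : cint m2 [set y | D (x, y)] (fun y => f (x, y)) =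
   (Rintegral m2 setT (fun y => Re (if (x, y) \in D then f (x, y) else 0))) +i*
   (Rintegral m2 setT (fun y => Im (if (x, y) \in D then f (x, y) else 0))).
  rewrite cint_mkcond /cint; congr (_ +i* _); apply: eq_Rintegral => y _;
    by rewrite (_ : (y \in _) = ((x, y) \in D))//; apply/idP/idP; rewrite !inE.
split; first by under eq_fun do rewrite E; split.
under [RHS]eq_cint do rewrite E.
by rewrite cint_mkcond /cint /= b e.
Qed.

Lemma cint_fubini2 (D : set (T1 * T2)) (f : T1 * T2 -> R[i]) : measurable D ->
  cintegrable m12 D f ->
  cintegrable m2 setT (fun y => cint m1 [set x | D (x, y)] (fun x => f (x, y))) /\
  cint m12 D f = cint m2 setT (fun y => cint m1 [set x | D (x, y)] (fun x => f (x, y))).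
Proof.
move=> mD /(cintegrable_mkcond _ _ mD)[/Rintegral_fubini2[a b] /Rintegral_fubini2[c e]].
have E y : cint m1 [set x | D (x, y)] (fun x => f (x, y)) =
   (Rintegral m1 setT (fun x => Re (if (x, y) \in D then f (x, y) else 0))) +i*
   (Rintegral m1 setT (fun x => Im (if (x, y) \in D then f (x, y) else 0))).
  rewrite cint_mkcond /cint; congr (_ +i* _); apply: eq_Rintegral => x _;
    by rewrite (_ : (x \in _) = ((x, y) \in D))//; apply/idP/idP; rewrite !inE.
split; first by under eq_fun do rewrite E; split.
under [RHS]eq_cint do rewrite E.
by rewrite cint_mkcond /cint /= b e.
Qed.

Lemma cint_set0 d (T : measurableType d) (m : {measure set T -> \bar R}) (f : T -> R[i]) :
  cint m set0 f = 0.
Proof. by apply: complex_eq => /=; rewrite Rintegral_set0. Qed.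

End Fubini.

Section Pushforward.
Context d1 d2 (T1 : measurableType d1) (T2 : measurableType d2) (R : realType).
Variables (m : {measure set T1 -> \bar R}) (m' : {measure set T2 -> \bar R}).
Variable (h : T1 -> T2).
Hypotheses (mh : measurable_fun setT h) (m'E : forall A, measurable A -> m' A = m (h @^-1` A)).

(** The image measure enters through an equality of values on measurable sets, which covers both
    [lebCn], a fixpoint on set functions, and the passage between [leb] and [lebesgue_measure]. *)
Lemma cint_pushforward (D : set T2) (f : T2 -> R[i]) : measurable D ->
  cintegrable m' D f ->
  cintegrable m (h @^-1` D) (f \o h) /\ cint m' D f = cint m (h @^-1` D) (f \o h).
Proof.
move=> mD ci.
have mhD : measurable (h @^-1` D) by rewrite -[X in measurable X]setTI; exact: mh.
pose pf : {measure set T2 -> \bar R} :=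
  measure_function_pushforward__canonical__measure_function_Measure m mh.
have key (g : T2 -> R) : m'.-integrable D (fun x => (g x)%:E) ->
    m.-integrable (h @^-1` D) (fun x => (g (h x))%:E) /\
    Rintegral m' D g = Rintegral m (h @^-1` D) (g \o h).
  move=> ig.
  have mg : measurable_fun D g by apply/measurable_EFinP; exact: measurable_int ig.
  have eqm (F : T2 -> \bar R) : (\int[m']_(x in D) F x = \int[pf]_(x in D) F x)%E.
    by apply: eq_measure_integral => A mA AD; rewrite m'E.
  have igh : m.-integrable (h @^-1` D) (fun x => (g (h x))%:E).
    apply/integrableP; split.
      apply/measurable_EFinP.
      apply: (@measurable_comp _ _ _ _ _ _ D g _ h) => //.
        by move=> _ [x ? <-].
      exact: measurable_funTS.
    have /integrableP[_] := ig; rewrite eqm.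
    rewrite (@ge0_integral_pushforward _ _ _ _ _ _ mh m D (fun x => `|(g x)%:E|%E))//.
    by apply/measurable_EFinP/measurableT_comp.
  split => //; rewrite /Rintegral; congr fine; rewrite eqm.
  rewrite integral_mkcond.
  rewrite (@integral_pushforward _ _ _ _ _ _ mh m setT)//; last 2 first.
  - apply/(measurable_restrictT _ mD).1 => //; exact/measurable_EFinP.
  - rewrite preimage_setT.
    move/(integrable_mkcond _ mhD): igh.
    by apply: eq_integrable => // x _; rewrite /= !patchE.
  rewrite [RHS]integral_mkcond; apply: eq_integral => x _.
  by rewrite /= !patchE.
by case: ci => /key[a b] /key[c e]; split => //; rewrite /cint b e.
Qed.

End Pushforward.

Section SigmaFinite.
Context d (T : measurableType d) (R : realType) (m : {measure set T -> \bar R}).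
Hypothesis m_sf : sigma_finite setT m.

(** A fresh name for [m], to which the sigma-finite structure is attached. *)
Let sfm : set T -> \bar R := m.
Let sf_sfm : sigma_finite setT sfm. Proof. exact: m_sf. Qed.
HB.instance Definition _ := Measure.on sfm.
HB.instance Definition _ := Measure_isSigmaFinite.Build _ _ _ sfm sf_sfm.
Definition sigma_finite_of : {sigma_finite_measure set T -> \bar R} := sfm.

Lemma sigma_finite_ofE : (sigma_finite_of : set T -> \bar R) = m.
Proof. by []. Qed.

End SigmaFinite.

Section Product.
Context d1 d2 (T1 : measurableType d1) (T2 : measurableType d2) (R : realType).
Variables (m1 : {sigma_finite_measure set T1 -> \bar R}).
Variables (m2 : {sigma_finite_measure set T2 -> \bar R}).

Let prod_sigma_finite : sigma_finite setT (m1 \x m2)%E.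
Proof.
have [F FT Foo] := sigma_finiteT m1; have [G GT Goo] := sigma_finiteT m2.
pose H n := if unpickle n is Some (i, j) then F i `*` G j else set0.
exists H.
  apply/seteqP; split => // -[x y] _.
  have [i _ Fi] : (\bigcup_i F i) x by rewrite -FT.
  have [j _ Gj] : (\bigcup_i G i) y by rewrite -GT.
  by exists (pickle (i, j)) => //; rewrite /H pickleK.
rewrite /H => n; case: (unpickle n) => [[i j]|]; last by split => //; rewrite measure0.
have [mF Fi] := Foo i; have [mG Gj] := Goo j; split; first exact: measurableX.
by rewrite product_measure1E// lte_mul_pinfty// ge0_fin_numE.
Qed.

Definition prodm : {sigma_finite_measure set (T1 * T2)%type -> \bar R} :=
  sigma_finite_of prod_sigma_finite.

End Product.

(** * Lebesgue measure on complex space *)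

Section LebCn.
Variable R : realType.

Let lebT : {sigma_finite_measure set (measurableTypeR R) -> \bar R} := @lebesgue_measure R.
Let idR : measurableTypeR R -> R := id.

Let measurable_idR : measurable_fun setT idR.
Proof. by move=> _ Y mY; rewrite setTI. Qed.

Let leb0 : {measure set R -> \bar R} :=
  measure_function_pushforward__canonical__measure_function_Measure lebT measurable_idR.

Let sf_leb0 : sigma_finite setT leb0.
Proof. by have [F FT Foo] := sigma_finiteT lebT; exists F. Qed.

(* [lebesgue_measure] is declared on [measurableTypeR R], whose display differs
   from that of [R] used in [lebC]; the sigma-algebras coincide. *)
Definition leb : {sigma_finite_measure set R -> \bar R} := sigma_finite_of sf_leb0.

Lemma lebE (A : set R) : leb A = @lebesgue_measure R A. Proof. by []. Qed.

Definition lebCm : {sigma_finite_measure set (R * R)%type -> \bar R} := prodm leb leb.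

Definition consT n (p : (R * R) * n.-tuple (R * R)) : n.+1.-tuple (R * R)%type := cons_tuple p.1 p.2.

Lemma measurable_consT n : measurable_fun setT (@consT n).
Proof. exact: measurable_cons. Qed.

(** The fixpoint [lebCn] yields bare set functions. The measure structure comes by induction, as the
    image under [consT] of a product; sigma-finiteness is carried over by the inverse [un]. *)
Lemma lebCn_measure n : {m : {sigma_finite_measure set (n.-tuple (R * R)%type) -> \bar R} |
  (m : set _ -> \bar R) = lebCn n}.
Proof.
elim: n => [|n [m IH]].
  by exists (\d_([tuple] : 0.-tuple (R * R)%type) : {sigma_finite_measure set _ -> \bar R}).
pose mp : {sigma_finite_measure set ((R * R) * n.-tuple (R * R))%type -> \bar R} := prodm lebCm m.
pose pf : {measure set (n.+1.-tuple (R * R)%type) -> \bar R} :=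
  measure_function_pushforward__canonical__measure_function_Measure mp (@measurable_consT n).
pose un (x : n.+1.-tuple (R * R)%type) := (thead x, [tuple of behead x]).
have mun : measurable_fun setT un.
  apply: measurable_fun_pair; first exact: measurable_tnth.
  apply/measurable_fun_tnthP => i; rewrite (_ : _ \o _ = fun x => tnth x (lift ord0 i)).
    exact: measurable_tnth.
  by apply/funext => x /=; rewrite (tnth_nth (0, 0)) [RHS](tnth_nth (0, 0)) /= nth_behead.
have unK : forall p, un (@consT n p) = p.
  by move=> [p t]; rewrite /un /consT /=; congr (_, _); exact: val_inj.
have sf : sigma_finite setT pf.
  have [F FT Foo] := sigma_finiteT mp.
  exists (fun k => un @^-1` (F k)).
    by rewrite -preimage_bigcup -FT preimage_setT.
  move=> k; have [mF Fk] := Foo k; split.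
    by rewrite -[X in measurable X]setTI; exact: mun.
  rewrite /= /pushforward -comp_preimage (_ : un \o _ = id)//.
  by apply/funext => p /=; rewrite unK.
exists (sigma_finite_of sf).
by apply/funext => A; rewrite sigma_finite_ofE /= /pushforward /= -IH.
Qed.

Definition lebCnm n := projT1 (lebCn_measure n).
Lemma lebCnmE n : (lebCnm n : set _ -> \bar R) = lebCn n.
Proof. exact: (projT2 (lebCn_measure n)). Qed.

Lemma lebCnmS n A : lebCnm n.+1 A = (lebCm \x lebCnm n)%E (@consT n @^-1` A).
Proof. by rewrite lebCnmE /= -lebCnmE. Qed.

Lemma lebCnm0 A : lebCnm 0 A = \d_([tuple] : 0.-tuple (R * R)%type) A.
Proof. by rewrite lebCnmE. Qed.

Lemma cmeas_toC n (i : 'I_n) : cmeas setT (fun x : n.-tuple (R * R)%type => toC x i).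
Proof.
split => /=.
  exact: (measurableT_comp (@measurable_fst _ _ _ _) (@measurable_tnth _ _ _ i)).
exact: (measurableT_comp (@measurable_snd _ _ _ _) (@measurable_tnth _ _ _ i)).
Qed.

Lemma measurable_normsq n : measurable_fun setT (fun x : n.-tuple (R * R)%type => normsq (toC x)).
Proof. by apply: measurable_sum => i; apply: measurable_absC2; exact: cmeas_toC. Qed.

Lemma measurable_ballr n (r : R) : measurable [set x : n.-tuple (R * R)%type | normsq (toC x) < r].
Proof.
have := @measurable_normsq n measurableT `]-oo, r[%classic.
rewrite setTI => /(_ (measurable_itv _)).
by congr measurable; apply/seteqP; split => x /=; rewrite in_itv /=.
Qed.

Lemma measurable_ballT n : measurable (@ballT R n).
Proof. exact: measurable_ballr. Qed.

Lemma normsq_consT n p : normsq (toC (@consT n p)) = absC2 (p.1.1 +i* p.1.2) + normsq (toC p.2).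
Proof.
rewrite /normsq big_ord_recl /toC /consT /= tnth0; congr (_ + _).
by apply: eq_bigr => i _; rewrite tnthS.
Qed.

Lemma toC_consT0 n p : toC (@consT n p) ord0 = p.1.1 +i* p.1.2.
Proof. by rewrite /toC /consT tnth0. Qed.
Lemma toC_consTS n p i : toC (@consT n p) (lift ord0 i) = toC p.2 i.
Proof. by rewrite /toC /consT tnthS. Qed.

Lemma normsq_ge0 n (z : cvec R n) : 0 <= normsq z.
Proof. by apply: sumr_ge0 => i _; exact: absC2_ge0. Qed.

End LebCn.

(** * The fundamental theorem of calculus for complex polynomials *)

Section PolyFTC.
Variable R : realType.
Local Notation leb := (@leb R).
Local Notation Re := (@complex.Re R).
Local Notation Im := (@complex.Im R).

Lemma leb_fin_itv (a b : R) (ba bb : bool) :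
  (leb [set` Interval (BSide ba a) (BSide bb b)] < +oo)%E.
Proof. by rewrite lebE lebesgue_measure_itv /=; case: ifP => _; rewrite ?ltry// -EFinB ltry. Qed.

Lemma measurable_horner (q : {poly R}) : measurable_fun setT (horner q).
Proof. by apply: continuous_measurable_fun; exact: continuous_horner. Qed.

Lemma horner_bounded (q : {poly R}) (a b : R) :
  exists M, forall x, x \in `]a, b[ -> `|q.[x]| <= M.
Proof.
exists (\sum_(i < size q) `|q`_i| * (`|a| + `|b|) ^+ i) => x; rewrite in_itv /= => /andP[ax xb].
rewrite horner_coef (le_trans (ler_norm_sum _ _ _))//; apply: ler_sum => i _.
rewrite normrM normrX ler_wpM2l//; apply: lerXn2r; rewrite ?nnegrE ?addr_ge0//.
rewrite ler_norml; apply/andP; split.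
  have := ler_norm (- a); have := normr_ge0 b; rewrite normrN; lra.
have := ler_norm b; have := normr_ge0 a; lra.
Qed.

Lemma ftc_horner (p : {poly R}) (a b : R) : a < b ->
  Rintegral (@lebesgue_measure R) `]a, b[ (fun x => p^`().[x]) = p.[b] - p.[a].
Proof.
move=> ab.
have E := @continuous_FTC2 R (horner (p^`())) (horner p) a b ab.
rewrite /Rintegral -(@integral_itv_bndoo R a b _ true false); last first.
  by apply/measurable_EFinP; apply: measurable_funTS; exact: measurable_horner.
rewrite E.
- by rewrite -EFinB.
- exact/continuous_subspaceT/continuous_horner.
- split.
  + by move=> x _; exact: derivable_horner.
  + exact/cvg_at_right_filter/continuous_horner.
  + exact/cvg_at_left_filter/continuous_horner.
- by move=> x _; rewrite derivE.
Qed.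

Lemma poly_ReIm (P : {poly R[i]}) : exists p q : {poly R},
  P = map_poly (real_complex R) p + 'i%:P * map_poly (real_complex R) q.
Proof.
elim/poly_ind: P => [|P c [p [q ->]]]; first by exists 0, 0; rewrite !rmorph0 mulr0 addr0.
exists (p * 'X + (Re c)%:P), (q * 'X + (Im c)%:P).
rewrite !rmorphD !rmorphM /= map_polyX !map_polyC /= mulrDl.
rewrite [in RHS]mulrDr addrACA mulrA; congr (_ + _).
by rewrite -polyCM -polyCD -complexE.
Qed.

Lemma cint_leb_deriv (P : {poly R[i]}) (a b : R) : a < b ->
  cint leb `]a, b[ (fun x => P^`().[x%:C]) = P.[b%:C] - P.[a%:C].
Proof.
move=> ab; have [p [q ->]] := poly_ReIm P.
pose ev (p q : {poly R}) x := p.[x] +i* q.[x].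
have evE (p' q' : {poly R}) x :
    (map_poly (real_complex R) p' + 'i%:P * map_poly (real_complex R) q').[x%:C] = ev p' q' x.
  by rewrite hornerD hornerM hornerC !horner_map; apply: complex_eq; rewrite /ev /=; ring.
under eq_cint do rewrite derivD derivM derivC mul0r add0r !deriv_map evE.
rewrite !evE.
have mid : measurable_fun setT (id : measurableTypeR R -> R).
  by move=> _ Y mY; rewrite setTI.
have ci : cintegrable leb `]a, b[ (ev (p^`()) (q^`())).
  have [M hM] := horner_bounded (p^`()) a b; have [L hL] := horner_bounded (q^`()) a b.
  apply: (@cintegrable_le _ _ _ _ _ _ (cst (M + L))) => //.
  - by split; apply: measurable_funTS; exact: measurable_horner.
  - apply: measurable_bounded_integrable => //; first exact: leb_fin_itv.
    exact: bounded_cst.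
  - by move=> x xab; rewrite (le_trans (cabs_le _))//= lerD ?hM ?hL.
have lE (A : set R) : measurable A -> leb A = lebesgue_measure (id @^-1` A : set (measurableTypeR R)) by [].
have mab : measurable (`]a, b[%classic : set R) by exact: measurable_itv.
have [_ ->] := cint_pushforward mid lE mab ci.
by apply: complex_eq; rewrite /= ftc_horner// ?ReD ?ImD ?ReN ?ImN.
Qed.

End PolyFTC.

(** * Integrals over discs *)

Section DiscMoments.
Variable R : realType.
Local Notation leb := (@leb R).
Local Notation lebCm := (@lebCm R).
Local Notation Re := (@complex.Re R).
Local Notation Im := (@complex.Im R).
Implicit Types (p : R * R) (r : R).

Definition zc p : R[i] := p.1 +i* p.2.
Definition disc r : set (R * R)%type := [set p | absC2 (zc p) < r].

Lemma cmeas_zc : cmeas setT zc.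
Proof. by split; [exact: measurable_fst|exact: measurable_snd]. Qed.

Lemma measurable_disc r : measurable (disc r).
Proof.
have m : measurable_fun setT (fun p => absC2 (zc p)) by exact: measurable_absC2 cmeas_zc.
have := m measurableT `]-oo, r[%classic.
rewrite setTI => /(_ (measurable_itv _)).
by congr measurable; apply/seteqP; split => x /=; rewrite in_itv /=.
Qed.

Lemma disc_fin r : (lebCm (disc r) < +oo)%E.
Proof.
pose I : set R := `](- (1 + `|r|)), (1 + `|r|)[%classic.
have mI : measurable I by exact: measurable_itv.
have sub : disc r `<=` I `*` I.
  have key (a b : R) : a ^+ 2 + b ^+ 2 < r -> - (1 + `|r|) < a < 1 + `|r|.
    move=> h; have h0 : 0 <= `|r| by []. have h1 := ler_norm r.
    have := sqr_ge0 b; nra.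
  move=> [a b]; rewrite /disc /zc /absC2 /= => h; split; rewrite /I /= in_itv /=.
    exact: key h.
  by apply: (key _ a); rewrite addrC.
apply: (@le_lt_trans _ _ (lebCm (I `*` I))).
  by apply: le_measure => //; rewrite inE; [exact: measurable_disc|exact: measurableX].
have -> : lebCm (I `*` I) = (leb I * leb I)%E by exact: product_measure1E.
by rewrite lte_mul_pinfty// ?ge0_fin_numE//; exact: leb_fin_itv.
Qed.

Lemma disc_integrable r (f : R * R -> R[i]) (M : R) : cmeas setT f ->
  (forall p, disc r p -> cabs (f p) <= M) -> cintegrable lebCm (disc r) f.
Proof.
move=> mf fM; apply: (@cintegrable_le _ _ _ _ _ _ (cst M)) => //.
- exact: measurable_disc.
- by apply: cmeas_subset mf.
- apply: measurable_bounded_integrable; [exact: measurable_disc|exact: disc_fin|by []|].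
  exact: bounded_cst.
Qed.

(** The factor [(r - |z|^2)^s] is what integrating out the other coordinates of a ball of squared
    radius [r] leaves on one coordinate. *)
Definition Jf (a b s : nat) r p : R[i] :=
  zc p ^+ a * (zc p)^^* ^+ b * ((r - absC2 (zc p)) ^+ s)%:C.

Lemma cmeas_Jf a b s r : cmeas setT (Jf a b s r).
Proof.
have mz := cmeas_zc.
apply: cmeasM; first by apply: cmeasM; apply: cmeasX => //; exact: cmeas_conj.
apply: cmeas_real; apply: measurable_funX; apply: measurable_funB => //.
exact: measurable_absC2.
Qed.

Lemma disc_cabs_zc r p : disc r p -> cabs (zc p) <= 1 + `|r|.
Proof.
rewrite /disc /= -cabs_sqr => h; have := ler_norm r; have := cabs_ge0 (zc p).
have : 0 <= `|r| by []. nra.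
Qed.

Lemma cabs_Jf_le a b s r p : disc r p -> cabs (Jf a b s r p) <= (1 + `|r|) ^+ (a + b + s).
Proof.
move=> h; have z1 := disc_cabs_zc h.
have rp : `|r - absC2 (zc p)| <= 1 + `|r|.
  move: h; rewrite /disc /= => h; rewrite ger0_norm ?subr_ge0 ?(ltW h)//.
  by have := absC2_ge0 (zc p); have := ler_norm r; lra.
rewrite !cabsM !cabsX cabs_conj cabs_real normrX !exprD.
by do ?[apply: ler_pM]; rewrite ?mulr_ge0 ?exprn_ge0 ?cabs_ge0//; apply: lerXn2r;
  rewrite ?nnegrE ?cabs_ge0 ?addr_ge0.
Qed.

Lemma integrable_Jf a b s r : cintegrable lebCm (disc r) (Jf a b s r).
Proof. by apply: (disc_integrable (@cmeas_Jf _ _ _ _)) => p; exact: cabs_Jf_le. Qed.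

Definition J a b s r := cint lebCm (disc r) (Jf a b s r).

Lemma sqr_lt_itv (c : R) : 0 < c ->
  [set x : R | x ^+ 2 < c] = `]- Num.sqrt c, Num.sqrt c[%classic.
Proof.
move=> c0; have key (x : R) : (x ^+ 2 < c) = (`|x| < Num.sqrt c).
  rewrite -[in LHS](sqr_sqrtr (ltW c0)) -(real_normK (num_real x)).
  by rewrite ltr_pXn2r ?nnegrE ?sqrtr_ge0.
by apply/seteqP; split => x /=; rewrite in_itv /= -ltr_norml key.
Qed.

(** The integrand is the derivative of [Q(x) (c - x^2)^(s+1)], which vanishes at both ends of the
    slice. *)
Lemma slice_ftc (c : R) (Q : {poly R[i]}) s :
  cint leb [set x : R | x ^+ 2 < c] (fun x => (Q^`()).[x%:C] * ((c - x ^+ 2) ^+ s.+1)%:C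
     - Q.[x%:C] * (2 * s.+1%:R * x * (c - x ^+ 2) ^+ s)%:C) = 0.
Proof.
have [c0|c0] := leP c 0.
  rewrite (_ : [set x | _] = set0) ?cint_set0// -subset0 => x /=.
  by rewrite ltNge (le_trans c0)// sqr_ge0.
rewrite sqr_lt_itv//.
have sc : - Num.sqrt c < Num.sqrt c by rewrite gtrN// sqrtr_gt0.
pose P := Q * (c%:C%:P - 'X ^+ 2) ^+ s.+1.
have PE x : P^`().[x%:C] = (Q^`()).[x%:C] * ((c - x ^+ 2) ^+ s.+1)%:C
     - Q.[x%:C] * (2 * s.+1%:R * x * (c - x ^+ 2) ^+ s)%:C.
  rewrite /P derivM deriv_exp derivB derivC derivXn /= hornerD !hornerM.
  rewrite hornerMn hornerM !horner_exp !hornerE /= !rmorphM !rmorphXn rmorphB rmorphXn /=.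
  rewrite rmorph_nat; congr (_ + _).
  rewrite -[_ *+ s.+1]mulr_natr -natcE; ring.
under eq_cint do rewrite -PE.
rewrite cint_leb_deriv// /P !hornerM !horner_exp !hornerE /=.
rewrite -!rmorphXn /= sqrrN sqr_sqrtr ?(ltW c0)// subrr expr0n /= !mulr0.
by rewrite subrr.
Qed.

End DiscMoments.

Section DiscRec.
Variable R : realType.
Local Notation leb := (@leb R).
Local Notation lebCm := (@lebCm R).
Local Notation Re := (@complex.Re R).
Local Notation Im := (@complex.Im R).
Implicit Types (p : R * R) (r : R).

Lemma leb_scale (c : R) (A : set R) : 0 < c -> measurable A ->
  leb A = (c%:E * leb [set x | A (c * x)%R])%E.
Proof.
move=> c0 mA.
have mh : measurable_fun setT (fun x : measurableTypeR R => c * x : measurableTypeR R).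
  exact: mulrl_measurable.
pose pf : {measure set (measurableTypeR R) -> \bar R} :=
  mscale (NngNum (ltW c0)) (measure_function_pushforward__canonical__measure_function_Measure
    (@lebesgue_measure R) mh).
have := @lebesgue_measure_unique R pf; apply => // X [[a b] _ <-].
rewrite /pf /= /mscale /= /pushforward.
rewrite (_ : _ @^-1` _ = `](a / c), (b / c)]%classic); last first.
  apply/seteqP; split => x /=; rewrite !in_itv /= ltr_pdivrMr// ler_pdivlMr// mulrC//.
rewrite !lebesgue_measure_itv /= !lte_fin ltr_pM2r ?invr_gt0//.
case: ifP => _; last by rewrite mule0.
by rewrite -!EFinB -EFinM; congr EFin; field; rewrite gt_eqF.
Qed.

Lemma lebCm_scale (c : R) (A : set (R * R)%type) : 0 < c -> measurable A ->
  lebCm A = ((c ^+ 2)%R%:E * lebCm [set p | A (c * p.1, c * p.2)%R])%E.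
Proof.
move=> c0 mA.
pose h (p : R * R) : R * R := (c * p.1, c * p.2).
have mh : measurable_fun setT h.
  apply: measurable_fun_pair; apply: measurable_funM => //.
have c20 : 0 <= c ^+ 2 by exact: sqr_ge0.
pose pf : {measure set (R * R)%type -> \bar R} :=
  mscale (NngNum c20) (measure_function_pushforward__canonical__measure_function_Measure
    lebCm mh).
apply: (@product_measure_unique _ _ _ _ _ leb leb pf) => // X Y mX mY.
rewrite /pf /= /mscale /= /pushforward (leb_scale c0 mX) (leb_scale c0 mY).
rewrite (_ : h @^-1` _ = [set x | X (c * x)] `*` [set x | Y (c * x)]); last first.
  by apply/seteqP; split => -[x y].
have mXc (Z : set R) : measurable Z -> measurable [set x | Z (c * x)].
  move=> mZ; have m : measurable_fun setT (fun x : R => c * x) by exact: mulrl_measurable.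
  by have := m measurableT _ mZ; rewrite setTI.
have -> : lebCm ([set x | X (c * x)] `*` [set x | Y (c * x)]) =
    (leb [set x | X (c * x)%R] * leb [set x | Y (c * x)%R])%E.
  by apply: product_measure1E; exact: mXc.
by rewrite expr2 EFinM muleACA.
Qed.

Lemma disc_area r : 0 < r -> lebCm (disc r) = (r%:E * lebCm (disc 1))%E.
Proof.
move=> r0; have s0 : 0 < Num.sqrt r by rewrite sqrtr_gt0.
rewrite (lebCm_scale s0 (@measurable_disc R r)) sqr_sqrtr ?ltW//.
congr (_ * lebCm _)%E; apply/seteqP; split => -[x y]; rewrite /disc /zc /absC2 /=.
  by rewrite !exprMn -mulrDr sqr_sqrtr ?ltW// -[X in _ < X]mulr1 ltr_pM2l.
by rewrite !exprMn -mulrDr sqr_sqrtr ?ltW// -[X in _ -> _ < X]mulr1 ltr_pM2l.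
Qed.

(** This number is pi; it stays symbolic because it cancels in the normalized volume. *)
Definition area : R := fine (lebCm (disc 1)).

Lemma area_gt0 : 0 < area.
Proof.
have h : (0 < lebCm (disc 1))%E.
  pose I : set R := `](- 2^-1), 2^-1[%classic.
  have mI : measurable I by exact: measurable_itv.
  have sub : I `*` I `<=` @disc R 1.
    move=> [a b]; rewrite /I /disc /zc /absC2 /= !in_itv /= => -[/andP[? ?] /andP[? ?]]; nra.
  apply: (@lt_le_trans _ _ (lebCm (I `*` I))); last first.
    by apply: le_measure => //; rewrite inE; [exact: measurableX|exact: measurable_disc].
  have -> : lebCm (I `*` I) = (leb I * leb I)%E by exact: product_measure1E.
  rewrite /I lebE lebesgue_measure_itv /= lte_fin gtrN ?invr_gt0//.
  by rewrite -EFinB -EFinM lte_fin; lra.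
by rewrite /area fine_gt0// h disc_fin.
Qed.

Lemma J000 r : 0 <= r -> J 0 0 0 r = (r * area)%:C.
Proof.
move=> r0; rewrite /J; transitivity (cint lebCm (disc r) (fun=> 1)).
  by apply: eq_cint => p _; rewrite /Jf !expr0 !mul1r.
rewrite /cint /=; rewrite Rintegral_cst ?mul1r; last exact: measurable_disc.
rewrite Rintegral_cst ?mul0r; last exact: measurable_disc.
move: r0; rewrite le_eqVlt => /predU1P[<-|r0].
  rewrite (_ : disc 0 = set0) ?measure0 ?mul0r//.
  by rewrite -subset0 => p; rewrite /disc /= ltNge absC2_ge0.
rewrite disc_area// fineM//.
by rewrite ge0_fin_numE//; exact: disc_fin.
Qed.

(** Integration by parts for the derivative in the conjugate of [z]: [g1] and [g2] are the
    derivatives in [x] and [y] of [z^a conj(z)^b (r-|z|^2)^(s+1)], which vanishes on the boundary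
    circle, and [g1 + i g2] is twice the desired derivative. At [b = 0] the truncated [b.-1] comes
    with coefficient 0. *)
Lemma Jrec a b s r : J a.+1 b s r = (b%:R / s.+1%:R) * J a b.-1 s.+1 r.
Proof.
pose A p : R[i] := zc p ^+ a * (zc p)^^* ^+ b.
pose rho p : R := r - absC2 (zc p).
pose dx p : R[i] := a%:R * zc p ^+ a.-1 * (zc p)^^* ^+ b + b%:R * zc p ^+ a * (zc p)^^* ^+ b.-1.
pose dy p : R[i] := 'i * (a%:R * zc p ^+ a.-1 * (zc p)^^* ^+ b - b%:R * zc p ^+ a * (zc p)^^* ^+ b.-1).
pose g1 p : R[i] := dx p * ((rho p) ^+ s.+1)%:C - A p * (2 * s.+1%:R * p.1 * (rho p) ^+ s)%:C.
pose g2 p : R[i] := dy p * ((rho p) ^+ s.+1)%:C - A p * (2 * s.+1%:R * p.2 * (rho p) ^+ s)%:C.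
have mz := @cmeas_zc R; have mzc := cmeas_conj mz.
have mrho : measurable_fun setT rho.
  by apply: measurable_funB => //; exact: measurable_absC2.
have mA : cmeas setT A by apply: cmeasM; exact: cmeasX.
have g1E p : g1 p = (a%:R * Jf a.-1 b s.+1 r p + b%:R * Jf a b.-1 s.+1 r p)
   - s.+1%:R * (Jf a.+1 b s r p + Jf a b.+1 s r p).
  rewrite /g1 /dx /A /rho /Jf; set c := r - _.
  have -> : ((2 * s.+1%:R * p.1 * c ^+ s)%:C : R[i]) = s.+1%:R * (zc p + (zc p)^^*) * (c ^+ s)%:C.
    have -> : zc p + (zc p)^^* = 2 * (p.1)%:C by apply: complex_eq; rewrite /=; ring.
    rewrite !rmorphM !rmorph_nat /=; ring.
  rewrite !exprSr; ring.
have g2E p : g2 p = 'i * (a%:R * Jf a.-1 b s.+1 r p - b%:R * Jf a b.-1 s.+1 r p)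
   + 'i * (s.+1%:R * (Jf a.+1 b s r p - Jf a b.+1 s r p)).
  rewrite /g2 /dy /A /rho /Jf; set c := r - _.
  have -> : ((2 * s.+1%:R * p.2 * c ^+ s)%:C : R[i]) =
     - 'i * (s.+1%:R * (zc p - (zc p)^^*) * (c ^+ s)%:C).
    rewrite !rmorphM !rmorph_nat /=.
    have -> : zc p - (zc p)^^* = 2 * 'i * (p.2)%:C by apply: complex_eq; rewrite /=; ring.
    have i2 : ('i : R[i]) * 'i = -1 by apply: complex_eq; rewrite /=; ring.
    have -> : - 'i * (s.+1%:R * (2 * 'i * (p.2)%:C) * (c ^+ s)%:C) =
       - ('i * 'i) * (s.+1%:R * 2 * (p.2)%:C * (c ^+ s)%:C) :> R[i] by ring.
    rewrite i2; ring.
  rewrite !exprSr; ring.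
have iJ := @integrable_Jf R; have mD := @measurable_disc R r.
have ig1 : cintegrable lebCm (disc r) g1.
  rewrite (funext g1E); apply: cintegrableB => //.
    by apply: cintegrableD => //; exact: cintegrableZ.
  by apply: cintegrableZ => //; exact: cintegrableD.
have ig2 : cintegrable lebCm (disc r) g2.
  rewrite (funext g2E); apply: cintegrableD => //; apply: cintegrableZ => //.
    by apply: cintegrableB => //; exact: cintegrableZ.
  by apply: cintegrableZ => //; exact: cintegrableB.
have c1 : cint lebCm (disc r) g1 = 0.
  have [_ ->] := @cint_fubini2 _ _ _ _ _ leb leb _ _ mD ig1.
  rewrite -[RHS](@cint0 _ _ _ leb setT); apply: eq_cint => y _.
  pose Q : {poly R[i]} := ('X + (0 +i* y)%:P) ^+ a * ('X - (0 +i* y)%:P) ^+ b.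
  rewrite -[RHS](slice_ftc (r - y ^+ 2) Q s);
    rewrite (_ : [set x | _] = [set x | x ^+ 2 < r - y ^+ 2]); last first.
    by apply/seteqP; split => x; rewrite /disc /zc /absC2 /= ltrBrDr.
  apply: eq_cint => x _; rewrite /g1 /rho.
  have rE : r - absC2 (zc (x, y)) = r - y ^+ 2 - x ^+ 2 by rewrite /absC2 /=; ring.
  have zE : x%:C + (0 +i* y) = zc (x, y) by apply: complex_eq; rewrite /= ?addr0 ?add0r.
  have zcE : x%:C - (0 +i* y) = (zc (x, y))^^* by apply: complex_eq; rewrite /= ?oppr0 ?addr0 ?add0r.
  rewrite rE /Q derivM !deriv_exp derivD derivB derivX derivC addr0 subr0.
  rewrite !(hornerE, hornerMn, horner_exp) /= zE zcE /dx /A; congr (_ - _); congr (_ * _).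
  by rewrite !mulr_natl !mulrnAl !mulrnAr.
have c2 : cint lebCm (disc r) g2 = 0.
  have [_ ->] := @cint_fubini1 _ _ _ _ _ leb leb _ _ mD ig2.
  rewrite -[RHS](@cint0 _ _ _ leb setT); apply: eq_cint => x _.
  pose Q : {poly R[i]} := ('i%:P * 'X + x%:C%:P) ^+ a * (- 'i%:P * 'X + x%:C%:P) ^+ b.
  rewrite -[RHS](slice_ftc (r - x ^+ 2) Q s);
    rewrite (_ : [set y | _] = [set y | y ^+ 2 < r - x ^+ 2]); last first.
    by apply/seteqP; split => y; rewrite /disc /zc /absC2 /= ltrBrDl.
  apply: eq_cint => y _; rewrite /g2 /rho.
  have rE : r - absC2 (zc (x, y)) = r - x ^+ 2 - y ^+ 2 by rewrite /absC2 /=; ring.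
  have zE : 'i * y%:C + x%:C = zc (x, y) by apply: complex_eq; rewrite /=; ring.
  have zcE : - 'i * y%:C + x%:C = (zc (x, y))^^* by apply: complex_eq; rewrite /=; ring.
  rewrite rE /Q derivM !deriv_exp !derivD !derivM derivN !derivC derivX.
  rewrite !(hornerE, hornerMn, horner_exp) /= zE zcE /dy /A; congr (_ - _); congr (_ * _).
  rewrite oppr0 mul0r sub0r mulrBr !(mulr_natl, mulrnAl, mulrnAr, mulNr, mulrN, mulNrn).
  by congr (_ *+ _ - _ *+ _); [rewrite mulrA|rewrite mulrCA].
have : 0 = cint lebCm (disc r) (fun p => g1 p + 'i * g2 p).
  by rewrite cintD// ?cintZ ?c1 ?c2 ?mulr0 ?addr0//; exact: cintegrableZ.
have E p : g1 p + 'i * g2 p = (2 * b%:R) * Jf a b.-1 s.+1 r p - (2 * s.+1%:R) * Jf a.+1 b s r p.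
  rewrite g1E g2E.
  have i2 : ('i : R[i]) * 'i = -1 by apply: complex_eq; rewrite /=; ring.
  set u := a%:R * _; set v := b%:R * _; set w := s.+1%:R * (_ - _).
  rewrite [X in _ + X](_ : _ = ('i * 'i) * (u - v + w)); last by ring.
  rewrite i2 /u /v /w; ring.
rewrite (funext E) cintB//; [|exact: cintegrableZ..].
rewrite !cintZ// -/(J _ _ _ _) -/(J _ _ _ _) => /eqP; rewrite eq_sym subr_eq0 => /eqP h.
have n0 : (s.+1%:R : R[i]) != 0 by rewrite pnatr_eq0.
have t0 : (2 : R[i]) != 0 by rewrite pnatr_eq0.
apply: (mulfI n0); apply: (mulfI t0); rewrite mulrA -h; field.
by rewrite ?n0 ?andbT// pnatr_eq0.
Qed.

End DiscRec.

(** * Monomial moments over balls *)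

Section Moments.
Variable R : realType.
Local Notation leb := (@leb R).
Local Notation lebCm := (@lebCm R).
Local Notation area := (@area R).
Implicit Types (p : R * R) (r : R).

Lemma Jconj a b s r : J b a s r = (J a b s r)^^*.
Proof.
rewrite /J -cint_conj; [|exact: measurable_disc|exact: integrable_Jf].
apply: eq_cint => p _; by rewrite /Jf !conjM !conjX conjcK conjc_real [X in X * _]mulrC.
Qed.

Lemma J_rdiag a s r : J a a s r = (a`! * s`!)%:R / (s + a)`!%:R * J 0 0 (s + a) r.
Proof.
elim: a s => [|a IH] s; first by rewrite addn0 mul1n divff ?mul1r// pnatr_eq0 -lt0n fact_gt0.
rewrite Jrec /= IH mulrA addSnnS; congr (_ * _).
rewrite (factS a) (factS s) !natrM; field.
by rewrite nat1r !pnatr_eq0 -lt0n fact_gt0.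
Qed.

(** [Jrec] lowers both exponents together; when one reaches 0 and the other is positive, its
    coefficient, possibly after conjugation, is 0. *)
Lemma J_off a b s r : a != b -> J a b s r = 0.
Proof.
elim: a b s => [|a IH] [|b] s //; last by rewrite eqSS => /IH h; rewrite Jrec /= h mulr0.
  by rewrite Jconj Jrec mul0r mul0r conjc0.
by rewrite Jrec !mul0r.
Qed.

(** Instead of polar coordinates, [J 1 1 s] is evaluated twice: by [|z|^2 = r - (r - |z|^2)] and by
    [Jrec]. Equating the results expresses [J 0 0 s.+1] through [J 0 0 s]. *)
Lemma J00 s r : 0 <= r -> J 0 0 s r = (r ^+ s.+1 / s.+1%:R * area)%:C.
Proof.
move=> r0; elim: s => [|s IH]; first by rewrite J000// expr1 divr1.
have s2 : (s.+2%:R : R[i]) != 0 by rewrite pnatr_eq0.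
have s1 : (s.+1%:R : R[i]) != 0 by rewrite pnatr_eq0.
have : J 1 1 s r = r%:C * J 0 0 s r - J 0 0 s.+1 r.
  rewrite /J -cintZ -?cintB; [|exact: measurable_disc|exact: cintegrableZ (measurable_disc r)
    (integrable_Jf _ _ _ _)|exact: integrable_Jf|exact: measurable_disc|exact: integrable_Jf].
  apply: eq_cint => p _; rewrite /Jf !expr1 !expr0 !mul1r -absC2E -!rmorphM -rmorphB /=.
  by congr (_%:C); rewrite exprS; ring.
rewrite Jrec /= mulr1n IH => h.
have : J 0 0 s.+1 r = s.+1%:R / s.+2%:R * (r%:C * (r ^+ s.+1 / s.+1%:R * area)%:C).
  apply: (mulfI s2); apply: (mulfI (invr_neq0 s1)).
  transitivity (s.+1%:R^-1 * J 0 0 s.+1 r + J 0 0 s.+1 r); first by rewrite -[s.+2]addn1 natrD; field.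
  rewrite -div1r h; field.
  by rewrite ?nat1r ?s1 -?(natrD _ 2) ?pnatr_eq0.
move=> ->; rewrite !natcE -fmorphV -!rmorphM /=; congr (_%:C).
rewrite [in RHS]exprS; field; by rewrite ?nat1r -?(natrD _ 2) ?pnatr_eq0.
Qed.

Definition mono n (a b : 'I_n -> nat) (z : cvec R n) : R[i] :=
  \prod_j (z j ^+ a j * (z j)^^* ^+ b j).

(** Here [r] is the squared radius, so the slice over a first coordinate [p] is the same set with
    [r - |p|^2]. *)
Definition ballr n r : set (n.-tuple (R * R)%type) := [set x | normsq (toC x) < r].

Lemma cmeas_mono n (a b : 'I_n -> nat) : cmeas setT (fun x : n.-tuple (R * R)%type => mono a b (toC x)).
Proof.
apply: cmeas_prod => j _; apply: cmeasM; apply: cmeasX; last apply: cmeas_conj; exact: cmeas_toC.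
Qed.

Lemma absC2_coord_le n (z : cvec R n) j : absC2 (z j) <= normsq z.
Proof. by rewrite /normsq (bigD1 j)//= lerDl sumr_ge0// => i _; exact: absC2_ge0. Qed.

Lemma cabs_mono_le n (a b : 'I_n -> nat) (z : cvec R n) r : normsq z < r ->
  cabs (mono a b z) <= \prod_j (1 + r) ^+ (a j + b j).
Proof.
move=> zr; rewrite /mono.
elim/big_ind2 : _ => [|x1 x2 y1 y2 h1 h2|j _].
- by rewrite cabs1.
- by rewrite cabsM ler_pM ?cabs_ge0.
- rewrite cabsM !cabsX cabs_conj -exprD; apply: lerXn2r; rewrite ?nnegrE ?cabs_ge0//.
    by rewrite addr_ge0// ltW// (le_lt_trans _ zr)// normsq_ge0.
  have := absC2_coord_le z j; rewrite -cabs_sqr => h.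
  have := cabs_ge0 (z j); nra.
Qed.

Lemma ballr_consT n r : @consT R n @^-1` (@ballr n.+1 r) =
  [set p | absC2 (zc p.1) + normsq (toC p.2) < r].
Proof. by apply/seteqP; split => p; rewrite /ballr /= normsq_consT. Qed.

Lemma ballr_fin n r : (lebCnm R n (ballr r) < +oo)%E.
Proof.
elim: n r => [|n IH] r.
  by rewrite lebCnm0 (le_lt_trans (probability_le1 _ _))// ?ltry//; exact: measurable_ballr.
rewrite lebCnmS ballr_consT.
apply: (@le_lt_trans _ _ ((lebCm \x lebCnm R n)%E (disc r `*` @ballr n r))).
  apply: le_measure; rewrite ?inE.
  - rewrite -ballr_consT -[X in measurable X]setTI; apply: measurable_consT => //.
    exact: measurable_ballr.
  - by apply: measurableX; [exact: measurable_disc|exact: measurable_ballr].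
  - move=> [p x] /=; rewrite /disc /ballr /= => h; split => /=.
      by rewrite (le_lt_trans _ h)// lerDl normsq_ge0.
    by rewrite (le_lt_trans _ h)// lerDr absC2_ge0.
rewrite product_measure1E; [|exact: measurable_disc|exact: measurable_ballr].
by rewrite lte_mul_pinfty// ?ge0_fin_numE//; exact: disc_fin.
Qed.

Lemma ballr_integrable n r (f : n.-tuple (R * R)%type -> R[i]) (M : R) : cmeas setT f ->
  (forall x, ballr r x -> cabs (f x) <= M) -> cintegrable (lebCnm R n) (ballr r) f.
Proof.
move=> mf fM; have mB := @measurable_ballr R n r.
apply: (@cintegrable_le _ _ _ _ _ _ (cst M)) => //.
- by apply: cmeas_subset mf.
- apply: measurable_bounded_integrable; [exact: mB|exact: ballr_fin|by []|].
  exact: bounded_cst.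
Qed.

Lemma integrable_mono n (a b : 'I_n -> nat) r :
  cintegrable (lebCnm R n) (ballr r) (fun x => mono a b (toC x)).
Proof. by apply: (ballr_integrable (cmeas_mono _ _)) => x h; exact: cabs_mono_le h. Qed.

Definition mcoef n (a b : 'I_n -> nat) : R :=
  if [forall j, a j == b j] then (\prod_j (a j)`!)%:R / ((\sum_j a j) + n)`!%:R else 0.

(** Induction on the dimension: by homogeneity the slice over [p] contributes a constant times
    [(r - |p|^2)^e], and one disc integral [J] remains. *)
Lemma cint_mono n (a b : 'I_n -> nat) r : 0 < r ->
  cint (lebCnm R n) (ballr r) (fun x => mono a b (toC x)) =
    (mcoef a b * r ^+ (\sum_j a j + n) * area ^+ n)%:C.
Proof.
elim: n a b r => [|n IH] a b r r0.
  have E : forall x, mono a b (@toC R 0 x) = 1 by move=> x; rewrite /mono big_ord0.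
  under eq_cint do rewrite E.
  have -> : mcoef a b * r ^+ (\sum_j a j + 0) * area ^+ 0 = r ^+ 0.
    rewrite /mcoef big_ord0 addn0 big_ord0 /= fact0 divr1 expr0 mulr1 mulr1.
    by rewrite ifT//; apply/forallP => -[].
  rewrite /cint Rintegral_cst ?mul0r; last exact: measurable_ballr.
  rewrite Rintegral_cst ?mul1r; last exact: measurable_ballr.
  rewrite lebCnm0 diracE.
  rewrite mem_set ?expr0; first by apply: complex_eq; rewrite /= ?mul0r.
  by rewrite /ballr /= /normsq big_ord0.
pose a' := a \o lift ord0; pose b' := b \o lift ord0.
have [] := @cint_pushforward _ _ _ _ _ (prodm lebCm (lebCnm R n)) (lebCnm R n.+1) _
   (@measurable_consT R n) (fun A _ => lebCnmS A) (ballr r) (fun x => mono a b (toC x))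
   (@measurable_ballr R _ r) (integrable_mono a b r).
move=> ic ->; have mB : measurable (@consT R n @^-1` (@ballr n.+1 r)).
  rewrite -[X in measurable X]setTI; apply: measurable_consT => //; exact: measurable_ballr.
have [_ ->] := @cint_fubini1 _ _ _ _ _ lebCm (lebCnm R n) _ _ mB ic.
pose e := (\sum_j a' j + n)%N.
have fE : mono a b \o toC \o @consT R n = fun p : ((R * R) * n.-tuple (R * R))%type =>
  zc p.1 ^+ a ord0 * (zc p.1)^^* ^+ b ord0 * mono a' b' (toC p.2).
  apply/funext => p /=; rewrite /mono big_ord_recl toC_consT0; congr (_ * _).
  by apply: eq_bigr => j _; rewrite toC_consTS.
have inner p : cint (lebCnm R n) [set y | (@consT R n @^-1` (@ballr n.+1 r)) (p, y)]
    (fun y => ((fun x => mono a b (toC x)) \o @consT R n) (p, y)) =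
   if p \in disc r then ((mcoef a' b' * area ^+ n)%:C) * Jf (a ord0) (b ord0) e r p else 0.
  rewrite -[_ \o _]/(mono a b \o toC \o @consT R n) fE ballr_consT /=.
  case: ifPn => [|/negP]; rewrite inE /disc /= => h.
    rewrite (_ : [set _ | _] = ballr (r - absC2 (zc p))); last first.
      by apply/seteqP; split => y; rewrite /ballr /= ltrBrDl.
    rewrite cintZ ?IH; [|by rewrite subr_gt0|exact: measurable_ballr|exact: integrable_mono].
    by rewrite /Jf -/e !rmorphM /=; ring.
  rewrite (_ : [set _ | _] = set0) ?cint_set0// -subset0 => y /= hy; apply: h.
  by rewrite (le_lt_trans _ hy)// lerDl normsq_ge0.
under eq_cint do rewrite inner.
rewrite -cint_mkcond cintZ; [|exact: measurable_disc|exact: integrable_Jf].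
rewrite -/(J _ _ _ _).
have sE : (\sum_j a j + n.+1 = (e + a ord0).+1)%N.
  by rewrite big_ord_recl /e addnS; congr S; rewrite addnC addnA addnC addnA.
have [ab|ab] := eqVneq (a ord0) (b ord0); last first.
  rewrite J_off// mulr0 /mcoef ifF ?mul0r//; apply/negbTE/forallPn; by exists ord0.
rewrite -ab J_rdiag J00 ?(ltW r0)// !natcE -fmorphV -!rmorphM /=; congr (_%:C).
rewrite /mcoef sE.
have -> : [forall j, a j == b j] = [forall j, a' j == b' j].
  apply/forallP/forallP => h j; first exact: h.
  by have [k ->|->] := unliftP ord0 j; [exact: h|rewrite ab].
case: ifP => _; last by rewrite !mul0r.
rewrite (factS (e + a ord0)) big_ord_recl !natrM exprS [area ^+ n.+1]exprS.
rewrite -/e.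
have -> : (\prod_(i < n) (a (lift ord0 i))`!)%:R = (\prod_j (a' j)`!)%:R :> R by [].
have fne k : (k`!%:R : R) != 0 by rewrite pnatr_eq0 -lt0n fact_gt0.
have := fne e; have := fne (e + a ord0)%N; have : ((e + a ord0).+1%:R : R) != 0 by rewrite pnatr_eq0.
move: (e`!%:R : R) ((e + a ord0)`!%:R : R) ((e + a ord0).+1%:R : R) => x y w x0 y0 w0; field.
by rewrite x0 y0 w0.
Qed.

End Moments.

Lemma cint_mscale d (T : measurableType d) (R : realType) (m : {measure set T -> \bar R})
  (k : {nonneg R}) (D : set T) (f : T -> R[i]) : measurable D -> cintegrable m D f ->
  cintegrable (mscale k m) D f /\ cint (mscale k m) D f = k%:num%:C * cint m D f.
Proof.
move=> mD ci.
have key (g : T -> R) : m.-integrable D (fun x => (g x)%:E) ->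
    (mscale k m).-integrable D (fun x => (g x)%:E) /\
    Rintegral (mscale k m) D g = k%:num * Rintegral m D g.
  move=> ig; have mg := measurable_int _ ig; split.
    apply/integrableP; split => //.
    rewrite ge0_integral_mscale//; last exact: measurableT_comp.
    by rewrite lte_mul_pinfty// ?lee_fin//; have /integrableP[] := ig.
  rewrite /Rintegral; rewrite integralE [in RHS]integralE.
  rewrite !ge0_integral_mscale//; [|exact: measurable_funeneg|exact: measurable_funepos].
  rewrite -muleBr//; last first.
    rewrite fin_num_adde_defl//.
    by rewrite fin_numN; apply: integrable_fin_num => //; exact: integrable_funeneg.
  rewrite fineM// -integralE; exact: integrable_fin_num.
case: ci => /key[a b] /key[c e]; split => //.
by rewrite /cint b e; apply: complex_eq; rewrite /=; ring.
Qed.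

(** * Moments of the normalized volume *)

Section NormalizedVolume.
Variables (R : realType) (N : nat).
Local Notation T := (N.-tuple (R * R)%type).
Local Notation area := (@area R).

Lemma vol_ballT : lebCn N (@ballT R N) = (area ^+ N / N`!%:R)%:E.
Proof.
rewrite -lebCnmE.
have := @cint_mono R N (fun=> 0%N) (fun=> 0%N) 1 ltr01.
have -> : cint (lebCnm R N) (ballr 1) (fun x => mono (fun=> 0%N) (fun=> 0%N) (toC x)) =
          cint (lebCnm R N) (ballr 1) (fun=> 1).
  by apply: eq_cint => x _; rewrite /mono big1// => j _; rewrite !expr0 mulr1.
rewrite /cint Rintegral_cst ?mul1r; last exact: measurable_ballr.
rewrite /mcoef ifT ?big1// /= ; last by apply/forallP.
case; rewrite expr1n mulr1 => h _; rewrite [RHS](_ : _ = (fine (lebCnm R N (ballr 1)))%:E).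
  by rewrite fineK// ge0_fin_numE// ballr_fin.
by rewrite h add0n mulrC div1r.
Qed.

Let vol : R := (fine (lebCn N (@ballT R N)))^-1.
Let vol_ge0 : 0 <= vol.
Proof. by rewrite invr_ge0 fine_ge0// -lebCnmE. Qed.

Definition dVm : {measure set T -> \bar R} := mscale (NngNum vol_ge0) (lebCnm R N).

Lemma dVmE : (dVm : set T -> \bar R) = dV N.
Proof. by apply/funext => A; rewrite /dVm /= /mscale lebCnmE. Qed.

Definition multi_moment (a b : 'I_N -> nat) : R[i] :=
  if [forall j, a j == b j] then (\prod_j (a j)`!)%:R * (N`!%:R / (\sum_j a j + N)`!%:R) else 0.

Lemma dVm_mono (a b : 'I_N -> nat) : cintegrable dVm (@ballT R N) (fun x => mono a b (toC x)) /\
  cint dVm (@ballT R N) (fun x => mono a b (toC x)) = multi_moment a b.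
Proof.
have [i ->] := cint_mscale (NngNum vol_ge0) (@measurable_ballT R N) (integrable_mono a b 1).
split => //; rewrite cint_mono//= expr1n mulr1 /vol vol_ballT /=.
have a0 : area ^+ N != 0 by rewrite gt_eqF// exprn_gt0// area_gt0.
have fne k : (k`!%:R : R) != 0 by rewrite pnatr_eq0 -lt0n fact_gt0.
rewrite /multi_moment /mcoef; case: ifP => _; last by rewrite mul0r mulr0.
rewrite !natcE -fmorphV -!rmorphM /=; congr (_%:C); field.
by rewrite a0 !fne.
Qed.

Lemma dVm_fin : (dVm (@ballT R N) < +oo)%E.
Proof.
rewrite dVmE /dV vol_ballT -EFinM ltry//.
Qed.

Lemma cintegrable_bounded_ball (f : T -> R[i]) (M : R) : cmeas (@ballT R N) f ->
  (forall x, ballT N x -> cabs (f x) <= M) -> cintegrable dVm (@ballT R N) f.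
Proof.
move=> mf fM; have mB := @measurable_ballT R N.
apply: (@cintegrable_le _ _ _ _ _ _ (cst M)) => //.
apply: measurable_bounded_integrable; [exact: mB|exact: dVm_fin|by []|].
exact: bounded_cst.
Qed.

Lemma L1ballE (u : cvec R N -> R[i]) :
  L1ball u <-> cintegrable dVm (@ballT R N) (fun x => u (toC x)).
Proof. by rewrite /cintegrable dVmE. Qed.

Lemma berezinE (u : cvec R N -> R[i]) z :
  berezin u z = cint dVm (@ballT R N) (fun x =>
    ((1 - normsq z) ^+ N.+1 / absC2 (1 - inner z (toC x)) ^+ N.+1)%:C * u (toC x)).
Proof.
rewrite /berezin /cint /Defs.Rint /Rintegral -dVmE.
congr (_ +i* _); congr fine; apply: eq_integral => x _; congr EFin;
  by case: (u _) => ? ? /=; ring.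
Qed.

End NormalizedVolume.

(** * Gaussian pairing and Wick ordering *)

Section Zpoly.
Import -(notations) mpoly.
Variables (R : realType) (N : nat).
Local Notation ZP := (zpoly R N).
Local Notation mnm := (mpoly.multinom (N + N)).
Local Notation X m := (@mpoly.mpolyX (N + N) R[i] m).
Local Notation U i := (@mpoly.mnm1 (N + N) i).
Local Notation msupp := (@mpoly.msupp (N + N) R[i]).
Local Notation mcoeff := (@mpoly.mcoeff (N + N) R[i]).
Local Notation mderiv := (@mpoly.mderiv (N + N) R[i]).
Local Notation L := (@lshift N N).
Local Notation Rr := (@rshift N N).
Implicit Types (P Q F : ZP) (m : mnm) (z xi : cvec R N).

Definition ldeg m := (\sum_j m (L j))%N.
Definition rdeg m := (\sum_j m (Rr j))%N.

Lemma mdeg_lr m : mpoly.mdeg m = (ldeg m + rdeg m)%N.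
Proof. by rewrite mpoly.mdegE big_split_ord. Qed.

Lemma mnmP_lr m m' : (forall j, m (L j) = m' (L j)) -> (forall j, m (Rr j) = m' (Rr j)) -> m = m'.
Proof.
move=> hl hr; apply/mpoly.mnmP => i; rewrite -(splitK i); case: (fintype.split i) => j /=.
  exact: hl.
exact: hr.
Qed.

Lemma mnm1_ll i j : U (L i) (L j) = (i == j).
Proof. by rewrite mpoly.mnm1E (inj_eq (@lshift_inj _ _)). Qed.
Lemma mnm1_rr i j : U (Rr i) (Rr j) = (i == j).
Proof. by rewrite mpoly.mnm1E (inj_eq (@rshift_inj _ _)). Qed.
Lemma mnm1_lr i j : U (L i) (Rr j) = 0%N.
Proof. by rewrite mpoly.mnm1E eq_lrshift. Qed.
Lemma mnm1_rl i j : U (Rr i) (L j) = 0%N.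
Proof. by rewrite mpoly.mnm1E eq_rlshift. Qed.

Lemma evalz_monoE m z : evalz (X m) z = mono (fun j => m (L j)) (fun j => m (Rr j)) z.
Proof.
rewrite /evalz mpoly.mevalX big_split_ord /mono /= -big_split /=.
apply: eq_bigr => j _.
by rewrite -[L j]/(unsplit (inl j)) -[Rr j]/(unsplit (inr j)) !unsplitK.
Qed.

Lemma evalzE P z : evalz P z =
  \sum_(m <- msupp P) mcoeff m P * mono (fun j => m (L j)) (fun j => m (Rr j)) z.
Proof.
by rewrite /evalz mpoly.mevalE; apply: eq_bigr => m _; rewrite -evalz_monoE /evalz mpoly.mevalX.
Qed.

Lemma evalzD P Q z : evalz (P + Q) z = evalz P z + evalz Q z.
Proof. exact: mpoly.mevalD. Qed.
Lemma evalzM P Q z : evalz (P * Q) z = evalz P z * evalz Q z.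
Proof. exact: mpoly.mevalM. Qed.
Lemma evalzZ c P z : evalz (c *: P) z = c * evalz P z.
Proof. exact: mpoly.mevalZ. Qed.
Lemma evalz1 z : evalz 1 z = 1.
Proof. exact: mpoly.meval1. Qed.
Lemma evalz_sum (I : Type) (r : seq I) (pr : pred I) (F : I -> ZP) z :
  evalz (\sum_(i <- r | pr i) F i) z = \sum_(i <- r | pr i) evalz (F i) z.
Proof. exact: rmorph_sum. Qed.
Lemma evalzX P n z : evalz (P ^+ n) z = evalz P z ^+ n.
Proof. exact: rmorphXn. Qed.

Lemma zpolyE P : P = \sum_(m <- msupp P) mcoeff m P *: X m.
Proof. exact: mpoly.mpolyE. Qed.

Definition gauss_mono m : R[i] :=
  if [forall j, m (L j) == m (Rr j)] then (\prod_j (m (L j))`!)%:R else 0.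

(* Expectation of a polynomial under the standard complex Gaussian. *)
Definition gauss P : R[i] := \sum_(m <- msupp P) mcoeff m P * gauss_mono m.

(** Supports change under addition, so linearity of [gauss] is proved on a common larger index
    set. *)
Lemma gauss_subset (s : seq mnm) P : uniq s -> {subset msupp P <= s} ->
  gauss P = \sum_(m <- s) mcoeff m P * gauss_mono m.
Proof.
move=> us ss; rewrite /gauss [RHS](bigID (fun m => m \in msupp P)) /= [Y in _ = _ + Y]big1 ?addr0; last first.
  by move=> m mP; rewrite mpoly.memN_msupp_eq0 ?mul0r.
rewrite -[RHS]big_filter; apply: perm_big; apply: uniq_perm.
- exact: mpoly.msupp_uniq.
- exact: filter_uniq.
- by move=> m; rewrite mem_filter; case: (boolP (m \in msupp P)) => //= /ss ->.
Qed.

Lemma gaussZD c P Q : gauss (c *: P + Q) = c * gauss P + gauss Q.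
Proof.
pose s := undup (msupp P ++ msupp Q ++ msupp (c *: P + Q)).
have us : uniq s by exact: undup_uniq.
rewrite !(@gauss_subset s)//; try by move=> m mm; rewrite mem_undup !mem_cat mm ?orbT.
rewrite mulr_sumr -big_split /=; apply: eq_bigr => m _.
by rewrite mpoly.mcoeffD mpoly.mcoeffZ mulrDl mulrA.
Qed.

Lemma gauss0 : gauss 0 = 0.
Proof. by rewrite /gauss mpoly.msupp0 big_nil. Qed.

Lemma gaussD P Q : gauss (P + Q) = gauss P + gauss Q.
Proof. by rewrite -[P]scale1r gaussZD mul1r scale1r. Qed.
Lemma gaussZ c P : gauss (c *: P) = c * gauss P.
Proof. by rewrite -[c *: P]addr0 gaussZD gauss0 addr0. Qed.
Lemma gaussB P Q : gauss (P - Q) = gauss P - gauss Q.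
Proof. by rewrite -scaleN1r addrC gaussZD mulN1r addrC. Qed.
Lemma gauss_sum (I : Type) (r : seq I) (pr : pred I) (F : I -> ZP) :
  gauss (\sum_(i <- r | pr i) F i) = \sum_(i <- r | pr i) gauss (F i).
Proof. by elim/big_rec2 : _ => [|i y1 y2 _ <-]; rewrite ?gauss0 ?gaussD. Qed.

Lemma gauss_monomial m : gauss (X m) = gauss_mono m.
Proof. by rewrite /gauss mpoly.msuppX big_seq1 mpoly.mcoeffX eqxx mul1r. Qed.

(** Gaussian integration by parts on monomials: multiplication by [z_j] becomes differentiation in
    its conjugate. When the exponent is 0, the truncated subtraction is multiplied by 0. *)
Lemma gauss_mono_l j m : gauss_mono (mpoly.mnm_add (U (L j)) m) =
  (m (Rr j))%:R * gauss_mono (mpoly.mnm_sub m (U (Rr j))).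
Proof.
have [m0|m0] := eqVneq (m (Rr j)) 0%N.
  rewrite m0 mul0r /gauss_mono ifF//; apply/negbTE/forallPn; exists j.
  by rewrite !mpoly.mnmDE mnm1_ll mnm1_lr m0 eqxx.
rewrite /gauss_mono.
have -> : [forall i, mpoly.mnm_add (U (L j)) m (L i) == mpoly.mnm_add (U (L j)) m (Rr i)] =
  [forall i, mpoly.mnm_sub m (U (Rr j)) (L i) == mpoly.mnm_sub m (U (Rr j)) (Rr i)].
  apply: eq_forallb => i; rewrite !mpoly.mnmDE !mpoly.mnmBE mnm1_ll mnm1_lr mnm1_rl mnm1_rr subn0 add0n.
  have [<-|_] := eqVneq j i; last by rewrite add0n subn0.
  by move: m0; case: (m (Rr j)) => // k _; rewrite add1n eqSS subn1.
case: ifPn => [/forallP h|_]; last by rewrite mulr0.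
rewrite (bigD1 j)// [in RHS](bigD1 j)//= !mpoly.mnmDE !mpoly.mnmBE mnm1_ll mnm1_rl eqxx subn0.
have := h j; rewrite !mpoly.mnmBE mnm1_rl mnm1_rr eqxx subn0 => /eqP e.
rewrite add1n factS {1}e subn1 prednK ?lt0n// -mulnA natrM; congr (_ * (_ * _)%:R).
apply: eq_bigr => i ij; rewrite mpoly.mnmDE mpoly.mnmBE mnm1_ll mnm1_rl subn0.
by rewrite eq_sym (negbTE ij).
Qed.

Lemma gauss_mono_r j m : gauss_mono (mpoly.mnm_add (U (Rr j)) m) =
  (m (L j))%:R * gauss_mono (mpoly.mnm_sub m (U (L j))).
Proof.
have [m0|m0] := eqVneq (m (L j)) 0%N.
  rewrite m0 mul0r /gauss_mono ifF//; apply/negbTE/forallPn; exists j.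
  by rewrite !mpoly.mnmDE mnm1_rr mnm1_rl m0 eqxx.
rewrite /gauss_mono.
have -> : [forall i, mpoly.mnm_add (U (Rr j)) m (L i) == mpoly.mnm_add (U (Rr j)) m (Rr i)] =
  [forall i, mpoly.mnm_sub m (U (L j)) (L i) == mpoly.mnm_sub m (U (L j)) (Rr i)].
  apply: eq_forallb => i; rewrite !mpoly.mnmDE !mpoly.mnmBE mnm1_ll mnm1_lr mnm1_rl mnm1_rr subn0 add0n.
  have [<-|_] := eqVneq j i; last by rewrite add0n subn0.
  by move: m0; case: (m (L j)) => // k _; rewrite add1n eqSS subn1.
case: ifPn => [/forallP h|_]; last by rewrite mulr0.
rewrite (bigD1 j)// [in RHS](bigD1 j)//= !mpoly.mnmDE !mpoly.mnmBE mnm1_ll mnm1_rl eqxx add0n.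
rewrite subn1 -[in LHS](prednK (n := m (L j))) ?lt0n// factS prednK ?lt0n// -mulnA natrM;
  congr (_ * (_ * _)%:R).
apply: eq_bigr => i ij; rewrite mpoly.mnmDE mpoly.mnmBE mnm1_ll mnm1_rl add0n.
by rewrite eq_sym (negbTE ij) subn0.
Qed.

Lemma gauss_parts_l j P : gauss (X (U (L j)) * P) = gauss (mderiv (Rr j) P).
Proof.
rewrite (zpolyE P) mulr_sumr raddf_sum !gauss_sum; apply: eq_bigr => m _.
rewrite -scalerAr /= mpoly.mderivZ !gaussZ; congr (_ * _).
by rewrite -mpoly.mpolyXD mpoly.mderivX gaussZ !gauss_monomial gauss_mono_l.
Qed.

Lemma gauss_parts_r j P : gauss (X (U (Rr j)) * P) = gauss (mderiv (L j) P).
Proof.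
rewrite (zpolyE P) mulr_sumr raddf_sum !gauss_sum; apply: eq_bigr => m _.
rewrite -scalerAr /= mpoly.mderivZ !gaussZ; congr (_ * _).
by rewrite -mpoly.mpolyXD mpoly.mderivX gaussZ !gauss_monomial gauss_mono_r.
Qed.

End Zpoly.

Section Wick.
Import -(notations) mpoly.
Variables (R : realType) (N : nat).
Local Notation ZP := (zpoly R N).
Local Notation mnm := (mpoly.multinom (N + N)).
Local Notation X m := (@mpoly.mpolyX (N + N) R[i] m).
Local Notation U i := (@mpoly.mnm1 (N + N) i).
Local Notation msupp := (@mpoly.msupp (N + N) R[i]).
Local Notation mcoeff := (@mpoly.mcoeff (N + N) R[i]).
Local Notation mderiv := (@mpoly.mderiv (N + N) R[i]).
Local Notation L := (@lshift N N).
Local Notation Rr := (@rshift N N).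
Implicit Types (P Q F : ZP) (m : mnm) (z xi : cvec R N).

Lemma innerE z xi : inner z xi = \sum_j z j * (xi j)^^*.
Proof. by []. Qed.

Lemma inner_conj z xi : (inner z xi)^^* = inner xi z.
Proof. by rewrite !innerE conj_sum; apply: eq_bigr => j _; rewrite conjM conjcK mulrC. Qed.

Lemma inner_self z : inner z z = (normsq z)%:C.
Proof. by rewrite innerE /normsq rmorph_sum; apply: eq_bigr => j _; rewrite -absC2E. Qed.

Lemma mderiv_exp i P n : mderiv i (P ^+ n) = (P ^+ n.-1 * mderiv i P) *+ n.
Proof.
elim: n => [|n IH]; first by rewrite expr0 mulr0n -mpoly.mpolyC1 mpoly.mderivC.
rewrite exprS mpoly.mderivM IH /= mulrS; congr (_ + _); first by rewrite mulrC.
by case: n {IH} => [|n]; rewrite ?mulr0n ?mulr0// mulrnAr mulrA -exprS.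
Qed.

(** At [xi] this is [<z,xi>], conjugate linear in [xi], hence the variables [Rr]; [linr z] is
    [<xi,z>]. So [linpow z a b] has bidegree [(b, a)]. *)
Definition linl z : ZP := \sum_j z j *: X (U (Rr j)).
Definition linr z : ZP := \sum_j (z j)^^* *: X (U (L j)).
Definition linpow z a b : ZP := linl z ^+ a * linr z ^+ b.

Lemma evalz_XL j z : evalz (X (U (L j))) z = z j.
Proof.
rewrite evalz_monoE /mono (bigD1 j)//= mnm1_ll mnm1_lr eqxx expr1 expr0 mulr1 big1 ?mulr1// => i ij.
by rewrite mnm1_ll mnm1_lr eq_sym (negbTE ij) !expr0 mulr1.
Qed.

Lemma evalz_XR j z : evalz (X (U (Rr j))) z = (z j)^^*.
Proof.
rewrite evalz_monoE /mono (bigD1 j)//= mnm1_rr mnm1_rl eqxx expr1 expr0 mul1r big1 ?mulr1// => i ij.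
by rewrite mnm1_rr mnm1_rl eq_sym (negbTE ij) !expr0 mulr1.
Qed.

Lemma evalz_linpow z a b xi : evalz (linpow z a b) xi = inner z xi ^+ a * inner xi z ^+ b.
Proof.
rewrite evalzM !evalzX !evalz_sum !innerE; congr (_ ^+ _ * _ ^+ _); apply: eq_bigr => j _.
  by rewrite evalzZ evalz_XR.
by rewrite evalzZ evalz_XL mulrC.
Qed.

Lemma mderivU i k : mderiv i (X (U k)) = (i == k)%:R *: 1.
Proof.
rewrite mpoly.mderivX mpoly.mnm1E eq_sym; have [->|] := eqVneq i k; last by rewrite !scale0r.
rewrite !scale1r -mpoly.mpolyX0; congr (X _); apply/mpoly.mnmP => j.
by rewrite mpoly.mnmBE subnn mpoly.mnm0E.
Qed.

Lemma mderiv_linl_r j z : mderiv (Rr j) (linl z) = z j *: 1.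
Proof.
rewrite raddf_sum (bigD1 j)//= mpoly.mderivZ mderivU eqxx scale1r big1 ?addr0// => i ij.
by rewrite mpoly.mderivZ mderivU (inj_eq (@rshift_inj _ _)) eq_sym (negbTE ij) scale0r scaler0.
Qed.
Lemma mderiv_linl_l j z : mderiv (L j) (linl z) = 0.
Proof.
rewrite raddf_sum big1// => i _; by rewrite /= mpoly.mderivZ mderivU eq_lrshift scale0r scaler0.
Qed.
Lemma mderiv_linr_l j z : mderiv (L j) (linr z) = (z j)^^* *: 1.
Proof.
rewrite raddf_sum (bigD1 j)//= mpoly.mderivZ mderivU eqxx scale1r big1 ?addr0// => i ij.
by rewrite mpoly.mderivZ mderivU (inj_eq (@lshift_inj _ _)) eq_sym (negbTE ij) scale0r scaler0.
Qed.
Lemma mderiv_linr_r j z : mderiv (Rr j) (linr z) = 0.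
Proof.
rewrite raddf_sum big1// => i _; by rewrite /= mpoly.mderivZ mderivU eq_rlshift scale0r scaler0.
Qed.

Lemma mderiv_linpow_r j z a b :
  mderiv (Rr j) (linpow z a b) = (a%:R * z j : R[i]) *: linpow z a.-1 b.
Proof.
rewrite /linpow mpoly.mderivM !mderiv_exp mderiv_linl_r mderiv_linr_r mulr0 mul0rn mulr0 addr0.
rewrite mulr_natl -!mpoly.mul_mpolyC mulr1 raddfMn /= !mulrnAl; congr (_ *+ _).
by rewrite mulrAC mulrC mulrA.
Qed.
Lemma mderiv_linpow_l j z a b :
  mderiv (L j) (linpow z a b) = (b%:R * (z j)^^* : R[i]) *: linpow z a b.-1.
Proof.
rewrite /linpow mpoly.mderivM !mderiv_exp mderiv_linl_l mderiv_linr_l mulr0 mul0rn mul0r add0r.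
rewrite mulr_natl -!mpoly.mul_mpolyC mulr1 raddfMn /= mulrnAl mulrnAr; congr (_ *+ _).
by rewrite mulrA mulrC.
Qed.

Lemma linpowSl z a b : linpow z a.+1 b = \sum_j z j *: (X (U (Rr j)) * linpow z a b).
Proof.
rewrite /linpow exprS -mulrA {1}/linl mulr_suml; apply: eq_bigr => j _.
by rewrite -scalerAl.
Qed.
Lemma linpowSr z a b : linpow z a b.+1 = \sum_j (z j)^^* *: (X (U (L j)) * linpow z a b).
Proof.
rewrite /linpow [linr z ^+ b.+1]exprS mulrCA {1}/linr mulr_suml; apply: eq_bigr => j _.
by rewrite -scalerAl.
Qed.

(** Integration by parts removes one factor of each kind and produces [|z|^2], so the two exponents
    decrease together. *)
Lemma gauss_linpow z a b :
  gauss (linpow z a b) = if a == b then a`!%:R * (normsq z)%:C ^+ a else 0.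
Proof.
elim: a b => [|a IH] b.
  case: b => [|b].
    rewrite /linpow !expr0 mulr1 -mpoly.mpolyX0 gauss_monomial /gauss_mono ifT.
      by rewrite eqxx mulr1 big1 ?fact0// => j _; rewrite mpoly.mnm0E.
    by apply/forallP => j; rewrite !mpoly.mnm0E.
  rewrite linpowSr gauss_sum big1// => j _.
  by rewrite gaussZ gauss_parts_l mderiv_linpow_r mul0r scale0r gauss0 mulr0.
rewrite linpowSl gauss_sum.
transitivity ((b%:R * (normsq z)%:C) * gauss (linpow z a b.-1)).
  rewrite -inner_self innerE mulr_sumr mulr_suml; apply: eq_bigr => j _.
  by rewrite gaussZ gauss_parts_r mderiv_linpow_l gaussZ; ring.
rewrite IH; case: b => [|b]; first by rewrite !mul0r.
rewrite /= eqSS; case: eqP => [->|_]; last by rewrite mulr0.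
by rewrite factS natrM exprS; ring.
Qed.

(* Bidegree [(p - i, q - i)], stated without truncated subtraction. *)
Definition bihom p q i P := forall m, m \in msupp P -> (ldeg m + i = p /\ rdeg m + i = q)%N.

Lemma bihom0 p q i : bihom p q i 0.
Proof. by move=> m; rewrite mpoly.msupp0. Qed.

Lemma bihom_mull p q i P j : bihom p q i P -> bihom p.+1 q i (X (U (L j)) * P).
Proof.
move=> h m; rewrite mulrC (perm_mem (mpoly.msuppMX _ _)) => /mapP[m' /h[h1 h2] ->]; split.
  rewrite -h1 -addSn; congr addn; rewrite /ldeg (bigD1 j)//= [in RHS](bigD1 j)//=.
  rewrite mpoly.mnmDE mnm1_ll eqxx -addnA add1n; congr (_ + _).+1; apply: eq_bigr => k kj.
  by rewrite mpoly.mnmDE mnm1_ll eq_sym (negbTE kj).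
rewrite -h2; congr addn; apply: eq_bigr => k _.
by rewrite mpoly.mnmDE mnm1_lr.
Qed.

Lemma bihom_mulr p q i P j : bihom p q i P -> bihom p q.+1 i (X (U (Rr j)) * P).
Proof.
move=> h m; rewrite mulrC (perm_mem (mpoly.msuppMX _ _)) => /mapP[m' /h[h1 h2] ->]; split.
  rewrite -h1; congr addn; apply: eq_bigr => k _.
  by rewrite mpoly.mnmDE mnm1_rl.
rewrite -h2 -addSn; congr addn; rewrite /rdeg (bigD1 j)//= [in RHS](bigD1 j)//=.
rewrite mpoly.mnmDE mnm1_rr eqxx -addnA add1n; congr (_ + _).+1; apply: eq_bigr => k kj.
by rewrite mpoly.mnmDE mnm1_rr eq_sym (negbTE kj).
Qed.

Lemma mem_msupp_mderiv i P m : m \in msupp (mderiv i P) -> mpoly.mnm_add m (U i) \in msupp P.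
Proof.
rewrite !mpoly.mcoeff_msupp mpoly.mcoeff_deriv; apply: contra => /eqP ->.
by rewrite mul0rn.
Qed.

Lemma ldegD m m' : ldeg (mpoly.mnm_add m m') = (ldeg m + ldeg m')%N.
Proof. by rewrite /ldeg -big_split; apply: eq_bigr => j _; rewrite mpoly.mnmDE. Qed.
Lemma rdegD m m' : rdeg (mpoly.mnm_add m m') = (rdeg m + rdeg m')%N.
Proof. by rewrite /rdeg -big_split; apply: eq_bigr => j _; rewrite mpoly.mnmDE. Qed.
Lemma ldegL j : ldeg (U (L j)) = 1%N.
Proof.
rewrite /ldeg (bigD1 j)//= mnm1_ll eqxx big1// => i ij; by rewrite mnm1_ll eq_sym (negbTE ij).
Qed.
Lemma rdegR j : rdeg (U (Rr j)) = 1%N.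
Proof.
rewrite /rdeg (bigD1 j)//= mnm1_rr eqxx big1// => i ij; by rewrite mnm1_rr eq_sym (negbTE ij).
Qed.
Lemma ldegR j : ldeg (U (Rr j)) = 0%N.
Proof. by rewrite /ldeg big1// => i _; rewrite mnm1_rl. Qed.
Lemma rdegL j : rdeg (U (L j)) = 0%N.
Proof. by rewrite /rdeg big1// => i _; rewrite mnm1_lr. Qed.

Lemma bihom_derivr p q i P j : bihom p q i P -> bihom p.+1 q i.+1 (mderiv (Rr j) P).
Proof.
move=> h m /mem_msupp_mderiv /h; rewrite ldegD rdegD ldegR rdegR addn0 addn1 !addnS.
by move=> [-> <-]; rewrite addSn.
Qed.
Lemma bihom_derivl p q i P j : bihom p q i P -> bihom p q.+1 i.+1 (mderiv (L j) P).
Proof.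
move=> h m /mem_msupp_mderiv /h; rewrite ldegD rdegD ldegL rdegL addn0 addn1 !addnS.
by move=> [<- ->]; rewrite addSn.
Qed.

Lemma bihomB p q i P Q : bihom p q i P -> bihom p q i Q -> bihom p q i (P - Q).
Proof. by move=> h1 h2 m /mpoly.msuppB_le; rewrite mem_cat => /orP[/h1|/h2]. Qed.

Lemma bihom_eq0 p q i P : bihom p q i P -> (minn p q < i)%N -> P = 0.
Proof.
move=> h; rewrite gtn_min => pq; apply: mpoly.msuppnil0.
move: h; rewrite /bihom; case: (msupp P) => // m s /(_ m); rewrite mem_head => /(_ isT)[h1 h2].
by move: pq; rewrite -{1}h1 -h2 !ltnNge !leq_addl.
Qed.

Lemma bihomM p q i p' q' P Q : bihom p q i P -> bihom p' q' 0 Q -> bihom (p + p') (q + q') i (P * Q).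
Proof.
move=> h h' m /mpoly.msuppM_le /allpairsP[[m1 m2] /= [/h[h1 h2] /h'[h3 h4] ->]].
by rewrite ldegD rdegD -h1 -h2 -h3 -h4 !addn0; split; rewrite addnAC.
Qed.

Lemma bihom_X m : bihom (ldeg m) (rdeg m) 0 (X m).
Proof. by move=> m'; rewrite mpoly.msuppX mem_seq1 => /eqP ->; rewrite !addn0. Qed.

Lemma bihom_sum (I : Type) (r : seq I) p q i (F : I -> ZP) :
  (forall k, bihom p q i (F k)) -> bihom p q i (\sum_(k <- r) F k).
Proof.
move=> h; elim: r => [|k r IH]; first by rewrite big_nil; exact: bihom0.
rewrite big_cons => m /mpoly.msuppD_le; rewrite mem_cat => /orP[/h//|/IH//].
Qed.

Lemma bihomZ p q i c P : bihom p q i P -> bihom p q i (c *: P).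
Proof. by move=> h m /mpoly.msuppZ_le /h. Qed.

Lemma bihom_linpow z a b : bihom b a 0 (linpow z a b).
Proof.
elim: a => [|a IH].
  elim: b => [|b IH]; last first.
    by rewrite linpowSr; apply: bihom_sum => j; apply: bihomZ; exact: bihom_mull.
  rewrite /linpow !expr0 mulr1 -mpoly.mpolyX0 => m; rewrite mpoly.msuppX mem_seq1 => /eqP ->.
  by rewrite /ldeg /rdeg !big1// => j _; rewrite mpoly.mnm0E.
by rewrite linpowSl; apply: bihom_sum => j; apply: bihomZ; exact: bihom_mulr.
Qed.

(** Here [i] is the conjugate variable of [k]. By parts, [X_k W_n Q] pairs to the derivative of
    [W_n] times [Q] plus [W_n] times the derivative of [Q]; the first terms telescope against the
    subtracted ones, and [W K = 0] removes the last. *)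
Lemma wick_step (k i : 'I_(N + N)) (W : nat -> ZP) Q K :
  (forall P, gauss (X (U k) * P) = gauss (mderiv i P)) -> W K = 0 ->
  \sum_(n < K.+1) gauss ((X (U k) * W n - (if n : nat is n'.+1 then mderiv i (W n') else 0)) * Q) =
  \sum_(n < K.+1) gauss (W n * mderiv i Q).
Proof.
move=> parts WK.
have e n : gauss ((X (U k) * W n - (if n is n'.+1 then mderiv i (W n') else 0)) * Q) =
    gauss (W n * mderiv i Q) +
    (gauss (mderiv i (W n) * Q) - (if n is n'.+1 then gauss (mderiv i (W n') * Q) else 0)).
  rewrite mulrBl gaussB -mulrA parts mpoly.mderivM gaussD addrAC addrC; congr (_ + (_ - _)).
  by case: n => // ; rewrite mul0r gauss0.
under eq_bigr do rewrite e.
rewrite big_split /= -[RHS]addr0; congr (_ + _).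
rewrite -(big_mkord xpredT (fun n => gauss (mderiv i (W n) * Q) -
  (if n is n'.+1 then gauss (mderiv i (W n') * Q) else 0))).
pose f n := if n is n'.+1 then gauss (mderiv i (W n') * Q) else 0.
under eq_bigr do rewrite -[gauss (mderiv i (W _) * Q)]/(f _.+1) -/(f _).
by rewrite telescope_sumr// /f WK mpoly.mderiv0 mul0r gauss0 subr0.
Qed.

(* [W i] is [(-1)^i / i!] times the [i]-th power of the Laplacian applied to the
   monomial: [\sum_i W i] is its Wick ordering, whose pairing with [G] is the
   corresponding derivative of [G]. *)
Lemma wick_exists m : exists W : nat -> ZP,
  (forall i, bihom (ldeg m) (rdeg m) i (W i)) /\
  forall z a b K, (ldeg m + rdeg m < K)%N ->
    \sum_(i < K) gauss (W i * linpow z a b) =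
    (a ^_ ldeg m * b ^_ rdeg m)%:R * evalz (X m) z * gauss (linpow z (a - ldeg m) (b - rdeg m)).
Proof.
have [n] := ubnP (mpoly.mdeg m); elim: n m => // n IH m mn.
have [m0|] := eqVneq (mpoly.mdeg m) 0%N.
  move: (m0); rewrite mdeg_lr => /eqP; rewrite addn_eq0 => /andP[/eqP l0 /eqP r0].
  exists (fun i => if i == 0%N then 1 else 0); split.
    move=> [|i]; last exact: bihom0.
    rewrite /= l0 r0 -mpoly.mpolyX0 => m'; rewrite mpoly.msuppX mem_seq1 => /eqP ->.
    by rewrite /ldeg /rdeg !big1// => j _; rewrite mpoly.mnm0E.
  move=> z a b [|K]//; rewrite l0 r0 addn0 => _; rewrite big_ord_recl big1 /= ?addr0; last first.
    by move=> i _; rewrite mul0r gauss0.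
  have -> : m = mpoly.mnm0 by apply/eqP; rewrite -mpoly.mdeg_eq0 m0.
  by rewrite mpoly.mpolyX0 evalz1 mul1r !subn0 !ffactn0 !mul1r.
rewrite mpoly.mdeg_eq0 => m0.
have [k mk] : exists k, m k != 0%N.
  apply/existsP; apply: contraNT m0; rewrite negb_exists => /forallP h; apply/eqP/mpoly.mnmP => k.
  by rewrite mpoly.mnm0E; apply/eqP; have := h k; rewrite negbK.
pose m' := mpoly.mnm_sub m (U k).
have mE : m = mpoly.mnm_add (U k) m'.
  apply/mpoly.mnmP => i; rewrite mpoly.mnmDE mpoly.mnmBE mpoly.mnm1E.
  have [<-|_] := eqVneq k i; last by rewrite add0n subn0.
  by rewrite add1n subn1 prednK// lt0n.
have dm' : (mpoly.mdeg m' < n)%N.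
  by move: mn; rewrite mE mpoly.mdegD mpoly.mdeg1 add1n ltnS.
have [W [hW eW]] := IH _ dm'.
have [[j kE]|[j kE]] : (exists j, k = L j) \/ (exists j, k = Rr j).
  by case: (splitP k) => j e; [left|right]; exists j; exact: val_inj.
- have lm : ldeg m = (ldeg m').+1 by rewrite mE kE ldegD ldegL add1n.
  have rm : rdeg m = rdeg m' by rewrite mE kE rdegD rdegL add0n.
  (* The commutator of the i-th power of the Laplacian with multiplication by [z_j] is [i] times its
     (i-1)-st power composed with the derivative in the conjugate of [z_j]; dividing by [(-1)^i i!]
     gives this recursion. *)
  exists (fun i => X (U (L j)) * W i - (if i is i'.+1 then mderiv (Rr j) (W i') else 0)); split.
    move=> i; rewrite lm rm; apply: bihomB; first exact: bihom_mull.
    by case: i => [|i]; [exact: bihom0|exact: bihom_derivr].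
  move=> z a b [|K]; rewrite lm rm // ltnS => lK.
  have WK : W K = 0.
    by apply: (bihom_eq0 (hW K)); rewrite gtn_min; apply/orP; left; exact: leq_trans (leq_addr _ _) lK.
  rewrite (wick_step _ (gauss_parts_l j) WK).
  under eq_bigr do rewrite mderiv_linpow_r -mpoly.mul_mpolyC mulrCA mpoly.mul_mpolyC gaussZ.
  rewrite -mulr_sumr eW; last by rewrite ltnS (leq_trans _ lK)// addSn leqnSn.
  rewrite mE kE mpoly.mpolyXD evalzM evalz_XL; case: a => [|a].
    by rewrite ffact0n /= !mul0n !mul0r.
  by rewrite /= subSS ffactSS !natrM; ring.
- have lm : ldeg m = ldeg m' by rewrite mE kE ldegD ldegR add0n.
  have rm : rdeg m = (rdeg m').+1 by rewrite mE kE rdegD rdegR add1n.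
  exists (fun i => X (U (Rr j)) * W i - (if i is i'.+1 then mderiv (L j) (W i') else 0)); split.
    move=> i; rewrite lm rm; apply: bihomB; first exact: bihom_mulr.
    by case: i => [|i]; [exact: bihom0|exact: bihom_derivl].
  move=> z a b [|K]; rewrite lm rm // addnS ltnS => lK.
  have WK : W K = 0.
    by apply: (bihom_eq0 (hW K)); rewrite gtn_min; apply/orP; right; exact: leq_ltn_trans (leq_addl _ _) lK.
  rewrite (wick_step _ (gauss_parts_r j) WK).
  under eq_bigr do rewrite mderiv_linpow_l -mpoly.mul_mpolyC mulrCA mpoly.mul_mpolyC gaussZ.
  rewrite -mulr_sumr eW; last by rewrite ltnS ltnW.
  rewrite mE kE mpoly.mpolyXD evalzM evalz_XR; case: b => [|b].
    by rewrite ffact0n /= !muln0 !mul0r.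
  by rewrite /= subSS ffactSS !natrM; ring.
Qed.

End Wick.

(** * Expansion of the Berezin kernel *)

Section NegBinomial.

(** Partial sums of the expansion of [(1 - x)^(-N-1)]. *)
Definition nbsum (K : comPzRingType) (N n : nat) (x : K) : K := \sum_(a < n) 'C(N + a, N)%:R * x ^+ a.

(** Pascal's rule; the subtracted term is the boundary term of the truncation. *)
Lemma nbsumS (K : comPzRingType) N n (x : K) :
  (1 - x) * nbsum N.+1 n x = nbsum N n x - 'C(N + n, N.+1)%:R * x ^+ n.
Proof.
elim: n => [|n IH].
  by rewrite /nbsum !big_ord0 mulr0 addn0 bin_small// mul0r subrr.
rewrite /nbsum !big_ord_recr /= mulrDr -/(nbsum _ _ _) IH -/(nbsum _ _ _).
rewrite addSn binS addnS binS !natrD exprS; ring.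
Qed.

Lemma nbsum0 (K : comPzRingType) n (x : K) : (1 - x) * nbsum 0 n x = 1 - x ^+ n.
Proof.
elim: n => [|n IH]; first by rewrite /nbsum big_ord0 expr0 subrr mulr0.
rewrite /nbsum big_ord_recr /= mulrDr -/(nbsum _ _ _) IH bin0 exprS; ring.
Qed.

Variable R : realType.
Implicit Types (r : R) (x : R[i]).

Lemma nbsum_ge0 N n r : 0 <= r -> 0 <= nbsum N n r.
Proof. by move=> r0; apply: sumr_ge0 => i _; rewrite mulr_ge0 ?exprn_ge0. Qed.

Lemma nbsum_le N n r : 0 <= r < 1 -> nbsum N n r <= (1 - r)^-1 ^+ N.+1.
Proof.
move=> /andP[r0 r1]; have r2 : 0 < 1 - r by rewrite subr_gt0.
elim: N n => [|N IH] n.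
  by rewrite expr1 -[X in _ <= X]mul1r ler_pdivlMr// mulrC nbsum0 gerBl exprn_ge0.
rewrite exprSr ler_pdivlMr// mulrC nbsumS (le_trans _ (IH n))// gerBl.
by rewrite mulr_ge0 ?exprn_ge0.
Qed.

(** For [s] halfway between [r] and 1, a single term at [s] is at most the whole sum, hence at most
    [(1-s)^(-N-1)]; the geometric factor [(r/s)^n] remains. *)
Lemma nbterm_cvg0 N r : 0 <= r < 1 -> 'C(N + n, N)%:R * r ^+ n @[n --> \oo] --> (0 : R).
Proof.
move=> /andP[r0 r1]; pose s := (1 + r) / 2.
have s0 : 0 < s by rewrite /s; lra.
have s1 : 0 <= s < 1 by rewrite /s; apply/andP; split; lra.
have rs : r / s < 1 by rewrite ltr_pdivrMr// mul1r /s; lra.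
have rs0 : 0 <= r / s by rewrite divr_ge0// ltW.
pose M := (1 - s)^-1 ^+ N.+1.
apply: (@squeeze_cvgr _ _ _ _ (cst 0) (fun n => M * (r / s) ^+ n)).
- apply: nearW => n; rewrite mulr_ge0 ?exprn_ge0//= expr_div_n mulrA ler_pdivlMr ?exprn_gt0//.
  rewrite mulrAC ler_wpM2r ?exprn_ge0//; apply: le_trans (nbsum_le N n.+1 s1).
  rewrite /nbsum big_ord_recr /= lerDr; apply: nbsum_ge0; exact: ltW.
- exact: cvg_cst.
- rewrite -(mulr0 M); apply: cvgM; first exact: cvg_cst.
  by apply: cvg_expr; rewrite ger0_norm.
Qed.

Lemma nbterm_ccvg0 N x : cabs x < 1 -> ccvg (fun n => 'C(N + n, N)%:R * x ^+ n) 0.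
Proof.
move=> x1; apply: (@ccvg_squeeze _ _ _ (fun n => 'C(N + n, N)%:R * cabs x ^+ n)).
  by move=> n; rewrite subr0 cabsM cabsX cabs_nat.
by apply: nbterm_cvg0; rewrite cabs_ge0.
Qed.

Lemma subr1_neq0 x : cabs x < 1 -> 1 - x != 0.
Proof.
by move=> x1; rewrite subr_eq0; apply: contraTneq x1 => <-; rewrite cabs1 ltxx.
Qed.

Lemma nbsum_ccvg N x : cabs x < 1 -> ccvg (fun n => nbsum N n x) ((1 - x)^-1 ^+ N.+1).
Proof.
move=> x1; have nz := subr1_neq0 x1; elim: N => [|N IH].
  have -> : (fun n => nbsum 0 n x) = (fun n => (1 - x)^-1 * (1 - 'C(0 + n, 0)%:R * x ^+ n)).
    by apply/funext => n; apply: (mulfI nz); rewrite nbsum0 mulVKf// bin0 mul1r.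
  rewrite expr1 -[X in ccvg _ X]mulr1 -[X in ccvg _ (_ * X)]subr0.
  apply: ccvgM; first exact: ccvg_cst.
  by apply: ccvgB; [exact: ccvg_cst|exact: nbterm_ccvg0].
have -> : (fun n => nbsum N.+1 n x) =
    (fun n => (1 - x)^-1 * (nbsum N n x - 'C(N + n, N.+1)%:R * x ^+ n)).
  by apply/funext => n; apply: (mulfI nz); rewrite nbsumS mulVKf.
rewrite exprS -[X in ccvg _ (_ * X)]subr0; apply: ccvgM; first exact: ccvg_cst.
apply: ccvgB => //.
apply: (@ccvg_squeeze _ _ _ (fun n => 'C(N.+1 + n, N.+1)%:R * cabs x ^+ n)).
  move=> n; rewrite subr0 cabsM cabsX cabs_nat ler_wpM2r ?exprn_ge0 ?cabs_ge0//.
  by rewrite ler_nat addSn binS leq_addr.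
by apply: nbterm_cvg0; rewrite cabs_ge0.
Qed.

Lemma cabs_nbsum N n x : cabs (nbsum N n x) <= nbsum N n (cabs x).
Proof.
apply: le_trans (cabs_sum _ _ _) _; apply: ler_sum => a _.
by rewrite cabsM cabsX cabs_nat.
Qed.

Lemma cabs_nbsum_le N n x r : cabs x <= r -> r < 1 -> cabs (nbsum N n x) <= (1 - r)^-1 ^+ N.+1.
Proof.
move=> xr r1; have x0 := cabs_ge0 x.
apply: le_trans (cabs_nbsum _ _ _) _; apply: le_trans (nbsum_le _ _ _) _.
  by rewrite x0 (le_lt_trans xr).
by apply: lerXn2r; rewrite ?nnegrE ?invr_ge0 ?lef_pV2 ?posrE ?subr_gt0 ?subr_ge0 ?lerD2l ?lerN2
  ?(le_lt_trans xr)//; lra.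
Qed.

End NegBinomial.

Section CauchySchwarz.
Variables (R : realType) (N : nat).
Implicit Types (z w : cvec R N).

Lemma cauchy_schwarz (a b : 'I_N -> R) :
  (\sum_j a j * b j) ^+ 2 <= (\sum_j a j ^+ 2) * (\sum_j b j ^+ 2).
Proof.
(* Lagrange's identity: this sum is twice the difference of the two sides. *)
have : 0 <= \sum_i \sum_j (a i * b j - a j * b i) ^+ 2.
  by apply: sumr_ge0 => i _; apply: sumr_ge0 => j _; exact: sqr_ge0.
have -> : \sum_i \sum_j (a i * b j - a j * b i) ^+ 2 =
    \sum_i \sum_j (a i ^+ 2 * b j ^+ 2 + b i ^+ 2 * a j ^+ 2 - 2 * (a i * b i * (a j * b j))).
  by apply: eq_bigr => i _; apply: eq_bigr => j _; ring.
under eq_bigr do rewrite sumrB big_split /= -!mulr_sumr.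
rewrite sumrB big_split /= -!mulr_suml -mulr_sumr -mulr_suml expr2.
set A := \sum_j a j ^+ 2; set B := \sum_j b j ^+ 2; set C := \sum_i a i * b i.
lra.
Qed.

Lemma cabs_inner_sqr z w : cabs (inner z w) ^+ 2 <= normsq z * normsq w.
Proof.
have h : cabs (inner z w) <= \sum_j cabs (z j) * cabs (w j).
  rewrite (le_trans (cabs_sum _ _ _))//; apply: ler_sum => j _.
  by rewrite cabsM -[(w j)^*%R]/((w j)^^*) cabs_conj.
apply: (@le_trans _ _ ((\sum_j cabs (z j) * cabs (w j)) ^+ 2)).
  by apply: lerXn2r; rewrite ?nnegrE ?cabs_ge0// sumr_ge0// => j _; rewrite mulr_ge0 ?cabs_ge0.
apply: le_trans (cauchy_schwarz _ _) _.
by rewrite /normsq; under eq_bigr do rewrite cabs_sqr; under [X in _ * X <= _]eq_bigr do rewrite cabs_sqr.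
Qed.

End CauchySchwarz.

Section Expansion.
Context d (T : measurableType d) (R : realType) (mu : {measure set T -> \bar R}).
Variables (D : set T) (mD : measurable D) (N : nat) (phi : T -> cvec R N).
Hypothesis mphi : forall j, cmeas D (fun x => phi x j).
Hypothesis phiD : forall x, D x -> normsq (phi x) < 1.
Variable U : T -> R[i].
Hypothesis iU : cintegrable mu D U.
Implicit Types (z : cvec R N).

Lemma cmeas_innerl z : cmeas D (fun x => inner z (phi x)).
Proof.
apply: cmeas_sum => j _; apply: cmeasM; first exact: cmeas_cst.
exact: (cmeas_conj (mphi j)).
Qed.

Lemma cmeas_innerr z : cmeas D (fun x => inner (phi x) z).
Proof. by apply: cmeas_sum => j _; apply: cmeasM => //; exact: cmeas_cst. Qed.

Lemma cabs_inner_phi z x : normsq z <= 1 -> D x -> cabs (inner z (phi x)) < 1.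
Proof.
move=> z1 Dx; have := cabs_inner_sqr z (phi x); have := phiD Dx.
have := normsq_ge0 (phi x); have := normsq_ge0 z; have := cabs_ge0 (inner z (phi x)); nra.
Qed.

Lemma cabs_inner_phir z x : normsq z <= 1 -> D x -> cabs (inner (phi x) z) < 1.
Proof. by move=> z1 Dx; rewrite -inner_conj cabs_conj cabs_inner_phi. Qed.

Definition moment a b z : R[i] := cint mu D (fun x => U x * (inner z (phi x) ^+ a * inner (phi x) z ^+ b)).

Lemma integrable_moment a b z : normsq z <= 1 ->
  cintegrable mu D (fun x => U x * (inner z (phi x) ^+ a * inner (phi x) z ^+ b)).
Proof.
move=> z1; apply: (@cintegrable_bounded _ _ _ _ _ _ _ 1) => //.
  by apply: cmeasM; apply: cmeasX; [exact: cmeas_innerl|exact: cmeas_innerr].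
move=> x Dx; rewrite cabsM !cabsX mulr_ile1 ?exprn_ge0 ?exprn_ile1 ?cabs_ge0 ?ltW//.
  exact: cabs_inner_phi.
exact: cabs_inner_phir.
Qed.

Lemma cabs_moment_le a b z : normsq z <= 1 ->
  cabs (moment a b z) <= 2 * Rintegral mu D (fun x => cabs (U x)).
Proof.
move=> z1; apply: le_trans (cabs_cint_le mD (integrable_moment a b z1)) _.
rewrite ler_pM2l//; apply: le_Rintegral => //.
- by apply: integrable_cabs => //; exact: integrable_moment.
- exact: integrable_cabs.
- move=> x Dx; rewrite cabsM -[X in _ <= X]mulr1 ler_wpM2l ?cabs_ge0//.
  rewrite cabsM !cabsX mulr_ile1 ?exprn_ge0 ?exprn_ile1 ?cabs_ge0 ?ltW//.
    exact: cabs_inner_phi.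
  exact: cabs_inner_phir.
Qed.

(** The square partial sums of the double series factor into two [nbsum], both bounded uniformly on
    [D], so dominated convergence gives integrability and the expansion together. *)
Let kernel_dominated z : normsq z < 1 ->
  cintegrable mu D (fun x => U x * ((absC2 (1 - inner z (phi x)))^-1 ^+ N.+1)%:C) /\
  ccvg (fun n => \sum_(a < n) \sum_(b < n) 'C(N + a, N)%:R * 'C(N + b, N)%:R * moment a b z)
    (cint mu D (fun x => U x * ((absC2 (1 - inner z (phi x)))^-1 ^+ N.+1)%:C)).
Proof.
move=> z1.
pose S n x : R[i] := nbsum N n (inner z (phi x)) * nbsum N n (inner (phi x) z).
have SE n : \sum_(a < n) \sum_(b < n) 'C(N + a, N)%:R * 'C(N + b, N)%:R * moment a b z =
    cint mu D (fun x => U x * S n x).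
  transitivity (cint mu D (fun x => \sum_(a < n) \sum_(b < n) 'C(N + a, N)%:R * 'C(N + b, N)%:R *
      (U x * (inner z (phi x) ^+ a * inner (phi x) z ^+ b)))).
    rewrite cint_sum//; last first.
      by move=> a _; apply: cintegrable_sum => // b _; apply: cintegrableZ => //; exact/integrable_moment/ltW.
    apply: eq_bigr => a _; rewrite cint_sum//; last first.
      by move=> b _; apply: cintegrableZ => //; exact/integrable_moment/ltW.
    by apply: eq_bigr => b _; rewrite cintZ//; exact/integrable_moment/ltW.
  apply: eq_cint => x _; rewrite /S /nbsum mulr_suml mulr_sumr; apply: eq_bigr => a _.
  rewrite !mulr_sumr; apply: eq_bigr => b _; ring.
(* By Cauchy-Schwarz [|<z,phi x>| <= |z| <= (1 + |z|^2) / 2 < 1], a bound independent of [x]. *)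
rewrite (funext SE); pose r := (1 + normsq z) / 2.
have z0 := normsq_ge0 z.
have r1 : r < 1 by rewrite /r; lra.
have zr x : D x -> cabs (inner z (phi x)) <= r.
  move=> Dx; have h := cabs_inner_sqr z (phi x); have h1 := phiD Dx.
  have h2 := normsq_ge0 (phi x); have h3 := cabs_ge0 (inner z (phi x)); rewrite /r; nra.
have zr' x : D x -> cabs (inner (phi x) z) <= r.
  by move=> Dx; rewrite -inner_conj cabs_conj zr.
have mSn n : cmeas D (S n).
  apply: cmeasM; apply: cmeas_sum => a _; (apply: cmeasM; first exact: cmeas_cst);
    apply: cmeasX; [exact: cmeas_innerl|exact: cmeas_innerr].
have mU := cintegrable_cmeas iU.
pose M := (1 - r)^-1 ^+ N.+1.
have [||||||h0 h] := @cint_dominated _ _ _ mu D (fun n x => U x * S n x)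
  (fun x => U x * ((absC2 (1 - inner z (phi x)))^-1 ^+ N.+1)%:C) (fun x => M * M * cabs (U x)) => //.
- by move=> n; exact: cmeasM.
- apply: cmeasM => //; apply: cmeas_real; apply: measurable_funX.
  have : cmeas D (fun x => (1 - inner z (phi x))^-1).
    by apply: cmeas_inv; apply: cmeasB; [exact: cmeas_cst|exact: cmeas_innerl].
  by move/measurable_absC2; under eq_fun do rewrite absC2V.
- apply: aeW => x Dx; apply: ccvgM; first exact: ccvg_cst.
  rewrite -absC2V -absC2X absC2E conjX conjV conjB conj1 inner_conj.
  by apply: ccvgM; apply: nbsum_ccvg; [exact: cabs_inner_phi (ltW z1) Dx|exact: cabs_inner_phir (ltW z1) Dx].
- under eq_fun do rewrite EFinM; apply: integrableZl => //; exact: integrable_cabs.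
- move=> n x Dx; rewrite cabsM mulrC ler_wpM2r ?cabs_ge0// cabsM.
  by apply: ler_pM; rewrite ?cabs_ge0//; apply: cabs_nbsum_le; auto.
Qed.

Lemma kernel_integrable z : normsq z < 1 ->
  cintegrable mu D (fun x => U x * ((absC2 (1 - inner z (phi x)))^-1 ^+ N.+1)%:C).
Proof. by case/kernel_dominated. Qed.

Lemma kernel_expansion z : normsq z < 1 ->
  ccvg (fun n => \sum_(a < n) \sum_(b < n) 'C(N + a, N)%:R * 'C(N + b, N)%:R * moment a b z)
    (cint mu D (fun x => U x * ((absC2 (1 - inner z (phi x)))^-1 ^+ N.+1)%:C)).
Proof. by case/kernel_dominated. Qed.

End Expansion.

(** * Uniqueness of the coefficients of double series *)

Section DoubleSeries.
Variable R : realType.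
Implicit Types (c : nat -> nat -> R[i]) (x y : R[i]).

(* Divided by the [s]-th power of the conjugate of [y], the sum is a polynomial
   in the quotient of [y] by its conjugate; the points [y = 1 + i t] give infinitely many quotients. *)
Lemma homogeneous_unique (c : nat -> R[i]) s :
  (forall y, \sum_(a < s.+1) c a * y ^+ a * y^^* ^+ (s - a) = 0) ->
  forall a, (a <= s)%N -> c a = 0.
Proof.
move=> h.
pose y (t : nat) : R[i] := 1 +i* t%:R.
have y0 t : y t != 0 by rewrite eq_complex /= oner_eq0.
have yc0 t : (y t)^^* != 0 by rewrite conjc_eq0.
pose w t := y t / (y t)^^*.
have winj : injective w.
  move=> t u /(congr1 (fun v => v * ((y t)^^* * (y u)^^*))).
  rewrite /w mulrA divfK// [(y t)^^* * _]mulrC mulrA divfK// => /(congr1 (@complex.Im R)) /=.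
  have h2 : (2 : R) != 0 by rewrite pnatr_eq0.
  rewrite !mul1r !mulr1 => e; apply/eqP; rewrite -(@eqr_nat R); apply/eqP; lra.
pose p : {poly R[i]} := \poly_(a < s.+1) c a.
have pw t : p.[w t] = 0.
  rewrite horner_poly.
  transitivity ((\sum_(a < s.+1) c a * y t ^+ a * (y t)^^* ^+ (s - a)) / (y t)^^* ^+ s).
    rewrite mulr_suml; apply: eq_bigr => a _.
    rewrite /w expr_div_n -!mulrA; congr (_ * (_ * _)).
    have as_ : (a <= s)%N by rewrite -ltnS.
    apply: (mulfI (expf_neq0 a (yc0 t))); rewrite divff ?expf_neq0// mulrA -exprD subnKC//.
    by rewrite divff ?expf_neq0.
  by rewrite h mul0r.
have p0 : p = 0.
  apply: (@roots_geq_poly_eq0 _ p (map w (iota 0 s.+1))).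
  - by apply/allP => _ /mapP[t _ ->]; apply/rootP.
  - by rewrite map_inj_uniq ?iota_uniq.
  - by rewrite size_map size_iota size_poly.
move=> a sa; have := congr1 (fun q : {poly R[i]} => q`_a) p0.
by rewrite coef_poly ltnS sa coef0.
Qed.

Lemma sum_diag (V : nmodType) (F : nat -> nat -> V) s n : (s < n)%N ->
  \sum_(a < n) \sum_(b < n) (if (a + b == s)%N then F a b else 0) = \sum_(a < s.+1) F a (s - a)%N.
Proof.
move=> sn; rewrite (big_ord_widen n (fun a => F a (s - a)%N))// [RHS]big_mkcond /=.
apply: eq_bigr => a _; case: ifPn => [as_|]; last first.
  rewrite ltnS -ltnNge => sa; rewrite big1// => b _; rewrite ifF//; apply/negbTE.
  by rewrite neq_ltn (leq_trans sa) ?leq_addr ?orbT.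
have bn : (s - a < n)%N by rewrite (leq_ltn_trans (leq_subr _ _)).
rewrite (bigD1 (Ordinal bn))//= subnKC// eqxx big1 ?addr0// => b bne.
rewrite ifF//; apply: contraNF bne => /eqP e; apply/eqP/val_inj => /=.
by rewrite -e addKn.
Qed.

(** Induction on [s = a + b]. Once all lower coefficients vanish, put [x = r y]: the part of degree
    [s] is [r^s H], and the rest is at most a constant times [r^(s+1)] by the weighted bound.
    Letting [r] tend to 0 gives [H = 0] for every [y], and [homogeneous_unique] applies. *)
Lemma double_series_unique c (M : R) :
  (forall n, \sum_(a < n) \sum_(b < n) cabs (c a b) * 2^-1 ^+ (a + b) <= M) ->
  (forall x, cabs x < 1 -> ccvg (fun n => \sum_(a < n) \sum_(b < n) c a b * x ^+ a * x^^* ^+ b) 0) ->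
  forall a b, c a b = 0.
Proof.
move=> cM cv.
suff main s : forall a b, (a + b < s)%N -> c a b = 0 by move=> a b; apply: (main (a + b).+1).
elim: s => // s IH a b; rewrite ltnS leq_eqVlt => /predU1P[abs|]; last exact: IH.
have -> : b = (s - a)%N by rewrite -abs addKn.
have as_ : (a <= s)%N by rewrite -abs leq_addr.
apply: (@homogeneous_unique (fun a => c a (s - a)%N) s) => // y.
set H := \sum_(_ < _) _.
have M0 : 0 <= M.
  by rewrite (le_trans _ (cM 0%N))// big_ord0.
(* Chosen so that [2 |x| <= r L]: the 2 compensates the weights [2^(-a-b)], the 1 keeps [L]
   positive. *)
pose L : R := 2 * (cabs y + 1).
have L0 : 0 < L by rewrite /L mulr_gt0// ltr_wpDl ?cabs_ge0.
have bound (r : R) : 0 < r -> r * L < 1 -> cabs H <= r * (L ^+ s.+1 * M).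
  move=> r0 rL; pose x := r%:C * y.
  have xr : cabs x = r * cabs y by rewrite /x cabsM cabs_real gtr0_norm.
  have y0 := cabs_ge0 y.
  have xL : 2 * cabs x <= r * L by rewrite xr /L; nra.
  have x1 : cabs x < 1 by have := cabs_ge0 x; lra.
  have HE n : (s < n)%N -> (r ^+ s)%:C * H =
     \sum_(a < n) \sum_(b < n) (if (a + b == s)%N then c a b * x ^+ a * x^^* ^+ b else 0).
    move=> sn; rewrite (@sum_diag _ (fun a b => c a b * x ^+ a * x^^* ^+ b))// mulr_sumr.
    apply: eq_bigr => i _; rewrite /x conjM conjc_real !exprMn.
    have is_ : (i <= s)%N by rewrite -ltnS.
    have -> : (r ^+ s)%:C = r%:C ^+ i * r%:C ^+ (s - i) :> R[i] by rewrite -exprD subnKC// rmorphXn.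
    ring.
  have cvs : ccvg (fun n => (r ^+ s)%:C * H -
     \sum_(a < n + s.+1) \sum_(b < n + s.+1) c a b * x ^+ a * x^^* ^+ b) ((r ^+ s)%:C * H - 0).
    apply: ccvgB; first exact: ccvg_cst.
    by have [h1 h2] := cv _ x1; split; [move: h1|move: h2]; rewrite -(cvg_shiftn s.+1).
  have h : r ^+ s * cabs H <= (r * L) ^+ s.+1 * M.
    have -> : r ^+ s * cabs H = cabs ((r ^+ s)%:C * H - 0).
      by rewrite subr0 cabsM cabs_real ger0_norm// exprn_ge0 ?ltW.
    apply: ccvg_cabs_le cvs => n; rewrite (HE (n + s.+1)%N) ?leq_addl// -sumrB.
    apply: le_trans (cabs_sum _ _ _) _.
    apply: (@le_trans _ _ ((r * L) ^+ s.+1 * \sum_(a < n + s.+1) \sum_(b < n + s.+1)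
        cabs (c a b) * 2^-1 ^+ (a + b))); last by rewrite ler_wpM2l// exprn_ge0// mulr_ge0 ?ltW.
    rewrite mulr_sumr; apply: ler_sum => i _; rewrite -sumrB.
    apply: le_trans (cabs_sum _ _ _) _; rewrite mulr_sumr; apply: ler_sum => j _.
    have pos : 0 <= (r * L) ^+ s.+1 * (cabs (c i j) * 2^-1 ^+ (i + j)).
      apply: mulr_ge0; first by apply/exprn_ge0/mulr_ge0; exact: ltW.
      by apply: mulr_ge0; rewrite ?cabs_ge0 ?exprn_ge0 ?invr_ge0.
    case: eqP => [_|/eqP ijs]; first by rewrite subrr cabs0.
    rewrite sub0r cabsN; have [ls|gs] := ltnP (i + j)%N s.
      by rewrite IH// !mul0r cabs0 mul0r mulr0.
    have {}gs : (s.+1 <= i + j)%N by rewrite ltn_neqAle eq_sym ijs.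
    rewrite !cabsM !cabsX cabs_conj -mulrA -exprD mulrCA ler_wpM2l ?cabs_ge0//.
    rewrite -(@ler_pM2r _ (2 ^+ (i + j))) ?exprn_gt0// -[X in _ <= X]mulrA -!exprMn mulVf ?pnatr_eq0//.
    rewrite expr1n mulr1 [cabs x * 2]mulrC.
    apply: (@le_trans _ _ ((2 * cabs x) ^+ s.+1)).
      apply: ler_wiXn2l => //; first by rewrite mulr_ge0// cabs_ge0.
      by rewrite (le_trans xL)// ltW.
    apply: lerXn2r; rewrite ?nnegrE //; apply: mulr_ge0 => //; by [exact: cabs_ge0|exact: ltW].
  have rs : 0 < r ^+ s by rewrite exprn_gt0.
  rewrite -(ler_pM2l rs) (le_trans h)//.
  by rewrite exprMn exprS le_eqVlt; apply/orP; left; apply/eqP; ring.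
apply/eqP; rewrite -cabs_eq0 eq_le cabs_ge0 andbT leNgt; apply/negP => H0.
pose K := L ^+ s.+1 * M.
have K0 : 0 <= K by rewrite mulr_ge0// exprn_ge0// ltW.
(* The first entry gives [r L < 1], as [bound] requires; the second gives [r K < |H|], which
   contradicts it. *)
pose r := Num.min ((2 * L)^-1) (cabs H / (2 * (K + 1))).
have r0 : 0 < r by rewrite lt_min invr_gt0 mulr_gt0//= divr_gt0// mulr_gt0// ltr_wpDl.
have r1 : r <= (2 * L)^-1 by rewrite ge_min lexx.
have r2 : r <= cabs H / (2 * (K + 1)) by rewrite ge_min lexx orbT.
have rL : r * L < 1.
  apply: (@le_lt_trans _ _ ((2 * L)^-1 * L)); first by rewrite ler_pM2r.
  by rewrite invfM mulfVK ?gt_eqF// invf_lt1// ltr1n.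
have := bound r r0 rL; rewrite -/K leNgt => /negP; apply.
apply: (@le_lt_trans _ _ (cabs H / (2 * (K + 1)) * K)); first by rewrite ler_wpM2r.
rewrite mulrAC ltr_pdivrMr ?mulr_gt0// ?ltr_wpDl// ltr_pM2l//; lra.
Qed.

End DoubleSeries.

Section ShiftedCoef.
Variables (K : comPzRingType) (N : nat).

(* Coefficient of [x^a y^b] in [x^p y^q (1 - tau x y)^(-N-1)]. *)
Definition shcoef (p q : nat) (tau : K) (a b : nat) : K :=
  if [&& (p <= a)%N, (q <= b)%N & (a - p == b - q)%N]
  then 'C(N + (a - p), N)%:R * tau ^+ (a - p) else 0.

Lemma sum_shift (h : nat -> K) p n :
  \sum_(a < n) (if (p <= a)%N then h (a - p)%N else 0) = \sum_(j < n - p) h j.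
Proof.
elim: n => [|n IH]; first by rewrite sub0n !big_ord0.
rewrite big_ord_recr /= IH; have [pn|np] := leqP p n; first by rewrite subSn// big_ord_recr.
by rewrite addr0 (eqP (ltnW np)) (eqP np).
Qed.

(** In the square [a, b < n] a diagonal index [j] occurs exactly when [p + j < n] and [q + j < n],
    which is where the maximum comes from. *)
Lemma sum_shcoef p q tau x y n :
  \sum_(a < n) \sum_(b < n) shcoef p q tau a b * x ^+ a * y ^+ b =
  x ^+ p * y ^+ q * nbsum N (n - maxn p q) (tau * (x * y)).
Proof.
pose g j : K := x ^+ p * y ^+ q * ('C(N + j, N)%:R * (tau * (x * y)) ^+ j).
transitivity (\sum_(a < n) (if (p <= a)%N then
   (fun j => if (q + j < n)%N then g j else 0) (a - p)%N else 0)).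
  apply: eq_bigr => a _; case: ifPn => pa; last first.
    by apply: big1 => b _; rewrite /shcoef (negbTE pa) /= !mul0r.
  case: ifPn => [qn|nq]; last first.
    apply: big1 => b _; rewrite /shcoef pa /=; case: ifPn => [/andP[qb /eqP e]|_]; last by rewrite !mul0r.
    by move: nq; rewrite e subnKC// ltn_ord.
  rewrite (bigD1 (Ordinal qn))//= big1 ?addr0 => [|b bne]; last first.
    rewrite /shcoef pa /=; case: ifPn => [/andP[qb /eqP e]|_]; last by rewrite !mul0r.
    by case/eqP: bne; apply: val_inj; rewrite /= e subnKC.
  rewrite /shcoef pa leq_addr addKn eqxx /= /g.
  have -> : x ^+ a = x ^+ p * x ^+ (a - p) by rewrite -exprD subnKC.
  by rewrite exprD !exprMn; ring.
rewrite (sum_shift (fun j => if (q + j < n)%N then g j else 0)) /nbsum mulr_sumr.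
have le : (n - maxn p q <= n - p)%N by rewrite leq_sub2l// leq_maxl.
rewrite [RHS](big_ord_widen _ (fun j => g j) le) [RHS]big_mkcond /=.
apply: eq_bigr => j _; rewrite (_ : (j < n - maxn p q)%N = (q + j < n)%N)//.
have jp : (p + j < n)%N by rewrite -ltn_subRL.
rewrite ltn_subRL /maxn; case: ifP => // /negbT; rewrite -leqNgt => qp.
by rewrite jp; apply/esym/leq_ltn_trans/jp; rewrite leq_add2r.
Qed.

End ShiftedCoef.

Section MomentCoefficients.
Import -(notations) mpoly.
Context d (T : measurableType d) (R : realType) (mu : {measure set T -> \bar R}).
Variables (D : set T) (mD : measurable D) (N : nat) (phi : T -> cvec R N).
Hypothesis mphi : forall j, cmeas D (fun x => phi x j).
Hypothesis phiD : forall x, D x -> normsq (phi x) < 1.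
Variable U : T -> R[i].
Hypothesis iU : cintegrable mu D U.
Local Notation mmt := (moment mu D phi U).
Implicit Types (z zeta : cvec R N).

Lemma normsq_scale (x : R[i]) z : normsq (fun j => x * z j) = absC2 x * normsq z.
Proof. by rewrite /normsq mulr_sumr; apply: eq_bigr => j _; rewrite absC2M. Qed.

Lemma inner_scalel (x : R[i]) z w : inner (fun j => x * z j) w = x * inner z w.
Proof. by rewrite !innerE mulr_sumr; apply: eq_bigr => j _; rewrite mulrA. Qed.

Lemma inner_scaler (x : R[i]) z w : inner z (fun j => x * w j) = x^^* * inner z w.
Proof. by rewrite -inner_conj inner_scalel conjM inner_conj. Qed.

Lemma mono_scale (x : R[i]) (a b : 'I_N -> nat) z :
  mono a b (fun j => x * z j) = x ^+ (\sum_j a j) * x^^* ^+ (\sum_j b j) * mono a b z.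
Proof.
rewrite /mono -!prodrXr -!big_split /=; apply: eq_bigr => j _.
by rewrite conjM !exprMn; ring.
Qed.

Lemma moment_scale a b z (x : R[i]) : normsq z <= 1 ->
  mmt a b (fun j => x * z j) = x ^+ a * x^^* ^+ b * mmt a b z.
Proof.
move=> z1; rewrite /moment -cintZ//; last exact: integrable_moment.
by apply: eq_cint => t _; rewrite inner_scalel inner_scaler !exprMn; ring.
Qed.

Lemma ccvg_subn (u : nat -> R[i]) l c : ccvg u l -> ccvg (fun n => u (n - c)%N) l.
Proof.
move=> [h1 h2]; split; rewrite -(cvg_shiftn c); [move: h1|move: h2];
  apply: cvg_trans; apply: near_eq_cvg; apply: nearW => n /=; by rewrite addnK.
Qed.

Variable f : zpoly R N.
Hypothesis Uf : forall z, normsq z < 1 ->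
  cint mu D (fun x => U x * ((absC2 (1 - inner z (phi x)))^-1 ^+ N.+1)%:C) =
  evalz f z * ((1 - normsq z)^-1 ^+ N.+1)%:C.

(** At [z = x zeta] both sides of [Uf] are double series in [x] and its conjugate, and their
    coefficients agree by [double_series_unique]. Only [|x| < 1] is used, so [zeta] may lie on the
    unit sphere, as the necessity proof requires. *)
Lemma moment_coefficients zeta a b : normsq zeta <= 1 ->
  'C(N + a, N)%:R * 'C(N + b, N)%:R * mmt a b zeta =
  \sum_(m <- mpoly.msupp f) mpoly.mcoeff m f *
     mono (fun j => m (lshift N j)) (fun j => m (rshift N j)) zeta *
     shcoef N (ldeg m) (rdeg m) (normsq zeta)%:C a b.
Proof.
move=> z1; have z0 := normsq_ge0 zeta.
pose fm (m : mpoly.multinom (N + N)) := mpoly.mcoeff m f *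
     mono (fun j => m (lshift N j)) (fun j => m (rshift N j)) zeta.
pose tau : R[i] := (normsq zeta)%:C.
pose e a b := \sum_(m <- mpoly.msupp f) fm m * shcoef N (ldeg m) (rdeg m) tau a b.
pose c a b := 'C(N + a, N)%:R * 'C(N + b, N)%:R * mmt a b zeta - e a b.
suff : c a b = 0 by move/eqP; rewrite subr_eq0 => /eqP.
(* [B] bounds all moments and [H] the sums of [C(N+a,N) 2^(-a)]; together they give the weighted
   bound of [double_series_unique]. *)
pose B := 2 * Rintegral mu D (fun x => cabs (U x)).
pose H : R := (1 - 2^-1)^-1 ^+ N.+1.
have half : 0 <= (2^-1 : R) < 1 by rewrite invr_ge0 invf_lt1// ltr1n ler0n.
have esum x y n : \sum_(a < n) \sum_(b < n) e a b * x ^+ a * y ^+ b =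
   \sum_(m <- mpoly.msupp f) fm m * (x ^+ ldeg m * y ^+ rdeg m *
       nbsum N (n - maxn (ldeg m) (rdeg m)) (tau * (x * y))).
  under eq_bigr do under eq_bigr do rewrite /e !mulr_suml.
  under eq_bigr do rewrite exchange_big /=.
  rewrite exchange_big /=; apply: eq_bigr => m _; rewrite -sum_shcoef mulr_sumr.
  by apply: eq_bigr => i _; rewrite mulr_sumr; apply: eq_bigr => j _; rewrite !mulrA.
apply: (@double_series_unique _ c (B * (H * H) + \sum_(m <- mpoly.msupp f) cabs (fm m) * H)).
  move=> n.
  apply: (@le_trans _ _ (\sum_(a < n) \sum_(b < n)
     (B * ('C(N + a, N)%:R * 2^-1 ^+ a) * ('C(N + b, N)%:R * 2^-1 ^+ b) +
      \sum_(m <- mpoly.msupp f) cabs (fm m) * (shcoef N (ldeg m) (rdeg m) 1 a b * 2^-1 ^+ a * 2^-1 ^+ b)))).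
    apply: ler_sum => i _; apply: ler_sum => j _.
    rewrite exprD mulrA /c.
    apply: (@le_trans _ _ ((cabs ('C(N + i, N)%:R * 'C(N + j, N)%:R * mmt i j zeta) + cabs (e i j))
      * 2^-1 ^+ i * 2^-1 ^+ j)).
      by rewrite !ler_wpM2r ?exprn_ge0 ?invr_ge0// cabsB.
    rewrite !mulrDl; apply: lerD.
      rewrite !cabsM !cabs_nat.
      have := cabs_moment_le mD mphi phiD iU i j z1; rewrite -/B => hB.
      rewrite [X in _ <= X](_ : _ = 'C(N + i, N)%:R * 'C(N + j, N)%:R * B * 2^-1 ^+ i * 2^-1 ^+ j);
        last by ring.
      by rewrite !ler_wpM2r ?exprn_ge0 ?invr_ge0// ler_wpM2l// mulr_ge0.
    rewrite [X in _ <= X](_ : _ = (\sum_(m <- mpoly.msupp f) cabs (fm m) *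
        shcoef N (ldeg m) (rdeg m) 1 i j) * 2^-1 ^+ i * 2^-1 ^+ j); last first.
      by rewrite !mulr_suml; apply: eq_bigr => m _; rewrite !mulrA.
    rewrite !ler_wpM2r ?exprn_ge0 ?invr_ge0//.
    apply: le_trans (cabs_sum _ _ _) _; apply: ler_sum => m _.
    rewrite cabsM ler_wpM2l ?cabs_ge0// /shcoef; case: ifP => _; last by rewrite cabs0.
    rewrite cabsM cabsX cabs_nat cabs_real expr1n mulr1 -[X in _ <= X]mulr1 ler_wpM2l//.
    by rewrite exprn_ile1// ger0_norm.
  under eq_bigr do rewrite big_split /=; rewrite big_split /=; apply: lerD.
    rewrite (_ : \sum_(i < n) _ = B * (nbsum N n 2^-1 * nbsum N n 2^-1)); last first.
      rewrite /nbsum mulr_suml mulr_sumr; apply: eq_bigr => i _.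
        by rewrite !mulr_sumr; apply: eq_bigr => j _; rewrite !mulrA.
    apply: ler_wpM2l.
      by rewrite mulr_ge0//; apply: Rintegral_ge0 => x _; exact: cabs_ge0.
    by apply: ler_pM; rewrite ?nbsum_ge0 ?invr_ge0//; exact: nbsum_le.
  under eq_bigr do rewrite exchange_big /=.
  rewrite exchange_big /=; apply: ler_sum => m _.
  under eq_bigr do rewrite -mulr_sumr.
  rewrite -mulr_sumr ler_wpM2l ?cabs_ge0// sum_shcoef mul1r.
  have h4 : 0 <= (2^-1 * 2^-1 : R) < 1 by have := half; set h := 2^-1; move=> /andP[? ?]; apply/andP;
    split; nra.
  apply: (@le_trans _ _ (1 * 1 * H)); last by rewrite !mul1r.
  apply: ler_pM; rewrite ?mulr_ge0 ?exprn_ge0 ?invr_ge0 ?nbsum_ge0 ?mulr_ge0 ?invr_ge0//.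
    by apply: ler_pM; rewrite ?exprn_ge0 ?invr_ge0// exprn_ile1 ?invr_ge0// invf_le1// ler1n.
  apply: le_trans (nbsum_le _ _ h4) _; apply: lerXn2r; rewrite ?nnegrE ?invr_ge0 ?lef_pV2 ?posrE; lra.
move=> x x1; pose z : cvec R N := fun j => x * zeta j.
have x2 : absC2 x < 1 by rewrite -cabs_sqr expr_lt1// cabs_ge0.
have x20 := absC2_ge0 x.
have zz : normsq z < 1 by rewrite /z normsq_scale; nra.
have cE n : \sum_(a < n) \sum_(b < n) c a b * x ^+ a * x^^* ^+ b =
   \sum_(a < n) \sum_(b < n) 'C(N + a, N)%:R * 'C(N + b, N)%:R * mmt a b z -
   \sum_(m <- mpoly.msupp f) fm m * (x ^+ ldeg m * x^^* ^+ rdeg m *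
       nbsum N (n - maxn (ldeg m) (rdeg m)) (tau * (x * x^^*))).
  rewrite -esum -sumrB; apply: eq_bigr => i _; rewrite -sumrB; apply: eq_bigr => j _.
  by rewrite /c moment_scale//; ring.
rewrite (funext cE).
have txx : tau * (x * x^^*) = (normsq z)%:C.
  by rewrite /tau /z normsq_scale -absC2E -rmorphM mulrC.
have fE : evalz f z = \sum_(m <- mpoly.msupp f) fm m * (x ^+ ldeg m * x^^* ^+ rdeg m).
  by rewrite evalzE; apply: eq_bigr => m _; rewrite mono_scale /fm; ring.
have E0 : 0 = evalz f z * ((1 - normsq z)^-1 ^+ N.+1)%:C -
   \sum_(m <- mpoly.msupp f) fm m * (x ^+ ldeg m * x^^* ^+ rdeg m * (1 - tau * (x * x^^*))^-1 ^+ N.+1).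
  rewrite fE mulr_suml -sumrB big1// => m _.
  by rewrite txx rmorphXn fmorphV rmorphB /= rmorph1; ring.
rewrite [X in ccvg _ X]E0; apply: ccvgB.
  by rewrite -Uf//; exact (kernel_expansion mD mphi phiD iU zz).
apply: ccvg_sum => m _; apply: ccvgM; first exact: ccvg_cst.
apply: ccvgM; first exact: ccvg_cst.
apply: (@ccvg_subn (fun n => nbsum N n (tau * (x * x^^*)))); apply: nbsum_ccvg.
by rewrite txx cabs_real ger0_norm ?normsq_ge0.
Qed.

End MomentCoefficients.

Lemma digits_inj (K n : nat) (f g : 'I_n -> nat) :
  (forall i, f i < K)%N -> (forall i, g i < K)%N ->
  (\sum_(i < n) f i * K ^ i = \sum_(i < n) g i * K ^ i)%N -> f =1 g.
Proof.
elim: n f g => [|n IH] f g fK gK; first by move=> _ [].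
have K0 : (0 < K)%N by exact: leq_ltn_trans (fK ord0).
have e (h : 'I_n.+1 -> nat) : (\sum_(i < n.+1) h i * K ^ i =
    (\sum_(i < n) h (lift ord0 i) * K ^ i) * K + h ord0)%N.
  rewrite big_ord_recl expn0 muln1 addnC big_distrl /=; congr addn; apply: eq_bigr => i _.
  by rewrite /bump /= add1n expnSr mulnA.
rewrite !e => E.
have E0 : f ord0 = g ord0 by have := congr1 (modn^~ K) E; rewrite !modnMDl !modn_small.
have E1 : (\sum_(i < n) f (lift ord0 i) * K ^ i = \sum_(i < n) g (lift ord0 i) * K ^ i)%N.
  by have := congr1 (divn^~ K) E; rewrite !divnMDl// !divn_small// !addn0.
move=> i; case: (unliftP ord0 i) => [j|] -> //.
exact: (IH (fun i => f (lift ord0 i)) (fun i => g (lift ord0 i))).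
Qed.

(** * Polynomials determined by their values, and polarization *)

Section Uniqueness.
Import -(notations) mpoly.
Variables (R : realType) (N : nat).
Local Notation ZP := (zpoly R N).
Local Notation mnm := (mpoly.multinom (N + N)).
Local Notation X m := (@mpoly.mpolyX (N + N) R[i] m).
Local Notation U i := (@mpoly.mnm1 (N + N) i).
Local Notation msupp := (@mpoly.msupp (N + N) R[i]).
Local Notation mcoeff := (@mpoly.mcoeff (N + N) R[i]).
Local Notation L := (@lshift N N).
Local Notation Rr := (@rshift N N).
Implicit Types (P Q F : ZP) (m : mnm) (z xi : cvec R N).

(* Along the curves [z_j = y^(K^j) conj(y)^(K^(N+j))], distinct monomials of [P]
   become distinct monomials in [y] and its conjugate once [K] exceeds the degree. *)
Lemma evalz_eq0 P : (forall z, evalz P z = 0) -> P = 0.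
Proof.
move=> h.
pose K := (\max_(m <- msupp P) mpoly.mdeg m).+1.
have mK m i : m \in msupp P -> (m i < K)%N.
  move=> mP; rewrite ltnS; apply: leq_trans (leq_bigmax_seq _ mP isT).
  by rewrite mpoly.mdegE (bigD1 i)//= leq_addr.
pose al m := (\sum_i m i * K ^ i)%N.
pose be m := (\sum_j m (L j) * K ^ (N + j) + \sum_j m (Rr j) * K ^ j)%N.
pose z (y : R[i]) : cvec R N := fun j => y ^+ (K ^ j) * y^^* ^+ (K ^ (N + j)).
have mz y m : mono (fun j => m (L j)) (fun j => m (Rr j)) (z y) = y ^+ al m * y^^* ^+ be m.
  rewrite /al /be big_split_ord /= !exprD -!prodrXr /mono /z -!big_split /=.
  apply: eq_bigr => j _; rewrite conjM !conjX conjcK !exprMn -!exprM.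
  by rewrite !(mulnC (m _)) (mulrC (y^^* ^+ (K ^ j * _))) mulrACA.
pose c a b := \sum_(m <- msupp P) (if (al m == a) && (be m == b) then mcoeff m P else 0).
have csum (V : nmodType) (F : nat -> nat -> V) (al' be' : nat) n :
   \sum_(a < n) \sum_(b < n) (if (al' == a) && (be' == b) then F a b else 0) =
   if (al' < n)%N && (be' < n)%N then F al' be' else 0.
  case: ifPn => [/andP[an bn]|abn].
    rewrite (bigD1 (Ordinal an))//= (bigD1 (Ordinal bn))//= !eqxx big1 ?addr0; last first.
      by move=> j jb; rewrite ifF//; apply: contraNF jb => /eqP e; apply/eqP/val_inj.
    rewrite big1 ?addr0// => i ia; rewrite big1// => j _; rewrite ifF//.
    by apply: contraNF ia => /andP[/eqP e _]; apply/eqP/val_inj.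
  rewrite big1// => i _; rewrite big1// => j _; rewrite ifF//.
  by apply: contraNF abn => /andP[/eqP -> /eqP ->]; rewrite !ltn_ord.
have c0 : forall a b, c a b = 0.
  apply: (@double_series_unique _ c (\sum_(m <- msupp P) cabs (mcoeff m P))).
    move=> n; apply: (@le_trans _ _ (\sum_(a < n) \sum_(b < n) \sum_(m <- msupp P)
       (if (al m == a) && (be m == b) then cabs (mcoeff m P) else 0))).
      apply: ler_sum => a _; apply: ler_sum => b _.
      rewrite -[leRHS]mulr1; apply: ler_pM; rewrite ?cabs_ge0 ?exprn_ge0 ?invr_ge0//.
        apply: le_trans (cabs_sum _ _ _) _; apply: ler_sum => m _.
        by case: ifP => _; rewrite ?cabs0.
      by rewrite exprn_ile1 ?invr_ge0// invf_le1// ler1n.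
    under eq_bigr do rewrite exchange_big /=.
    rewrite exchange_big /=; apply: ler_sum => m _.
    rewrite (csum _ (fun _ _ => cabs (mcoeff m P))).
    by case: ifP => _; rewrite ?cabs_ge0.
  move=> x _; pose n0 := (\max_(m <- msupp P) maxn (al m) (be m)).+1.
  have E n : \sum_(a < n + n0) \sum_(b < n + n0) c a b * x ^+ a * x^^* ^+ b = 0.
    rewrite -[RHS](h (z x)) evalzE.
    under eq_bigr do under eq_bigr do rewrite /c !mulr_suml.
    under eq_bigr do rewrite exchange_big /=.
    rewrite exchange_big /=; rewrite big_seq [RHS]big_seq; apply: eq_bigr => m mP.
    rewrite mz; transitivity (\sum_(a < n + n0) \sum_(b < n + n0)
       (if (al m == a) && (be m == b) then mcoeff m P * x ^+ a * x^^* ^+ b else 0)).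
      by apply: eq_bigr => a _; apply: eq_bigr => b _; case: ifP => _; rewrite ?mul0r.
    rewrite (csum _ (fun a b => mcoeff m P * x ^+ a * x^^* ^+ b)).
    have : (maxn (al m) (be m) < n + n0)%N.
      by rewrite ltn_addl// ltnS (@leq_bigmax_seq _ _ _ (fun m => maxn (al m) (be m)) m mP isT).
    by rewrite gtn_max => ->; rewrite mulrA.
  by split; rewrite -(cvg_shiftn n0); under eq_fun do rewrite E; exact: cvg_cst.
apply/mpoly.mpolyP => m0; rewrite mpoly.mcoeff0.
have [mP|] := boolP (m0 \in msupp P); last exact: mpoly.memN_msupp_eq0.
have := c0 (al m0) (be m0); rewrite /c (bigD1_seq m0) ?mpoly.msupp_uniq//= !eqxx big_seq_cond big1 ?addr0//.
move=> m /andP[mP' mm0]; rewrite ifF//; apply: contraNF mm0 => /andP[/eqP e _].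
by apply/eqP/mpoly.mnmP; apply: (digits_inj _ _ e) => i; exact: mK.
Qed.

Lemma linpowE z a b : linpow z a b = \sum_(f : {ffun 'I_a -> 'I_N}) \sum_(g : {ffun 'I_b -> 'I_N})
  ((\prod_i z (f i)) * (\prod_i (z (g i))^^*)) *: (\prod_i X (U (Rr (f i))) * \prod_i X (U (L (g i)))).
Proof.
have e n (c : 'I_N -> R[i]) (Y : 'I_N -> ZP) : (\sum_j c j *: Y j) ^+ n =
    \sum_(f : {ffun 'I_n -> 'I_N}) (\prod_i c (f i)) *: \prod_i Y (f i).
  transitivity (\prod_(i < n) \sum_j c j *: Y j); first by rewrite prodr_const card_ord.
  by rewrite bigA_distr_bigA /=; apply: eq_bigr => f _; rewrite scaler_prod.
rewrite /linpow /linl /linr !e mulr_suml; apply: eq_bigr => f _.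
by rewrite mulr_sumr; apply: eq_bigr => g _; rewrite -scalerAr -scalerAl scalerA [in RHS]mulrC.
Qed.

(** Polarization. Expanding [linpow z a b] over words makes [La (linpow z a b)] the value at [z] of
    a polynomial [Q]. It vanishes everywhere, so [Q = 0]; each coefficient of [Q] is a number of
    words times [La] of one monomial, and that number is nonzero for monomials of bidegree
    [(b, a)]. *)
Lemma linpow_span a b (La : ZP -> R[i]) :
  (forall c P Q, La (c *: P + Q) = c * La P + La Q) ->
  (forall z, La (linpow z a b) = 0) -> forall P, bihom b a 0 P -> La P = 0.
Proof.
move=> lin La0.
have l0 : La 0 = 0.
  by have := lin 1 0 0; rewrite scaler0 addr0 mul1r => /eqP;
    rewrite -subr_eq0 opprD addrA subrr sub0r oppr_eq0 => /eqP.
have lsum (I : Type) (r : seq I) (F : I -> ZP) (c : I -> R[i]) :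
    La (\sum_(i <- r) c i *: F i) = \sum_(i <- r) c i * La (F i).
  by elim: r => [|i r IH]; rewrite ?big_nil// !big_cons lin IH.
have prodX n (h : 'I_n -> 'I_(N + N)) : \prod_i X (U (h i)) = X (\big[mpoly.mnm_add/mpoly.mnm0]_i U (h i)).
  by elim/big_rec2 : _ => [|i m y _ ->]; rewrite ?mpoly.mpolyX0 ?mpoly.mpolyXD.
pose W (f : {ffun 'I_a -> 'I_N}) (g : {ffun 'I_b -> 'I_N}) : ZP :=
  \prod_i X (U (Rr (f i))) * \prod_i X (U (L (g i))).
pose V (f : {ffun 'I_a -> 'I_N}) (g : {ffun 'I_b -> 'I_N}) : mnm :=
  mpoly.mnm_add (\big[mpoly.mnm_add/mpoly.mnm0]_i U (L (f i))) (\big[mpoly.mnm_add/mpoly.mnm0]_i U (Rr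
    (g i))).
pose Q : ZP := \sum_f \sum_g La (W f g) *: X (V f g).
have Q0 : Q = 0.
  apply: evalz_eq0 => z; rewrite -(La0 z) linpowE pair_big /= lsum /Q pair_big /= evalz_sum.
  apply: eq_bigr => -[f g] _ /=; rewrite evalzZ mulrC; congr (_ * _).
  rewrite /V mpoly.mpolyXD evalzM -!prodX /evalz !rmorph_prod /=; congr (_ * _); apply: eq_bigr => i _.
    exact: evalz_XL.
  exact: evalz_XR.
have WV f g : W f g = X (mpoly.mnm_add (\big[mpoly.mnm_add/mpoly.mnm0]_i U (Rr (f i)))
    (\big[mpoly.mnm_add/mpoly.mnm0]_i U (L (g i)))).
  by rewrite mpoly.mpolyXD -!prodX.
(* A coordinate [z_j] is the coefficient of the conjugate variable in [linl], so a monomial in [z]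
   is matched with the monomial in [xi] with the two groups of variables exchanged. *)
pose sw m : mnm := mpoly.Multinom [tuple m (match fintype.split i with inl j => Rr j | inr j =>
  L j end) | i < N + N].
have swL m j : sw m (L j) = m (Rr j).
  by rewrite /sw mpoly.multinomE tnth_mktuple -[L j]/(unsplit (inl j)) unsplitK.
have swR m j : sw m (Rr j) = m (L j).
  by rewrite /sw mpoly.multinomE tnth_mktuple -[Rr j]/(unsplit (inr j)) unsplitK.
have bigU n (h : 'I_n -> 'I_(N + N)) i :
    (\big[mpoly.mnm_add/mpoly.mnm0]_k U (h k)) i = (\sum_k (h k == i))%N.
  by rewrite (big_morph (fun m : mnm => m i) (fun m m' => mpoly.mnmDE i m m') (mpoly.mnm0E i));
    apply: eq_bigr => k _; rewrite mpoly.mnm1E.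
have Vsw f g m : (V f g == m) -> W f g = X (sw m).
  move=> /eqP <-; rewrite WV; congr (X _); apply: mnmP_lr => j;
    rewrite ?swL ?swR !mpoly.mnmDE !bigU; congr addn; apply: eq_bigr => k _;
    by rewrite ?eq_lrshift ?eq_rlshift ?(inj_eq (@lshift_inj _ _)) ?(inj_eq (@rshift_inj _ _)).
have count m : mcoeff m Q = (\sum_f \sum_g (V f g == m))%:R * La (X (sw m)).
  rewrite /Q raddf_sum natr_sum mulr_suml; apply: eq_bigr => f _ /=.
  rewrite raddf_sum natr_sum mulr_suml; apply: eq_bigr => g _ /=.
  rewrite mpoly.mcoeffZ mpoly.mcoeffX; case: eqP => [/eqP e|_]; last by rewrite mulr0 mul0r.
  by rewrite mulr1 mul1r (Vsw _ _ _ e).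
(* Every exponent vector of total degree [n] comes from some word of length [n], so the count above
   is positive. *)
have word n (k : 'I_N -> nat) : (\sum_j k j = n)%N ->
    exists f : {ffun 'I_n -> 'I_N}, forall j, (\sum_i (f i == j) = k j)%N.
  elim: n k => [|n IH] k kn.
    have f0 : 'I_0 -> 'I_N by case.
    exists [ffun i => f0 i] => j.
    rewrite big_ord0; have : (\sum_j k j == 0)%N by rewrite kn.
    by rewrite sum_nat_eq0 => /forallP/(_ j)/eqP ->.
  have [j kj] : exists j, k j != 0%N.
    apply/existsP; apply: contra_eqT kn; rewrite negb_exists => /forallP k0.
    by rewrite big1// => i _; apply/eqP; have := k0 i; rewrite negbK.
  have [|f fP] := IH (fun i => (k i - (j == i))%N).
    rewrite (bigD1 j)//= eqxx subn1; move: kn; rewrite (bigD1 j)//=.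
    rewrite -{1}(prednK (n := k j)) ?lt0n// addSn => -[<-]; congr addn.
    by apply: eq_bigr => i ij; rewrite eq_sym (negbTE ij) subn0.
  exists [ffun i => if unlift ord0 i is Some i' then f i' else j] => i.
  rewrite big_ord_recl ffunE unlift_none /=; under eq_bigr do rewrite ffunE liftK.
  rewrite fP subnKC//; case: eqP => // <-; by rewrite lt0n.
move=> P hP; rewrite (zpolyE P) lsum big_seq big1// => m /hP; rewrite !addn0 => -[lm rm].
have [g gP] := word _ _ lm; have [f fP] := word _ _ rm.
have cm := count (sw m); rewrite Q0 mpoly.mcoeff0 in cm.
have swK : sw (sw m) = m by apply: mnmP_lr => j; rewrite !(swL, swR).
rewrite swK in cm; move/esym/eqP: cm; rewrite mulf_eq0 => /orP[|/eqP ->]; last by rewrite mulr0.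
rewrite pnatr_eq0 sum_nat_eq0 => /forallP/(_ f); rewrite /= sum_nat_eq0 => /forallP/(_ g) /=.
rewrite eqb0 => /negP[]; apply/eqP/mnmP_lr => j; rewrite ?swL ?swR mpoly.mnmDE !bigU.
  rewrite (eq_bigr (fun k => (f k == j) : nat)) ?fP; last by move=> k _; rewrite (inj_eq (@lshift_inj _ _)).
  by rewrite big1 ?addn0// => k _; rewrite eq_rlshift.
rewrite addnC (eq_bigr (fun k => (g k == j) : nat)) ?gP; last by move=> k _;
  rewrite (inj_eq (@rshift_inj _ _)).
by rewrite big1 ?addn0// => k _; rewrite eq_lrshift.
Qed.

End Uniqueness.

(** * Moments determined by the kernel integrals *)

Section VolumeMoments.
Import -(notations) mpoly.
Variables (R : realType) (N : nat).
Local Notation ZP := (zpoly R N).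
Local Notation ballT := (@ballT R N).
Local Notation dVm := (dVm R N).
Local Notation L := (@lshift N N).
Local Notation Rr := (@rshift N N).
Implicit Types (P : ZP) (z : cvec R N).

Lemma multi_moment_gauss (m : mpoly.multinom (N + N)) :
  multi_moment R (fun j => m (L j)) (fun j => m (Rr j)) =
  gauss_mono R m * (N`!%:R / (ldeg m + N)`!%:R).
Proof. by rewrite /multi_moment /gauss_mono; case: ifP => _; rewrite ?mul0r. Qed.

Lemma cintegrable_evalz P : cintegrable dVm ballT (fun x => evalz P (toC x)).
Proof.
have mB := @measurable_ballT R N.
have := @cintegrable_sum _ _ _ dVm ballT _ (mpoly.msupp P) xpredT (fun m x =>
  mpoly.mcoeff m P * mono (fun j => m (L j)) (fun j => m (Rr j)) (toC x)) mB.
have -> : (fun x : N.-tuple (R * R) => evalz P (toC x)) = (fun x =>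
  \sum_(m <- mpoly.msupp P) mpoly.mcoeff m P * mono (fun j => m (L j)) (fun j => m (Rr j)) (toC x)).
  by apply/funext => x; rewrite evalzE.
by apply=> m _; apply: cintegrableZ => //; case: (dVm_mono R (fun j => m (L j)) (fun j => m (Rr j))).
Qed.

Lemma dVm_gauss n P : (forall m, m \in mpoly.msupp P -> ldeg m = n) ->
  cint dVm ballT (fun x => evalz P (toC x)) = gauss P * (N`!%:R / (n + N)`!%:R).
Proof.
have mB := @measurable_ballT R N => hP.
under eq_cint do rewrite evalzE.
have im m : cintegrable dVm ballT (fun x => mono (fun j => m (L j)) (fun j => m (Rr j)) (toC x)).
  by case: (dVm_mono R (fun j => m (L j)) (fun j => m (Rr j))).
rewrite cint_sum//; last by move=> m _; exact: cintegrableZ.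
rewrite /gauss mulr_suml !big_seq; apply: eq_bigr => m mP.
rewrite cintZ//; case: (dVm_mono R (fun j => m (L j)) (fun j => m (Rr j))) => _ ->.
by rewrite multi_moment_gauss hP// mulrA.
Qed.

Lemma toC_meas (j : 'I_N) : cmeas ballT (fun x => toC x j).
Proof. apply: cmeas_subset (@cmeas_toC R N j) => //; exact: measurableT. Qed.

Lemma dVm_cst1 : cintegrable dVm ballT (fun=> 1).
Proof. by apply: (@cintegrable_bounded_ball _ _ _ 1) => [|x _]; [exact: cmeas_cst|rewrite cabs1]. Qed.

(** That is, the Berezin transform of 1 is 1. Only the diagonal moments are nonzero, and
    [C(N+a,N) a! N! = (N+a)!] cancels one of the two binomials of the expansion. *)
Lemma dVm_kernel z : normsq z < 1 ->
  cint dVm ballT (fun x => 1 * ((absC2 (1 - inner z (toC x)))^-1 ^+ N.+1)%:C) =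
  evalz 1 z * ((1 - normsq z)^-1 ^+ N.+1)%:C.
Proof.
move=> z1; have mB := @measurable_ballT R N.
have z0 := normsq_ge0 z.
apply: (ccvg_unique (kernel_expansion mB toC_meas (fun x h => h) dVm_cst1 z1)).
have E n : \sum_(a < n) \sum_(b < n) 'C(N + a, N)%:R * 'C(N + b, N)%:R *
     moment dVm ballT (@toC R N) (fun=> 1) a b z = nbsum N n (normsq z)%:C.
  have mo a b : moment dVm ballT (@toC R N) (fun=> 1) a b z =
      if a == b then a`!%:R * (normsq z)%:C ^+ a * (N`!%:R / (a + N)`!%:R) else 0.
    rewrite /moment; under eq_cint do rewrite mul1r -evalz_linpow.
    rewrite (@dVm_gauss b); last by move=> m /bihom_linpow[]; rewrite addn0.
    by rewrite gauss_linpow; case: eqP => [->|_]; rewrite ?mul0r.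
  rewrite /nbsum; apply: eq_bigr => a _; rewrite (bigD1 a)//= big1 ?addr0; last first.
    by move=> b ba; rewrite mo ifF ?mulr0//; apply: contraNF ba => /eqP e; apply/eqP/val_inj.
  rewrite mo eqxx; have h : 'C(N + a, N)%:R * (a`!%:R * N`!%:R) = (a + N)`!%:R :> R[i].
    rewrite -!natrM; congr (_%:R); rewrite [(a + N)%N]addnC -(@bin_fact (N + a) N) ?leq_addr//.
    by rewrite addKn [(a`! * _)%N]mulnC.
  have f0 : (a + N)`!%:R != 0 :> R[i] by rewrite pnatr_eq0 -lt0n fact_gt0.
  transitivity ('C(N + a, N)%:R * (normsq z)%:C ^+ a * ('C(N + a,
    N)%:R * (a`!%:R * N`!%:R) / (a + N)`!%:R) : R[i]).
    move: ((a + N)`!%:R)^-1 ('C(N + a, N)%:R : R[i]) (a`!%:R : R[i]) (N`!%:R : R[i]) => p q r t; ring.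
  by rewrite h divff// mulr1.
rewrite (funext E) evalz1 mul1r rmorphXn fmorphV rmorphB /= rmorph1.
by apply: nbsum_ccvg; rewrite cabs_real ger0_norm.
Qed.

End VolumeMoments.

Section GenericMoments.
Import -(notations) mpoly.
Context d (T : measurableType d) (R : realType) (mu : {measure set T -> \bar R}).
Variables (D : set T) (mD : measurable D) (N : nat) (phi : T -> cvec R N).
Hypothesis mphi : forall j, cmeas D (fun x => phi x j).
Hypothesis phiD : forall x, D x -> normsq (phi x) < 1.
Variable k : T -> R[i].
Hypothesis ik : cintegrable mu D k.
Hypothesis kK : forall z, normsq z < 1 ->
  cint mu D (fun x => k x * ((absC2 (1 - inner z (phi x)))^-1 ^+ N.+1)%:C) =
  evalz 1 z * ((1 - normsq z)^-1 ^+ N.+1)%:C.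
Implicit Types (P : zpoly R N) (z : cvec R N).
Local Notation L := (@lshift N N).
Local Notation Rr := (@rshift N N).

Lemma cmeas_evalz P : cmeas D (fun x => evalz P (phi x)).
Proof.
under eq_fun do rewrite evalzE.
apply: cmeas_sum => m _; apply: cmeasM; first exact: cmeas_cst.
by apply: cmeas_prod => j _; apply: cmeasM; apply: cmeasX => //; exact: cmeas_conj.
Qed.

Lemma evalz_bounded P : exists M, forall z, normsq z < 1 -> cabs (evalz P z) <= M.
Proof.
exists (\sum_(m <- mpoly.msupp P) cabs (mpoly.mcoeff m P) * \prod_(j < N) (1 + 1) ^+ (m (L j) + m (Rr j))).
move=> z z1; rewrite evalzE; apply: le_trans (cabs_sum _ _ _) _; apply: ler_sum => m _.
by rewrite cabsM ler_wpM2l ?cabs_ge0//; exact: cabs_mono_le.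
Qed.

Lemma cintegrable_kevalz P : cintegrable mu D (fun x => k x * evalz P (phi x)).
Proof.
have [M hM] := evalz_bounded P.
apply: (@cintegrable_bounded _ _ _ _ _ _ _ M) => //; first exact: cmeas_evalz.
by move=> x Dx; apply/hM/phiD.
Qed.

(** The kernel integrals fix all polynomial moments: [moment_coefficients] gives equal pairings with
    [linpow z a b] for [|z| <= 1], homogeneity extends this to all [z], and [linpow_span] to all
    monomials. *)
Lemma generic_moment P : cint mu D (fun x => k x * evalz P (phi x)) =
  cint (dVm R N) (ballT N) (fun x => evalz P (toC x)).
Proof.
have mB := @measurable_ballT R N.
pose La P : R[i] := cint mu D (fun x => k x * evalz P (phi x)) -
  cint (dVm R N) (ballT N) (fun x => evalz P (toC x)).
have lin c P1 P2 : La (c *: P1 + P2) = c * La P1 + La P2.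
  rewrite /La; have -> : cint mu D (fun x => k x * evalz (c *: P1 + P2) (phi x)) =
     c * cint mu D (fun x => k x * evalz P1 (phi x)) + cint mu D (fun x => k x * evalz P2 (phi x)).
    rewrite -cintZ// -?cintD//; try by [exact: cintegrable_kevalz|apply: cintegrableZ => //;
      exact: cintegrable_kevalz].
    by apply: eq_cint => x _; rewrite evalzD evalzZ; ring.
  have -> : cint (dVm R N) (ballT N) (fun x => evalz (c *: P1 + P2) (toC x)) =
     c * cint (dVm R N) (ballT N) (fun x => evalz P1 (toC x)) + cint (dVm R N) (ballT N) (fun x =>
       evalz P2 (toC x)).
    rewrite -cintZ// -?cintD//; try by [exact: cintegrable_evalz|apply: cintegrableZ => //;
      exact: cintegrable_evalz].
    by apply: eq_cint => x _; rewrite evalzD evalzZ.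
  ring.
have La1 z a b : normsq z <= 1 -> La (linpow z a b) = 0.
  move=> z1; have := moment_coefficients mD mphi phiD ik kK a b z1.
  rewrite -(moment_coefficients mB (@toC_meas R N) (fun x h => h) (dVm_cst1 R N) (@dVm_kernel R N) a b z1).
  have nz : 'C(N + a, N)%:R * 'C(N + b, N)%:R != 0 :> R[i].
    by rewrite mulf_neq0// pnatr_eq0 -lt0n bin_gt0 leq_addr.
  move/(mulfI nz) => h; apply/eqP; rewrite subr_eq0; apply/eqP.
  transitivity (moment mu D phi k a b z).
    by apply: eq_cint => x _; rewrite evalz_linpow.
  by rewrite h; apply: eq_cint => x _; rewrite evalz_linpow mul1r.
have La0 z a b : La (linpow z a b) = 0.
  (* Dividing [z] by [t] brings it into the closed unit ball, since [|z|^2 <= (1 + |z|^2)^2]. *)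
  pose t := 1 + normsq z; have z0 := normsq_ge0 z.
  have t0 : 0 < t by rewrite /t; lra.
  have tC : (t^-1)%:C != 0 :> R[i] by rewrite (inj_eq (@complexI R)) invr_eq0 gt_eqF.
  have zt : normsq (fun j => (t^-1)%:C * z j) <= 1.
    rewrite normsq_scale absC2_real exprVn mulrC ler_pdivrMr ?exprn_gt0// mul1r /t; nra.
  have E : linpow (fun j => (t^-1)%:C * z j) a b = ((t^-1)%:C ^+ (a + b)) *: linpow z a b.
    rewrite /linpow; have -> : linl (fun j => (t^-1)%:C * z j) = (t^-1)%:C *: linl z.
      by rewrite scaler_sumr; apply: eq_bigr => j _; rewrite scalerA.
    have -> : linr (fun j => (t^-1)%:C * z j) = (t^-1)%:C *: linr z.
      by rewrite scaler_sumr; apply: eq_bigr => j _; rewrite conjM conjc_real scalerA.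
    by rewrite !exprZn -scalerAl -scalerAr scalerA exprD.
  have l0 : La 0 = 0.
    have := lin 1 0 0; rewrite scaler0 addr0 mul1r => /eqP.
    by rewrite -subr_eq0 opprD addrA subrr sub0r oppr_eq0 => /eqP.
  have := La1 _ a b zt; rewrite E -[_ *: _]addr0 lin l0 addr0 => /eqP.
  by rewrite mulf_eq0 expf_eq0 (negbTE tC) andbF /= => /eqP.
have LaX m : La (mpoly.mpolyX _ m) = 0.
  apply: (linpow_span lin _ (@bihom_X R N m)) => z; exact: La0.
have La00 : forall P, La P = 0.
  move=> {}P; rewrite (zpolyE P).
  elim: (mpoly.msupp P) => [|m s IH]; last by rewrite big_cons lin LaX IH mulr0 addr0.
  rewrite big_nil; have := lin 1 0 0; rewrite scaler0 addr0 mul1r => /eqP.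
  by rewrite -subr_eq0 opprD addrA subrr sub0r oppr_eq0 => /eqP.
by have /eqP := La00 P; rewrite subr_eq0 => /eqP.
Qed.

End GenericMoments.

(** * Indicators of balls as limits of polynomials *)

Section IndicatorApprox.
Variables (R : realType) (r : R).
Hypothesis r01 : 0 < r <= 1.

(* [(1 - t^n)^(indexp n)] is about [exp (- n (t / r)^n)]. *)
Definition indexp n : nat := (Num.truncn (n%:R / r ^+ n)).+1.

Lemma bernoulli_ineq (x : R) n : -1 <= x -> 1 + n%:R * x <= (1 + x) ^+ n.
Proof.
move=> x1; elim: n => [|n IH]; first by rewrite mul0r addr0 expr0.
rewrite exprSr -natr1; have h : 0 <= n%:R * x ^+ 2 by rewrite mulr_ge0 ?sqr_ge0.
apply: (@le_trans _ _ ((1 + n%:R * x) * (1 + x))); last by rewrite ler_wpM2r//; lra.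
by rewrite -subr_ge0 (_ : _ - _ = n%:R * x ^+ 2)//; ring.
Qed.

(** Let [m = indexp n], so [n / r^n <= m <= n / r^n + 1]. For [t < r], Bernoulli gives the lower
    bound [1 - (n+1) (t/r)^n]. For [t >= r], [(1-t^n)^m (1+t^n)^m <= 1] and
    [(1+t^n)^m >= 1 + m t^n >= n+1] give the upper bound [1/(n+1)]. *)
Lemma indicator_cvg (t : R) : 0 <= t <= 1 ->
  (1 - t ^+ n) ^+ indexp n @[n --> \oo] --> ((t < r)%R%:R : R).
Proof.
move=> /andP[t0 t1]; have /andP[r0 r1] := r01.
have tn n : 0 <= t ^+ n <= 1 by rewrite exprn_ge0//= exprn_ile1.
have c1 n : n%:R / r ^+ n <= (indexp n)%:R.
  by rewrite ltW//; exact: truncnS_gt.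
have c2 n : (indexp n)%:R <= n%:R / r ^+ n + 1.
  rewrite /indexp -natr1 lerD2r truncn_le divr_ge0 ?exprn_ge0//; exact: ltW.
have [tr|rt] := ltP t r.
  have q1 : 0 <= t / r < 1.
    by apply/andP; split; [apply: divr_ge0 => //; exact: ltW|rewrite ltr_pdivrMr// mul1r].
  rewrite -[X in _ --> X]subr0; apply: (@squeeze_cvgr _ _ _ _
      (fun n => 1 - 'C(1 + n, 1)%:R * (t / r) ^+ n) (cst 1)).
  - apply: nearW => n; have /andP[a0 a1] := tn n; apply/andP; split; last first.
      by rewrite exprn_ile1 ?subr_ge0// gerBl.
    have h := @bernoulli_ineq (- t ^+ n) (indexp n); apply: le_trans (h _); last by lra.
    rewrite mulrN lerD2l lerN2 bin1 add1n -natr1.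
    apply: (@le_trans _ _ ((n%:R / r ^+ n + 1) * t ^+ n)); first by rewrite ler_wpM2r.
    rewrite !mulrDl !mul1r expr_div_n mulrA mulrAC lerD2l.
    by rewrite ler_pdivlMr ?exprn_gt0// ler_piMr// exprn_ile1// ltW.
  - by apply: cvgB; [exact: cvg_cst|exact: nbterm_cvg0].
  - by rewrite subr0; exact: cvg_cst.
apply: (@squeeze_cvgr _ _ _ _ (cst 0) (@harmonic R)); [|exact: cvg_cst|exact: cvg_harmonic].
apply: nearW => n; have /andP[a0 a1] := tn n.
rewrite exprn_ge0 ?subr_ge0//= -[leRHS]mul1r ler_pdivlMr//.
apply: (@le_trans _ _ ((1 - t ^+ n) ^+ indexp n * (1 + t ^+ n) ^+ indexp n)).
  rewrite ler_wpM2l ?exprn_ge0 ?subr_ge0//; apply: le_trans (bernoulli_ineq _ _); last by lra.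
  rewrite -natr1 addrC lerD2l; apply: (@le_trans _ _ (n%:R / r ^+ n * t ^+ n)); last by rewrite ler_wpM2r.
  by rewrite mulrAC ler_pdivlMr ?exprn_gt0// ler_wpM2l//; apply: lerXn2r; rewrite ?nnegrE// ltW.
rewrite -exprMn exprn_ile1//; nra.
Qed.

End IndicatorApprox.

Lemma cmeas_ltr d (T : measurableType d) (R : realType) (D : set T) (f g : T -> R) :
  measurable_fun D f -> measurable_fun D g ->
  cmeas D (fun x => (((f x < g x)%R%:R : R)%:C : R[i])).
Proof.
move=> mf mg; apply: cmeas_real => mD.
have -> : (fun x => (f x < g x)%R%:R : R) = (fun x => if f x < g x then 1 else 0).
  by apply/funext => x; case: (_ < _).
by apply: measurable_fun_if => //; exact: measurable_fun_ltr.
Qed.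

Section BallIndicator.
Import -(notations) mpoly.
Variables (R : realType) (N : nat).
Local Notation ZP := (zpoly R N).
Local Notation X m := (@mpoly.mpolyX (N + N) R[i] m).
Local Notation U i := (@mpoly.mnm1 (N + N) i).
Local Notation L := (@lshift N N).
Local Notation Rr := (@rshift N N).
Implicit Types (P : ZP) (z : cvec R N).

Definition sqnorm_poly : ZP := \sum_j X (U (L j)) * X (U (Rr j)).

Lemma evalz_sqnorm z : evalz sqnorm_poly z = (normsq z)%:C.
Proof.
rewrite evalz_sum /normsq rmorph_sum; apply: eq_bigr => j _.
by rewrite evalzM evalz_XL evalz_XR -absC2E.
Qed.

Definition indb (r : R) z : R[i] := ((normsq z < r)%R%:R : R)%:C.

Lemma cabs_indb_le r z : cabs (indb r z) <= 1.
Proof. by rewrite /indb cabs_real; case: (_ < _); rewrite ?normr1 ?normr0. Qed.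

Section Approx.
Context d (T : measurableType d) (mu : {measure set T -> \bar R}).
Variables (D : set T) (mD : measurable D) (phi : T -> cvec R N).
Hypothesis mphi : forall j, cmeas D (fun x => phi x j).
Hypothesis phiD : forall x, D x -> normsq (phi x) < 1.
Variable k : T -> R[i].
Hypothesis ik : cintegrable mu D k.
Variable r : R.
Hypothesis r01 : 0 < r <= 1.

Lemma measurable_normsq_phi : measurable_fun D (fun x => normsq (phi x)).
Proof. by apply: measurable_sum => j; exact: measurable_absC2. Qed.

Lemma cmeas_indb : cmeas D (fun x => indb r (phi x)).
Proof.
by apply: cmeas_ltr => //; exact: measurable_normsq_phi.
Qed.

Lemma indicator_approx P :
  ccvg (fun n => cint mu D (fun x => k x * evalz (P * (1 - sqnorm_poly ^+ n) ^+ indexp r n) (phi x)))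
    (cint mu D (fun x => k x * (evalz P (phi x) * indb r (phi x)))).
Proof.
have [M hM] := evalz_bounded P.
have evE n x : evalz (P * (1 - sqnorm_poly ^+ n) ^+ indexp r n) (phi x) =
    evalz P (phi x) * ((1 - normsq (phi x) ^+ n) ^+ indexp r n)%:C.
  rewrite evalzM evalzX -[1 - _]addrC -scaleN1r evalzD evalzZ evalz1 evalzX evalz_sqnorm.
  by rewrite mulN1r addrC rmorphXn rmorphB /= rmorphXn rmorph1.
have [||||||//_ +] := @cint_dominated _ _ _ mu D
  (fun n x => k x * evalz (P * (1 - sqnorm_poly ^+ n) ^+ indexp r n) (phi x))
  (fun x => k x * (evalz P (phi x) * indb r (phi x))) (fun x => M * cabs (k x)) => //.
- by move=> n; exact/cintegrable_cmeas/(cintegrable_kevalz mD mphi phiD ik).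
- apply: cmeasM; first exact: cintegrable_cmeas ik.
  by apply: cmeasM; [exact: cmeas_evalz|exact: cmeas_indb].
- apply: aeW => x Dx; apply: ccvgM; first exact: ccvg_cst.
  under [F in ccvg F _]eq_fun do rewrite evE; apply: ccvgM; first exact: ccvg_cst.
  split => /=; last exact: cvg_cst.
  by apply: indicator_cvg => //; rewrite normsq_ge0/= ltW// phiD.
- under eq_fun do rewrite EFinM; apply: integrableZl => //; exact: integrable_cabs.
- move=> n x Dx; rewrite evE !cabsM mulrC ler_wpM2r ?cabs_ge0//.
  have h0 := normsq_ge0 (phi x); have h1 := phiD Dx.
  have /andP[a0 a1] : 0 <= normsq (phi x) ^+ n <= 1 by rewrite exprn_ge0//= exprn_ile1// ltW.
  rewrite -[leRHS]mulr1 ler_pM ?cabs_ge0// ?hM//.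
  by rewrite cabs_real ger0_norm ?exprn_ge0 ?exprn_ile1 ?subr_ge0// gerBl.
Qed.

Lemma cintegrable_kindb P : cintegrable mu D (fun x => k x * (evalz P (phi x) * indb r (phi x))).
Proof.
have [M hM] := evalz_bounded P.
apply: (@cintegrable_bounded _ _ _ _ _ _ _ M) => //.
  by apply: cmeasM; [exact: cmeas_evalz|exact: cmeas_indb].
move=> x Dx; rewrite cabsM -[leRHS]mulr1; apply: ler_pM; rewrite ?cabs_ge0//; first exact/hM/phiD.
exact: cabs_indb_le.
Qed.

End Approx.

Lemma dVm_ball_mono (a b : 'I_N -> nat) r : 0 < r <= 1 ->
  cint (dVm R N) (ballT N) (fun x => mono a b (toC x) * indb r (toC x)) =
  multi_moment R a b * (r ^+ (\sum_j a j + N))%:C.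
Proof.
move=> /andP[r0 r1]; have mB := @measurable_ballT R N.
have e s : 0 < s <= 1 -> cint (lebCnm R N) (@ballT R N) (fun x => mono a b (toC x) * indb s (toC x)) =
   cint (lebCnm R N) (ballr s) (fun x => mono a b (toC x)).
  move=> /andP[s0 s1]; rewrite cint_mkcond [RHS]cint_mkcond; apply: eq_cint => x _.
  rewrite /indb; case: ltP => h; last first.
    by rewrite mulr0; case: ifP => _; case: ifPn => //; rewrite inE /ballr /= ltNge h.
  rewrite mulr1; have -> : x \in ballr s by rewrite inE.
  by have -> : x \in @ballT R N by rewrite inE /ballT/ball_N /= (lt_le_trans h).
have ii s : cintegrable (lebCnm R N) (@ballT R N) (fun x => mono a b (toC x) * indb s (toC x)).
  apply: (@cintegrable_bounded _ _ _ _ _ _ _ 1 mB (integrable_mono a b 1)) => [|x _].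
    apply: cmeas_indb => j; exact: toC_meas.
  exact: cabs_indb_le.
(* The normalizing constant is kept abstract: comparison with [dVm_mono], the case of the whole
   ball, eliminates it. *)
have [c cE] : exists c : R[i], forall f, cintegrable (lebCnm R N) (@ballT R N) f ->
    cint (dVm R N) (@ballT R N) f = c * cint (lebCnm R N) (@ballT R N) f.
  by eexists => f fi; exact: (proj2 (cint_mscale _ mB fi)).
rewrite cE// e ?r0// cint_mono//.
have [_ <-] := dVm_mono R a b; rewrite cE; last exact: integrable_mono.
rewrite (cint_mono a b ltr01) expr1n mulr1 -[RHS]mulrA; congr (_ * _).
by rewrite -(rmorphM (real_complex R)) /= mulrAC.
Qed.

Lemma dVm_ball_gauss n P r : 0 < r <= 1 -> (forall m, m \in mpoly.msupp P -> ldeg m = n) ->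
  cint (dVm R N) (ballT N) (fun x => evalz P (toC x) * indb r (toC x)) =
  gauss P * (N`!%:R / (n + N)`!%:R) * (r ^+ (n + N))%:C.
Proof.
have mB := @measurable_ballT R N => r01 hP.
under eq_cint do rewrite evalzE mulr_suml.
have im m c : cintegrable (dVm R N) (ballT N)
    (fun x => c * mono (fun j => m (L j)) (fun j => m (Rr j)) (toC x) * indb r (toC x)).
  apply: (@cintegrable_bounded _ _ _ _ _ _ _ 1 mB) => [||x _].
  - by apply: cintegrableZ => //; case: (dVm_mono R (fun j => m (L j)) (fun j => m (Rr j))).
  - by apply: cmeas_indb => j; exact: toC_meas.
  - exact: cabs_indb_le.
rewrite cint_sum//.
rewrite /gauss !mulr_suml !big_seq; apply: eq_bigr => m mP.
under eq_cint do rewrite -mulrA.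
rewrite cintZ//; last by have := im m 1; under eq_fun do rewrite mul1r.
by rewrite dVm_ball_mono// multi_moment_gauss -/(ldeg m) hP// !mulrA.
Qed.

Section Generic.
Context d (T : measurableType d) (mu : {measure set T -> \bar R}).
Variables (D : set T) (mD : measurable D) (phi : T -> cvec R N).
Hypothesis mphi : forall j, cmeas D (fun x => phi x j).
Hypothesis phiD : forall x, D x -> normsq (phi x) < 1.
Variable k : T -> R[i].
Hypothesis ik : cintegrable mu D k.
Hypothesis kK : forall z, normsq z < 1 ->
  cint mu D (fun x => k x * ((absC2 (1 - inner z (phi x)))^-1 ^+ N.+1)%:C) =
  evalz 1 z * ((1 - normsq z)^-1 ^+ N.+1)%:C.

(** The integrals for the model and for the volume are limits of the same sequence of polynomial
    moments. *)
Lemma generic_ball_gauss n P r : 0 < r <= 1 -> (forall m, m \in mpoly.msupp P -> ldeg m = n) ->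
  cint mu D (fun x => k x * (evalz P (phi x) * indb r (phi x))) =
  gauss P * (N`!%:R / (n + N)`!%:R) * (r ^+ (n + N))%:C.
Proof.
move=> r01 hP; rewrite -dVm_ball_gauss//.
have mB := @measurable_ballT R N.
apply: (ccvg_unique (indicator_approx mD mphi phiD ik r01 P)).
have := indicator_approx mB (@toC_meas R N) (fun x h => h) (dVm_cst1 R N) r01 P.
under [Y in ccvg Y _ -> _]eq_fun do under eq_cint do rewrite mul1r.
under [Y in _ -> ccvg Y _]eq_fun do rewrite (generic_moment mD mphi phiD ik kK).
by under eq_cint do rewrite mul1r.
Qed.

End Generic.

End BallIndicator.

(** * Sufficiency *)

Section PartialFractions.
Variable F : numFieldType.
Implicit Types (g h : {poly F}) (x : F).

Lemma prod_XaddC n (c : nat -> F) :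
  \prod_(j < n) ('X + (c j)%:P) \is monic /\ size (\prod_(j < n) ('X + (c j)%:P)) = n.+1.
Proof.
have -> : \prod_(j < n) ('X + (c j)%:P) = \prod_(i <- [seq - c (nat_of_ord l) | l <- index_enum 'I_n])
  ('X - i%:P : {poly F}).
  by rewrite big_map; apply: eq_bigr => l _; rewrite polyCN opprK.
rewrite monic_prod_XsubC size_prod_XsubC size_map.
by rewrite -[index_enum _]/(Finite.enum _) -enumT size_enum_ord.
Qed.

(** Induction on the number of poles: subtracting the residue term at [-(q+1)] leaves a numerator
    divisible by the last factor. *)
Lemma partial_fractions g q : (size g <= q)%N -> exists A : nat -> F, forall x,
  (forall l, (l < q)%N -> x + l.+1%:R != 0) ->
  g.[x] / \prod_(l < q) (x + l.+1%:R) = \sum_(l < q) A l / (x + l.+1%:R).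
Proof.
elim: q g => [|q IH] g gq.
  exists (fun=> 0) => x _; rewrite !big_ord0.
  by move: gq; rewrite leqn0 size_poly_eq0 => /eqP ->; rewrite horner0 mul0r.
pose D : {poly F} := \prod_(l < q) ('X + l.+1%:R%:P).
have hD x : D.[x] = \prod_(l < q) (x + l.+1%:R).
  by rewrite horner_prod; apply: eq_bigr => l _; rewrite !hornerE.
have sD : size D = q.+1.
  by case: (prod_XaddC q (fun l => l.+1%:R)).
pose c : F := - q.+1%:R.
have Dc : D.[c] != 0.
  rewrite hD; apply/prodf_neq0 => l _; rewrite /c addrC subr_eq0 eqr_nat eqSS.
  by rewrite neq_ltn ltn_ord.
pose a := g.[c] / D.[c].
have : root (g - a *: D) c.
  by rewrite /root !hornerE /a divfK// subrr.
move=> /factor_theorem[h hE].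
have sh : (size h <= q)%N.
  have [->|h0] := eqVneq h 0; first by rewrite size_poly0.
  have : (size (g - a *: D)%R <= q.+1)%N.
    rewrite (leq_trans (size_polyD _ _))// geq_max gq size_polyN.
    by rewrite (leq_trans (size_scale_leq _ _))// sD.
  by rewrite hE size_Mmonic ?monicXsubC// size_XsubC addn2.
have [A hA] := IH h sh.
exists (fun l => if l == q then a else A l) => x hx.
have hx' l : (l < q)%N -> x + l.+1%:R != 0 by move=> lq; apply: hx; rewrite ltnW.
have Dx : D.[x] != 0 by rewrite hD; apply/prodf_neq0 => l _; exact: hx'.
rewrite !big_ord_recr /= eqxx -hD.
rewrite [X in _ = X + _](eq_bigr (fun l : 'I_q => A l / (x + l.+1%:R))) => [|l _]; last first.
  by rewrite (ltn_eqF (ltn_ord l)).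
rewrite -hA// -hD; have -> : g = h * ('X - c%:P) + a *: D by rewrite -hE subrK.
rewrite !hornerE /c opprK; have := hx q (ltnSn q); move: (D.[x]) Dx (x + q.+1%:R) => y y0 t t0.
by field; rewrite t0 y0.
Qed.

(** The quotient is a monic polynomial of degree [q - i] in [k] over the monic product of the
    [k + l + 1], [l < q]; hence the constant part 1 for [i = 0] only. For [p = 0] it is identically
    1, and recording [A = 0] is what frees this case from a degree bound. *)
Lemma fact_partial_fractions p q i : (i <= p)%N -> (i <= q)%N -> exists A : nat -> F,
  (p = 0%N -> forall l, A l = 0) /\
  forall k : nat, ((k + (p + q - i))`! * k`!)%:R / ((k + p)`! * (k + q)`!)%:R =
    (i == 0%N)%:R + \sum_(l < q) A l / (k + l.+1)%:R.
Proof.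
move=> ip iq; have fne n : n`!%:R != 0 :> F by rewrite pnatr_eq0 -lt0n fact_gt0.
have [p0|p0] := posnP p.
  exists (fun=> 0); split => // k; move: ip; rewrite p0 leqn0 => /eqP ->.
  rewrite add0n subn0 addn0 mulnC divff ?natrM ?mulf_neq0//.
  by rewrite big1 ?addr0// => l _; rewrite mul0r.
pose N1 : {poly F} := \prod_(j < q - i) ('X + (p + j.+1)%:R%:P).
pose D : {poly F} := \prod_(l < q) ('X + l.+1%:R%:P).
have [m1 s1] := prod_XaddC (q - i) (fun j => (p + j.+1)%:R).
have [m2 s2] := prod_XaddC q (fun l => l.+1%:R).
have hN (k : nat) : N1.[k%:R] * (k + p)`!%:R = (k + (p + q - i))`!%:R.
  rewrite /N1 horner_prod -addnBA// addnA.
  elim: (q - i)%N => [|n IH]; first by rewrite big_ord0 mul1r addn0.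
  rewrite big_ord_recr /= mulrAC IH [in RHS]addnS factS natrM mulrC !hornerE -natrD.
  by rewrite !addnA addnS.
have hD (k : nat) : D.[k%:R] * k`!%:R = (k + q)`!%:R.
  rewrite /D horner_prod; elim: (q) => [|n IH]; first by rewrite big_ord0 mul1r addn0.
  by rewrite big_ord_recr /= mulrAC IH [in RHS]addnS factS natrM mulrC !hornerE -natrD addnS.
have [|A hA] := @partial_fractions (N1 - (i == 0%N)%:R *: D) q.
  have [i0|i0] := eqVneq i 0%N; last first.
    by rewrite scale0r subr0 s1 -subSn// leq_subLR -add1n leq_add2r lt0n.
  rewrite scale1r -ltnS.
  have [->|nz] := eqVneq (N1 - D) 0; first by rewrite size_poly0.
  rewrite ltn_neqAle (leq_trans (size_polyD _ _)) ?geq_max ?size_polyN ?s1 ?s2 ?i0 ?subn0 ?leqnn// andbT.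
  apply: contra nz => /eqP sE; rewrite -lead_coef_eq0 lead_coefE sE /= coefB.
  have qi : (q - i = q)%N by rewrite i0 subn0.
  have e1 : N1`_q = 1 by rewrite -[RHS](monicP m1) lead_coefE s1 -/N1 qi.
  have e2 : D`_q = 1 by rewrite -[RHS](monicP m2) lead_coefE s2.
  by rewrite e1 e2 subrr.
exists A; split; first by move=> p0'; move: p0; rewrite p0'.
move=> k; have xne l : (l < q)%N -> (k%:R : F) + l.+1%:R != 0 by move=> _; rewrite -natrD pnatr_eq0 addnS.
have := hA k%:R xne.
under [in X in _ = X]eq_bigr do rewrite -natrD.
move=> <-; have Dx : D.[k%:R] != 0.
  by apply: contraNneq (fne (k + q)%N) => D0; rewrite -hD D0 mul0r.
have -> : \prod_(l < q) (k%:R + l.+1%:R) = D.[k%:R].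
  by rewrite horner_prod; apply: eq_bigr => l _; rewrite !hornerE.
rewrite !natrM -hN -hD hornerD hornerN hornerZ; have := fne k; have := fne (k + p)%N.
move: N1.[k%:R] D.[k%:R] Dx (k`!%:R : F) ((k + p)`!%:R : F) (i == 0%N)%:R => a b b0 c e dl c0 e0.
by field; rewrite b0 c0 e0.
Qed.

End PartialFractions.

Section Tonelli.
Context d1 d2 (T1 : measurableType d1) (T2 : measurableType d2) (R : realType).
Variables (m1 : {sigma_finite_measure set T1 -> \bar R}).
Variables (m2 : {sigma_finite_measure set T2 -> \bar R}).

Lemma cintegrable_tonelli (D : set T1) (I : set T2) (F : T1 * T2 -> R[i]) (C : R) :
  measurable D -> measurable I -> (m2 I < +oo)%E -> cmeas (D `*` I) F ->
  (forall y, I y -> (\int[m1]_(x in D) (cabs (F (x, y)))%:E <= C%:E)%E) ->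
  cintegrable (m1 \x m2)%E (D `*` I) F.
Proof.
move=> mD mI Ifin mF FC; have mDI : measurable (D `*` I) by exact: measurableX.
pose G := (fun z => (cabs (F z))%:E) \_ (D `*` I).
have mG : measurable_fun setT G.
  by apply/(measurable_restrictT _ mDI)/measurable_EFinP/measurable_cabs.
have G0 z : (0 <= G z)%E by rewrite /G patchE; case: ifP => // _; rewrite lee_fin cabs_ge0.
have iG : (m1 \x m2)%E.-integrable (D `*` I) (fun z => (cabs (F z))%:E).
  apply/(integrable_mkcond _ mDI); apply: (@integrable21ltyP _ _ _ _ _ m1 m2 _ mG).2.
  apply: (@le_lt_trans _ _ (\int[m2]_(y in I) (Num.max C 0)%:E)%E); last first.
    rewrite integral_cst// lte_mul_pinfty// ?lee_fin ?le_max ?lexx ?orbT//.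
  rewrite [leRHS]integral_mkcond; apply: ge0_le_integral => //.
  - by move=> y _; apply: integral_ge0.
  - apply: (@measurable_fun_fubini_tonelli_G _ _ _ _ _ m1 (fun z => `|G z|%E)) => //.
    exact: measurableT_comp.
  - by apply/(measurable_restrictT _ mI); exact: measurable_cst.
  - move=> y _; rewrite patchE; case: ifPn => [|yI].
      rewrite inE => Iy; apply: (@le_trans _ _ C%:E); last by rewrite lee_fin le_max lexx.
      apply: le_trans (FC y Iy); rewrite [leRHS]integral_mkcond.
      rewrite le_eqVlt; apply/orP; left; apply/eqP; apply: eq_integral => x _.
      rewrite gee0_abs// /G !patchE; congr (if _ then _ else _).
      by apply/idP/idP; rewrite !inE => //= -[].
    rewrite integral0_eq// => x _; rewrite /G patchE ifF ?abse0//; apply/negbTE.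
    by apply: contra yI; rewrite !inE => -[].
by apply: cintegrable_le iG _ => // x _.
Qed.

End Tonelli.

Section ScaleGe0.
Context d (T : measurableType d) (R : realType) (mu : {measure set T -> \bar R}).

Lemma Rintegral_scale_ge0 (D : set T) (g : T -> R) (a : R) : measurable D -> measurable_fun D g ->
  (forall x, D x -> 0 <= g x) ->
  Rintegral mu D (fun x => a * g x) = a * Rintegral mu D g.
Proof.
move=> mD mg g0.
have pos b : 0 <= b -> fine (\int[mu]_(x in D) (b * g x)%:E)%E = b * Rintegral mu D g.
  move=> b0; under eq_integral do rewrite EFinM.
  rewrite ge0_integralZl//; last by first [exact/measurable_EFinP|move=> x Dx; rewrite lee_fin g0].
  rewrite /Rintegral; case: (\int[mu]_(x in D) (g x)%:E)%E => [r //||] /=; rewrite mulr0.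
    by move: b0; rewrite le_eqVlt => /predU1P[<-|b0]; rewrite ?mul0e// gt0_muley.
  by move: b0; rewrite le_eqVlt => /predU1P[<-|b0]; rewrite ?mul0e// gt0_muleNy.
rewrite {1}/Rintegral; have [a0|a0] := leP 0 a; first exact: pos.
have -> : (\int[mu]_(x in D) (a * g x)%:E)%E = (\int[mu]_(x in D) - ((- a) * g x)%:E)%E.
  by apply: eq_integral => x _; rewrite -EFinN mulNr opprK.
rewrite integral_ge0N; last by move=> x Dx; rewrite lee_fin mulr_ge0 ?g0// oppr_ge0 ltW.
by rewrite fineN pos ?oppr_ge0 ?ltW// mulNr opprK.
Qed.

(* Both sides vanish when [g] is not integrable. *)
Lemma cint_scale_ge0 (D : set T) (g : T -> R) (c : R[i]) : measurable D -> measurable_fun D g ->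
  (forall x, D x -> 0 <= g x) ->
  cint mu D (fun x => c * (g x)%:C) = c * (Rintegral mu D g)%:C.
Proof.
move=> mD mg g0; apply: complex_eq; rewrite /= ?ReM ?ImM /= mulr0 ?subr0 ?add0r.
  rewrite -Rintegral_scale_ge0//; apply: eq_Rintegral => x _.
  by rewrite ReM /= mulr0 subr0.
rewrite [RHS]mulrC [RHS]mulrC -Rintegral_scale_ge0//; apply: eq_Rintegral => x _.
by rewrite ImM /= mulr0 add0r.
Qed.

End ScaleGe0.

Section Rectangle.
Context d1 d2 (T1 : measurableType d1) (T2 : measurableType d2) (R : realType).
Variables (m1 : {sigma_finite_measure set T1 -> \bar R}).
Variables (m2 : {sigma_finite_measure set T2 -> \bar R}).
Variables (D : set T1) (I : set T2) (F : T1 * T2 -> R[i]).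
Hypotheses (mD : measurable D) (mI : measurable I) (iF : cintegrable (m1 \x m2)%E (D `*` I) F).

Lemma cint_rectangle1 : cintegrable m1 D (fun x => cint m2 I (fun y => F (x, y))) /\
  cint (m1 \x m2)%E (D `*` I) F = cint m1 D (fun x => cint m2 I (fun y => F (x, y))).
Proof.
have [a b] := cint_fubini1 (measurableX mD mI) iF.
have e x : cint m2 [set y | (D `*` I) (x, y)] (fun y => F (x, y)) =
    if x \in D then cint m2 I (fun y => F (x, y)) else 0.
  case: ifPn => [|/negP xD].
    by rewrite inE => Dx; congr (cint _ _ _); apply/seteqP; split => y //= -[].
  rewrite -[RHS](cint_set0 m2 (fun y => F (x, y))); congr (cint _ _ _).
  by apply/seteqP; split => y //= -[]; move=> Dx; case: xD; rewrite inE.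
split; first by apply/(cintegrable_mkcond _ _ mD); move: a; under eq_fun do rewrite e.
by rewrite b [RHS]cint_mkcond; apply: eq_cint => x _; rewrite e.
Qed.

Lemma cint_rectangle2 : cint (m1 \x m2)%E (D `*` I) F = cint m2 I (fun y => cint m1 D (fun x => F (x, y))).
Proof.
have [_ ->] := cint_fubini2 (measurableX mD mI) iF.
rewrite [RHS]cint_mkcond; apply: eq_cint => y _; case: ifPn => [|/negP yI].
  rewrite inE => Iy; congr (cint _ _ _); apply/seteqP; split => x //= -[]//.
rewrite -[RHS](cint_set0 m1 (fun x => F (x, y))); congr (cint _ _ _).
by apply/seteqP; split => x //= -[] _ Iy; case: yI; rewrite inE.
Qed.

Lemma cmeas_fst f : cmeas D f -> cmeas (D `*` I) (fun z : T1 * T2 => f z.1 : R[i]).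
Proof.
have sub : [set z.1 | z in D `*` I] `<=` D by move=> _ [[x y] [Dx _] <-].
have mf : measurable_fun (D `*` I) (@fst T1 T2) by apply: measurable_funTS; exact: measurable_fst.
by move=> [a b]; split; [exact: (measurable_comp mD sub a mf)|exact: (measurable_comp mD sub b mf)].
Qed.

End Rectangle.

(** * Radial functions with prescribed moments *)

Section RadialPotential.
Import -(notations) mpoly.
Variables (R : realType) (N : nat).
Implicit Types (P : zpoly R N) (z : cvec R N).
Local Notation I01 := (`]0, 1[%classic : set R).
Local Notation L := (@lshift N N).
Local Notation Rr := (@rshift N N).

(** The indicator form lets Fubini reduce moments of [rad] to those over the balls of squared radius
    [rho ^+ 2], given by [generic_ball_gauss]. *)
Definition radw s t (rho : R) : R := 2 / rho ^+ s * ((t < rho ^+ 2)%R)%:R.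

(* The integral of [2 rho^(-s)] over [sqrt t < rho < 1]. *)
Definition rad s (t : R) : R := Rintegral (leb R) I01 (radw s t).

Lemma cabs_mono_pow (a b : 'I_N -> nat) z rho : 0 <= rho -> normsq z <= rho ^+ 2 ->
  cabs (mono a b z) <= rho ^+ (\sum_j a j + \sum_j b j).
Proof.
move=> r0 zr; rewrite -big_split /= -prodrXr /mono.
elim/big_ind2 : _ => [|x1 x2 y1 y2 h1 h2|j _].
- by rewrite cabs1.
- by rewrite cabsM ler_pM ?cabs_ge0.
- rewrite cabsM !cabsX cabs_conj -exprD; apply: lerXn2r; rewrite ?nnegrE ?cabs_ge0//.
  have h := le_trans (absC2_coord_le z j) zr.
  by rewrite -(@ler_pXn2r _ 2)// ?nnegrE ?cabs_ge0// cabs_sqr.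
Qed.

Lemma evalz_small e P : (forall m, m \in mpoly.msupp P -> (e <= ldeg m + rdeg m)%N) ->
  exists2 C, 0 <= C & forall z rho, 0 <= rho <= 1 -> normsq z <= rho ^+ 2 -> cabs (evalz P z) <= C * rho ^+ e.
Proof.
move=> hP; exists (\sum_(m <- mpoly.msupp P) cabs (mpoly.mcoeff m P)).
  by apply: sumr_ge0 => m _; exact: cabs_ge0.
move=> z rho /andP[r0 r1] zr; rewrite evalzE mulr_suml; apply: le_trans (cabs_sum _ _ _) _.
rewrite big_seq [leRHS]big_seq; apply: ler_sum => m mP.
rewrite cabsM ler_wpM2l ?cabs_ge0//; apply: le_trans (cabs_mono_pow _ _ r0 zr) _.
by apply: ler_wiXn2l => //; exact: hP.
Qed.

Lemma radwE s t rho : (radw s t rho)%:C =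
  2 * (rho%:C ^+ s)^-1 * (((t < rho ^+ 2)%R%:R : R)%:C) :> R[i].
Proof. by rewrite /radw !(rmorphM (real_complex R)) fmorphV rmorphXn rmorph_nat. Qed.

Lemma measurable_radw s t : measurable_fun I01 (radw s t).
Proof.
have h : cmeas I01 (fun rho : R => (rho%:C : R[i])).
  by apply: cmeas_real; exact: measurable_id.
have [a _] : cmeas I01 (fun rho : R => ((radw s t rho)%:C : R[i])).
  under [X in cmeas _ X]eq_fun do rewrite radwE.
  apply: cmeasM; first by apply: cmeasM; [exact: cmeas_cst|apply: cmeas_inv; exact: cmeasX].
  by apply: cmeas_ltr; [exact: measurable_cst|exact: measurable_funX].
by [].
Qed.

Lemma radw_ge0 s t rho : I01 rho -> 0 <= radw s t rho.
Proof.
rewrite /= in_itv /= => /andP[r0 r1].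
by rewrite mulr_ge0// divr_ge0// exprn_ge0// ltW.
Qed.

Lemma cint_leb_pow M : cint (leb R) I01 (fun rho => ((rho ^+ M)%:C : R[i])) = M.+1%:R^-1.
Proof.
have := @cint_leb_deriv R ((M.+1%:R^-1)%:P * 'X^(M.+1)) 0 1 ltr01.
rewrite derivM derivC mul0r add0r derivXn /= !(hornerM _ _ 1%:C) !(hornerM _ _ 0%:C) !hornerC !hornerXn
  expr1n expr0n /= mulr0 subr0 mulr1 => <-.
apply: eq_cint => rho _; rewrite hornerM hornerC hornerMn hornerXn -[_ ^+ _ *+ _]mulr_natl mulrA mulVf
  ?pnatr_eq0// mul1r.
by rewrite rmorphXn.
Qed.

Context d (T : measurableType d) (mu : {sigma_finite_measure set T -> \bar R}).
Variables (D : set T) (mD : measurable D) (phi : T -> cvec R N).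
Hypothesis mphi : forall j, cmeas D (fun x => phi x j).
Hypothesis phiD : forall x, D x -> normsq (phi x) < 1.
Variable k : T -> R.
Hypothesis k0 : forall x, D x -> 0 <= k x.
Hypothesis ik : cintegrable mu D (fun x => (k x)%:C).
Hypothesis kK : forall z, normsq z < 1 ->
  cint mu D (fun x => (k x)%:C * ((absC2 (1 - inner z (phi x)))^-1 ^+ N.+1)%:C) =
  evalz 1 z * ((1 - normsq z)^-1 ^+ N.+1)%:C.

Lemma gauss1 : gauss (1 : zpoly R N) = 1.
Proof.
have := @gauss_linpow R N (fun=> 0) 0 0; rewrite /linpow !expr0 mulr1 => ->.
by rewrite eqxx fact0 mulr1.
Qed.

Lemma ball_mass r : 0 < r <= 1 -> mu.-integrable D (fun x => (k x * (normsq (phi x) < r)%R%:R)%:E) /\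
  Rintegral mu D (fun x => k x * (normsq (phi x) < r)%R%:R) = r ^+ N.
Proof.
move=> r01; have := cintegrable_kindb mD mphi phiD ik r (1 : zpoly R N).
have := generic_ball_gauss mD mphi phiD ik kK r01 (P := 1) (n := 0%N).
rewrite gauss1 mul1r add0n divff ?mul1r; last by rewrite pnatr_eq0 -lt0n fact_gt0.
have E x : (k x)%:C * (evalz 1 (phi x) * indb r (phi x)) = ((k x * (normsq (phi x) < r)%R%:R)%:C : R[i]).
  by rewrite evalz1 mul1r /indb -rmorphM.
move=> h [i _]; split.
  by move: i; apply: eq_integrable => // x _; rewrite E.
have : forall m, m \in mpoly.msupp (1 : zpoly R N) -> ldeg m = 0%N.
  move=> m; rewrite -mpoly.mpolyX0 mpoly.msuppX mem_seq1 => /eqP ->.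
  by rewrite /ldeg big1// => j _; rewrite mpoly.mnm0E.
move/h => /(congr1 (@complex.Re R)) /= <-; apply: eq_Rintegral => x _; by rewrite E.
Qed.

Variables (e s : nat) (P : zpoly R N).
Hypotheses (eP : forall m, m \in mpoly.msupp P -> (e <= ldeg m + rdeg m)%N) (se : (s <= e + 2 * N)%N).

Let F (xr : T * R) : R[i] := (k xr.1)%:C * evalz P (phi xr.1) * (radw s (normsq (phi xr.1)) xr.2)%:C.

(** At fixed [rho], [P] is at most [C rho^e] on the ball, whose mass is [rho^(2N)], so the inner
    integral is at most [2 C rho^(e+2N-s)]. The hypothesis [se] makes this bounded. *)
Let iF : cintegrable (mu \x leb R)%E (D `*` I01) F.
Proof.
have mI : measurable I01 by exact: measurable_itv.
have [C C0 hC] := evalz_small eP.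
apply: (@cintegrable_tonelli _ _ _ _ _ _ _ _ _ _ (2 * C)) => //.
- exact: leb_fin_itv.
- apply: cmeasM.
    apply: (@cmeas_fst _ _ _ _ _ _ _ mD (fun x => (k x)%:C * evalz P (phi x))).
    by apply: cmeasM; [exact: cintegrable_cmeas ik|exact: cmeas_evalz].
  have m2 : measurable_fun (D `*` I01) (fun z : T * R => z.2) by apply: measurable_funTS;
    exact: measurable_snd.
  have h : cmeas (D `*` I01) (fun z : T * R => (z.2%:C : R[i])) by exact: cmeas_real.
  under [X in cmeas _ X]eq_fun do rewrite radwE.
  apply: cmeasM; first by apply: cmeasM; [exact: cmeas_cst|apply: cmeas_inv; exact: cmeasX].
  apply: cmeas_ltr; last exact: measurable_funX.
  have mn : cmeas D (fun x => ((normsq (phi x))%:C : R[i])).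
    by apply: cmeas_real; exact: measurable_normsq_phi.
  by have [+ _] := @cmeas_fst _ _ _ _ _ _ I01 mD _ mn.
- move=> rho; rewrite /= in_itv /= => /andP[r0 r1].
  have r201 : 0 < rho ^+ 2 <= 1 by rewrite exprn_gt0//= exprn_ile1 ?ltW.
  have [ib vb] := ball_mass r201.
  pose c := C * rho ^+ e * (2 / rho ^+ s).
  have c0 : 0 <= c by rewrite /c; apply: mulr_ge0; [apply: mulr_ge0 => //|apply: divr_ge0 => //];
    apply: exprn_ge0; exact: ltW.
  apply: (@le_trans _ _ (\int[mu]_(x in D) (c%:E * (k x * (normsq (phi x) < rho ^+ 2)%R%:R)%:E))%E).
    apply: ge0_le_integral => //.
    + by move=> x _; rewrite lee_fin cabs_ge0.
    + apply/measurable_EFinP/measurable_cabs; rewrite /F /=; apply: cmeasM.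
        by apply: cmeasM; [exact: cintegrable_cmeas ik|exact: cmeas_evalz].
      under [X in cmeas _ X]eq_fun do rewrite radwE.
      by apply: cmeasM; [exact: cmeas_cst|apply: cmeas_ltr => //; exact: measurable_normsq_phi].
    + by apply: emeasurable_funM => //; exact: measurable_int ib.
    + move=> x Dx; rewrite -EFinM lee_fin /F /= !cabsM !cabs_real /radw.
      case: ltP => h; last by rewrite !mulr0 normr0 mulr0.
      have w0 : 0 <= 2 / rho ^+ s by apply: divr_ge0 => //; apply: exprn_ge0; exact: ltW.
      rewrite !mulr1 (ger0_norm (k0 Dx)) (ger0_norm w0) /c -[leRHS]mulrA -[leLHS]mulrA mulrCA [k x * _]mulrC.
      apply: ler_wpM2r; first by rewrite mulr_ge0// k0.
      by apply: hC; rewrite ?(ltW h) ?(ltW r0) ?(ltW r1).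
  rewrite integralZl// -[X in (_ * X)%E]fineK; last exact (integrable_fin_num mD ib).
  rewrite -[fine _]/(Rintegral mu D (fun x => k x * (normsq (phi x) < rho ^+ 2)%R%:R)) vb -EFinM lee_fin.
  have -> : c * (rho ^+ 2) ^+ N = 2 * C * (rho ^+ (e + 2 * N) / rho ^+ s).
    by rewrite /c -exprM exprD; ring.
  rewrite -[leRHS]mulr1 ler_wpM2l ?mulr_ge0// ler_pdivrMr ?exprn_gt0// mul1r.
  by apply: ler_wiXn2l; rewrite ?ltW.
Qed.

Let inner1 x : cint (leb R) I01 (fun rho => F (x, rho)) =
  (k x)%:C * evalz P (phi x) * (rad s (normsq (phi x)))%:C.
Proof.
rewrite /F /= cint_scale_ge0//; first exact: measurable_radw.
by move=> rho; exact: radw_ge0.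
Qed.

Lemma radial_integrable :
  cintegrable mu D (fun x => (k x)%:C * evalz P (phi x) * (rad s (normsq (phi x)))%:C).
Proof.
have [h _] := cint_rectangle1 mD (measurable_itv _) iF.
by move: h; under eq_fun do rewrite inner1.
Qed.

(** After exchanging the integrals, the ball moment contributes [rho^(2(n+N))], and
    [2 rho^(2(n+N)-s)] is integrated over the unit interval. *)
Lemma radial_moment n : (forall m, m \in mpoly.msupp P -> ldeg m = n) ->
  cint mu D (fun x => (k x)%:C * evalz P (phi x) * (rad s (normsq (phi x)))%:C) =
  gauss P * (N`!%:R / (n + N)`!%:R) * (2 / (2 * (n + N) - s).+1%:R).
Proof.
move=> nP; have mI : measurable I01 by exact: measurable_itv.
have [_ h] := cint_rectangle1 mD mI iF.
transitivity (cint (mu \x leb R)%E (D `*` I01) F).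
  by rewrite h; apply: eq_cint => x _; rewrite inner1.
rewrite cint_rectangle2// {h}.
pose G := gauss P * (N`!%:R / (n + N)`!%:R).
have inner2 rho : I01 rho -> cint mu D (fun x =>
  F (x, rho)) = G * ((2 / rho ^+ s * (rho ^+ 2) ^+ (n + N))%:C).
  rewrite /= in_itv /= => /andP[r0 r1].
  have r201 : 0 < rho ^+ 2 <= 1 by rewrite exprn_gt0//= exprn_ile1 ?ltW.
  transitivity (cint mu D (fun x =>
    (2 / rho ^+ s)%:C * ((k x)%:C * (evalz P (phi x) * indb (rho ^+ 2) (phi x))))).
    by apply: eq_cint => x _; rewrite /F /= /radw /indb rmorphM /=; ring.
  rewrite cintZ//; last exact: (cintegrable_kindb mD mphi phiD ik).
  by rewrite (generic_ball_gauss mD mphi phiD ik kK r201 nP) -/G rmorphM /=; ring.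
rewrite (eq_cint _ inner2).
have [g0|g0] := eqVneq (gauss P) 0.
  by rewrite /G g0 !mul0r; under eq_cint do rewrite mul0r; exact: cint0.
(* A nonzero Gaussian expectation forces a monomial with both degrees equal to [n], so [e <= 2 n]
   and the exponent is not truncated. When it is 0, both sides vanish. *)
have sn : (s <= 2 * (n + N))%N.
  have [m mP gm] : exists2 m, m \in mpoly.msupp P & gauss_mono R m != 0.
    apply/hasP; apply: contraNT g0 => /hasPn h; rewrite /gauss big_seq big1// => m /h.
    by rewrite negbK => /eqP ->; rewrite mulr0.
  apply: leq_trans se _; rewrite mulnDr leq_add2r (leq_trans (eP mP))//.
  move: gm; rewrite /gauss_mono; case: ifP => [/forallP lr _|]; last by rewrite eqxx.
  rewrite mul2n -addnn -{1}(nP _ mP) leq_add2l -(nP _ mP); apply: leq_sum => j _.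
  by rewrite (eqP (lr j)).
transitivity (cint (leb R) I01 (fun rho => (G * 2) * (rho ^+ (2 * (n + N) - s))%:C)).
  apply: eq_cint => rho; rewrite /= in_itv /= => /andP[r0 r1].
  rewrite -[RHS]mulrA; congr (_ * _); rewrite -exprM -{1}(subnK sn) exprD.
  rewrite -(rmorph_nat (real_complex R)) -rmorphM /=; congr (_%:C).
  by rewrite mulrAC -!mulrA divff ?mulr1// expf_neq0// gt_eqF.
rewrite cintZ//; first by rewrite cint_leb_pow mulrA.
apply: (@cintegrable_le _ _ _ _ _ _ (cst 1)) => //.
- by apply: cmeas_real; apply: measurable_funX; exact: measurable_id.
- apply: measurable_bounded_integrable => //; first exact: leb_fin_itv.
  exact: bounded_cst.
- move=> rho; rewrite /= in_itv /= => /andP[r0 r1].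
  by rewrite cabs_real ger0_norm ?exprn_ge0 ?exprn_ile1 ?ltW.
Qed.

End RadialPotential.

(** * Construction of [u] *)

Section Sufficiency.
Import -(notations) mpoly.
Variables (R : realType) (N : nat).
Local Notation mnm := (mpoly.multinom (N + N)).
Local Notation X m := (@mpoly.mpolyX (N + N) R[i] m).
Implicit Types (P : zpoly R N) (z : cvec R N) (m : mnm).

(** The factorial identity that turns the volume factor of the pairings and the Wick identity into
    the coefficients required of a preimage of the monomial. *)
Lemma shcoef_gauss (p q a b : nat) (tau : R[i]) :
  'C(N + a, N)%:R * 'C(N + b, N)%:R *
    ((if (p + b == q + a)%N then (N`! * (N + b - q)`!)%:R / ((N + a)`! * (N + b)`!)%:R else 0) *
    ((a ^_ p * b ^_ q)%:R * (if (a - p == b - q)%N then (a - p)`!%:R * tau ^+ (a - p) else 0))) =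
  shcoef N p q tau a b.
Proof.
rewrite /shcoef; have [ap|pa] := ltnP a p; first by rewrite ffact_small// mul0n mul0r !mulr0.
have [bq|qb] := ltnP b q; first by rewrite [b ^_ q]ffact_small// muln0 mul0r !mulr0.
have [e|ne] := eqVneq (a - p)%N (b - q)%N; rewrite /=; last by rewrite !mulr0.
have eb : (p + b = q + a)%N by lia.
rewrite eb eqxx; set j := (a - p)%N in e *.
have -> : (N + b - q = N + j)%N by lia.
have fne n : n`!%:R != 0 :> R[i] by rewrite pnatr_eq0 -lt0n fact_gt0.
have ha : 'C(N + a, N)%:R * N`!%:R * (a ^_ p)%:R * j`!%:R = (N + a)`!%:R :> R[i].
  rewrite -!natrM; congr (_%:R).
  by rewrite -mulnA ffact_fact// -mulnA -(@bin_fact (N + a) N) ?leq_addr// addKn.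
have hb : 'C(N + b, N)%:R * N`!%:R * (b ^_ q)%:R * j`!%:R = (N + b)`!%:R :> R[i].
  rewrite -!natrM; congr (_%:R).
  by rewrite e -mulnA ffact_fact// -mulnA -(@bin_fact (N + b) N) ?leq_addr// addKn.
have hj : 'C(N + j, N)%:R * N`!%:R * j`!%:R = (N + j)`!%:R :> R[i].
  by rewrite -!natrM; congr (_%:R); rewrite -mulnA -(@bin_fact (N + j) N) ?leq_addr// addKn.
have na := fne (N + a)%N; have nb := fne (N + b)%N.
rewrite !natrM -hj; apply: (mulfI (mulf_neq0 na nb)); rewrite -{3}ha -{3}hb.
move: na nb; move: ((N + a)`!%:R : R[i]) ((N + b)`!%:R : R[i]) => A B A0 B0.
move: ('C(N + a, N)%:R : R[i]) ('C(N + b, N)%:R : R[i]) ('C(N + j, N)%:R : R[i]) (tau ^+ j) => c1 c2 c3 t.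
move: (N`!%:R : R[i]) (j`!%:R : R[i]) ((a ^_ p)%:R : R[i]) ((b ^_ q)%:R : R[i]) => x1 x2 x3 x4.
by field; rewrite A0 B0.
Qed.

(* Data with the kernel integrals of the volume of the ball; [k = 1] with the
   identity and [k = k_w] with the automorphism [phi_w] are the two instances used. *)
Definition ball_model d (T : measurableType d) (mu : {measure set T -> \bar R}) (D : set T)
    (phi : T -> cvec R N) (k : T -> R) : Prop :=
  [/\ measurable D, forall j, cmeas D (fun x => phi x j), forall x, D x -> normsq (phi x) < 1,
      forall x, D x -> 0 <= k x & cintegrable mu D (fun x => (k x)%:C) /\
      forall z, normsq z < 1 ->
        cint mu D (fun x => (k x)%:C * ((absC2 (1 - inner z (phi x)))^-1 ^+ N.+1)%:C) =
        evalz 1 z * ((1 - normsq z)^-1 ^+ N.+1)%:C].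

(** One [u] serves every model at once: the volume gives a preimage of [P], and the Moebius weight
    lets the same [u] be composed with [phi_w]. *)
Definition kernel_lift (u : cvec R N -> R[i]) P : Prop :=
  forall d (T : measurableType d) (mu : {sigma_finite_measure set T -> \bar R}) (D : set T)
    (phi : T -> cvec R N) (k : T -> R), ball_model mu D phi k ->
  cintegrable mu D (fun x => (k x)%:C * u (phi x)) /\
  forall z, normsq z < 1 ->
    cint mu D (fun x => (k x)%:C * u (phi x) * ((absC2 (1 - inner z (phi x)))^-1 ^+ N.+1)%:C) =
    evalz P z * ((1 - normsq z)^-1 ^+ N.+1)%:C.

Lemma sufficiency_monomial m : (ldeg m == 0%N) || (rdeg m == 0%N) || (ldeg m + rdeg m <= 2 * N + 1)%N ->
  exists u : cvec R N -> R[i], kernel_lift u (X m).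
Proof.
set p := ldeg m; set q := rdeg m => pq.
have [W [hW eW]] := wick_exists R m; rewrite -/p -/q in hW eW.
have hA i : exists A : nat -> R[i], (p = 0%N -> forall l, A l = 0) /\
  ((i <= p)%N -> (i <= q)%N -> forall kk : nat,
    ((kk + (p + q - i))`! * kk`!)%:R / ((kk + p)`! * (kk + q)`!)%:R =
    (i == 0%N)%:R + \sum_(l < q) A l / (kk + l.+1)%:R).
  have [ip|pi] := leqP i p; last by exists (fun=> 0); split.
  have [iq|qi] := leqP i q; last by exists (fun=> 0); split.
  by have [A [A0 AE]] := fact_partial_fractions R[i] ip iq; exists A; split.
pose A i := projT1 (cid (hA i)).
have A0 i l : p = 0%N -> A i l = 0 by move=> p0; have [h _] := projT2 (cid (hA i)); exact: h.
have AE i := (projT2 (cid (hA i))).2.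
(* With [kk = N + b - q] and [n + N = kk + p + q - i], this exponent makes the radial moment
   [2 / (2 (n+N) - s + 1)] equal to the partial fraction [1 / (kk + l + 1)]. *)
pose s i l := (2 * (p + q - i - l) - 1)%N.
pose K := (p + q).+1.
pose u z : R[i] := \sum_(i < K) evalz (W i) z *
  ((nat_of_ord i == 0%N)%:R + \sum_(l < q) A i l * (rad (s i l) (normsq z))%:C).
exists u => d T mu D phi k [mD mphi phiD k0 [ik kK]].
pose t i l (Q : zpoly R N) x : R[i] := (k x)%:C * evalz (W i * Q) (phi x) * (rad (s i l) (normsq (phi x)))%:C.
have W0 i : ~~ ((i <= p)%N && (i <= q)%N) -> W i = 0.
  by move=> h; apply: (bihom_eq0 (hW i)); rewrite gtn_min !ltnNge -negb_and.
have uE Q x : (k x)%:C * u (phi x) * evalz Q (phi x) = \sum_(i < K)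
   ((nat_of_ord i == 0%N)%:R * ((k x)%:C * evalz (W i * Q) (phi x)) + \sum_(l < q) A i l * t i l Q x).
  rewrite /u [Y in Y * _]mulr_sumr mulr_suml; apply: eq_bigr => i _; rewrite evalzM /t.
  under [in RHS]eq_bigr do rewrite evalzM.
  move: (evalz Q (phi x)) (evalz (W i) (phi x)) ((k x)%:C : R[i]) => y w c.
  rewrite mulrDr mulrDr mulrDl; congr (_ + _); first by ring.
  rewrite !mulr_sumr mulr_suml; apply: eq_bigr => l _; ring.
have suppQ i z a b : forall m', m' \in mpoly.msupp (W i * linpow z a b) ->
  (ldeg m' + i = p + b /\ rdeg m' + i = q + a)%N.
  by apply: bihomM => //; exact: bihom_linpow.
have mom i l z a b : (l < q)%N -> cintegrable mu D (fun x => A i l * t i l (linpow z a b) x) /\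
   cint mu D (fun x => A i l * t i l (linpow z a b) x) =
   A i l * (gauss (W i * linpow z a b) * (N`!%:R / (p + b - i + N)`!%:R) * (2 / (2 * (p + b - i + N) -
     s i l).+1%:R)).
  move=> lq; have zero : (forall x, A i l * t i l (linpow z a b) x = 0) -> (A i l = 0 \/ W i = 0) ->
     cintegrable mu D (fun x => A i l * t i l (linpow z a b) x) /\
    cint mu D (fun x => A i l * t i l (linpow z a b) x) =
     A i l * (gauss (W i * linpow z a b) * (N`!%:R / (p + b - i + N)`!%:R) * (2 / (2 * (p + b - i + N)
       - s i l).+1%:R)).
    move=> h0 h; rewrite (funext h0); split; first exact: cintegrable0.
    by rewrite cint0; case: h => ->; rewrite ?mul0r// gauss0 !mul0r mulr0.
  (* Without a degree bound the radial factor may fail to be integrable; for [p = 0] its coefficient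
     is 0, and for [q = 0] there is no index [l < q]. *)
  have [p0|p0] := posnP p.
    by apply: zero; [move=> x|left]; rewrite A0// mul0r.
  have [ipq|nipq] := boolP ((i <= p)%N && (i <= q)%N); last first.
    apply: zero; [move=> x|right]; rewrite /t W0// mul0r /evalz mpoly.meval0; ring.
  have /andP[ip iq] := ipq.
  have eP m' : m' \in mpoly.msupp (W i * linpow z a b) -> (p + q - 2 * i <= ldeg m' + rdeg m')%N.
    by move=> /suppQ[]; lia.
  have se : (s i l <= p + q - 2 * i + 2 * N)%N.
    rewrite /s; move: pq; lia.
  have ri := radial_integrable mD mphi phiD k0 ik kK eP se.
  split; first exact: cintegrableZ.
  rewrite cintZ//; congr (_ * _).
  apply: (radial_moment mD mphi phiD k0 ik kK eP se (n := p + b - i)).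
  by move=> m' /suppQ[]; lia.
pose cab a b : R[i] := if (p + b == q + a)%N then (N`! * (N + b - q)`!)%:R / ((N + a)`! * (N + b)`!)%:R
  else 0.
pose term i z a b x : R[i] := (nat_of_ord i == 0%N)%:R * ((k x)%:C * evalz (W (nat_of_ord (i : 'I_K)) *
  linpow z a b) (phi x)) +
   \sum_(l < q) A i l * t i l (linpow z a b) x.
have iterm i z a b : cintegrable mu D (term i z a b).
  apply: cintegrableD => //; first by apply: cintegrableZ => //; exact: (cintegrable_kevalz mD mphi phiD ik).
  by apply: cintegrable_sum => // l _; case: (mom i l z a b (ltn_ord l)).
(* The radial factors are chosen to make the volume factor [cab] independent of [i], so that summing
   over [i] gives the Wick identity [eW]. *)
have vterm i z a b : cint mu D (term i z a b) = gauss (W i * linpow z a b) * cab a b.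
  rewrite cintD//; first last.
  - by apply: cintegrable_sum => // l _; case: (mom i l z a b (ltn_ord l)).
  - by apply: cintegrableZ => //; exact: (cintegrable_kevalz mD mphi phiD ik).
  rewrite cintZ//; last exact: (cintegrable_kevalz mD mphi phiD ik).
  rewrite cint_sum//; last by move=> l _; case: (mom i l z a b (ltn_ord l)).
  rewrite (generic_moment mD mphi phiD ik kK) (@dVm_gauss _ _ (p + b - i)); last by move=> m' /suppQ[]; lia.
  under eq_bigr => l _ do rewrite (proj2 (mom i l z a b (ltn_ord l))).
  have [g0|g0] := eqVneq (gauss (W i * linpow z a b)) 0.
    by rewrite g0 !mul0r mulr0 add0r big1// => l _; rewrite !mul0r mulr0.
  have [m' mP gm] : exists2 m', m' \in mpoly.msupp (W i * linpow z a b) & gauss_mono R m' != 0.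
    apply/hasP; apply: contraNT g0 => /hasPn h; rewrite /gauss big_seq big1// => m' /h.
    by rewrite negbK => /eqP ->; rewrite mulr0.
  have lr : ldeg m' = rdeg m'.
    move: gm; rewrite /gauss_mono; case: ifP => [/forallP lr _|]; last by rewrite eqxx.
    by apply: eq_bigr => j _; rewrite (eqP (lr j)).
  have [s1 s2] := suppQ _ _ _ _ _ mP.
  have /andP[ip iq] : (i <= p)%N && (i <= q)%N.
    by apply: contraNT g0 => /W0 ->; rewrite mul0r gauss0.
  have pbqa : (p + b = q + a)%N by rewrite -s1 -s2 lr.
  (* If [q > N + b], then [p = q + a - b > N + a] as well, so [p] and [q] are positive and
     [p + q >= 2 N + 2], against [pq]. *)
  have qb : (q <= N + b)%N by move: pq; lia.
  rewrite /cab pbqa eqxx; set kk := (N + b - q)%N.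
  have e1 : (p + b - i + N = kk + (p + q - i))%N by rewrite /kk; lia.
  have e2 : (N + a = kk + p)%N by rewrite /kk; lia.
  have e3 : (N + b = kk + q)%N by rewrite /kk; lia.
  rewrite -pbqa e1 e2 e3 natrM -[in RHS]mulrA.
  have fne n : n`!%:R != 0 :> R[i] by rewrite pnatr_eq0 -lt0n fact_gt0.
  have := AE i ip iq kk; rewrite natrM => hpf.
  transitivity (gauss (W i * linpow z a b) * (N`!%:R / (kk + (p + q - i))`!%:R) *
    ((kk + (p + q - i))`!%:R * kk`!%:R / ((kk + p)`! * (kk + q)`!)%:R)); last first.
    have := fne (kk + (p + q - i))%N.
    move: ((kk + (p + q - i))`!%:R : R[i]) (((kk + p)`! * (kk + q)`!)%:R^-1 : R[i]) (kk`!%:R : R[i]) =>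
      x y w x0.
    by field.
  rewrite hpf mulrDr mulr_sumr; congr (_ + _); first by rewrite mulrC.
  apply: eq_bigr => l _; rewrite mulrCA; congr (_ * _).
  rewrite -/(A i); congr (_ * _).
  have -> : (2 * (kk + (p + q - i)) - s i l).+1 = (2 * (kk + l.+1))%N.
    by rewrite /s; have := ltn_ord l; lia.
  by rewrite natrM invfM mulVKf// pnatr_eq0.
have totE z a b x : (k x)%:C * u (phi x) * evalz (linpow z a b) (phi x) = \sum_(i < K) term i z a b x.
  exact: uE.
have tot z a b : cintegrable mu D (fun x => (k x)%:C * u (phi x) * evalz (linpow z a b) (phi x)) /\
    cint mu D (fun x => (k x)%:C * u (phi x) * evalz (linpow z a b) (phi x)) =
    cab a b * ((a ^_ p * b ^_ q)%:R * (if (a - p == b - q)%N then (a - p)`!%:R * (normsq z)%:C ^+ (a -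
      p) else 0)) * evalz (X m) z.
  rewrite (funext (totE z a b)); split; first by apply: cintegrable_sum.
  rewrite cint_sum//; under eq_bigr do rewrite vterm.
  rewrite -mulr_suml eW// gauss_linpow; ring.
have iu : cintegrable mu D (fun x => (k x)%:C * u (phi x)).
  have [+ _] := tot (fun=> 0) 0%N 0%N; apply: eq_cintegrable => // x _.
  by rewrite evalz_linpow !expr0 !mulr1.
split => // z z1.
have := kernel_expansion mD mphi phiD iu z1.
have mo a b : 'C(N + a, N)%:R * 'C(N + b, N)%:R * moment mu D phi (fun x => (k x)%:C * u (phi x)) a b z =
    shcoef N p q (normsq z)%:C a b * evalz (X m) z.
  rewrite -shcoef_gauss -[RHS]mulrA; congr (_ * _); rewrite -(proj2 (tot z a b)).
  by apply: eq_cint => x _; rewrite evalz_linpow.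
under [Y in ccvg Y _]eq_fun do under eq_bigr do under eq_bigr do rewrite mo.
move/ccvg_unique; apply.
have E n : \sum_(a < n) \sum_(b < n) shcoef N p q (normsq z)%:C a b * evalz (X m) z =
   evalz (X m) z * nbsum N (n - maxn p q) (normsq z)%:C.
  have := @sum_shcoef _ N p q (normsq z)%:C 1 1 n; rewrite !expr1n !mulr1 mul1r => <-.
  rewrite mulr_sumr; apply: eq_bigr => a _; rewrite mulr_sumr; apply: eq_bigr => b _.
  by rewrite !expr1n !mulr1 mulrC.
rewrite (funext E); apply: ccvgM; first exact: ccvg_cst.
rewrite rmorphXn fmorphV rmorphB /= rmorph1.
apply: (@ccvg_subn R (fun n => nbsum N n (normsq z)%:C)); apply: nbsum_ccvg.
by rewrite cabs_real ger0_norm// normsq_ge0.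
Qed.

Lemma sufficiency (f : zpoly R N) :
  (forall m, m \in mpoly.msupp f -> (ldeg m == 0%N) || (rdeg m == 0%N) || (ldeg m + rdeg m <= 2 * N + 1)%N) ->
  exists u : cvec R N -> R[i], kernel_lift u f.
Proof.
move=> hf.
(* The membership is placed inside the existential so that a function is chosen for every [m]. *)
have hm m : exists u : cvec R N -> R[i], m \in mpoly.msupp f -> kernel_lift u (X m).
  have [/hf/sufficiency_monomial[u hu]|_] := boolP (m \in mpoly.msupp f); first by exists u.
  by exists (fun=> 0).
pose u m := projT1 (cid (hm m)).
have hu m := projT2 (cid (hm m)).
exists (fun z => \sum_(m <- mpoly.msupp f) mpoly.mcoeff m f * u m z).
move=> d T mu D phi k hB; have [mD mphi phiD k0 [ik kK]] := hB.
have im m c : m \in mpoly.msupp f -> cintegrable mu D (fun x => c * ((k x)%:C * u m (phi x))).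
  by move=> mf; apply: cintegrableZ => //; case: (hu m mf _ _ _ _ _ _ hB).
have uE x : (k x)%:C * (\sum_(m <- mpoly.msupp f) mpoly.mcoeff m f * u m (phi x)) =
    \sum_(m <- mpoly.msupp f | m \in mpoly.msupp f) mpoly.mcoeff m f * ((k x)%:C * u m (phi x)).
  by rewrite mulr_sumr big_seq; apply: eq_bigr => m _; rewrite mulrCA.
rewrite (funext uE); split; first by apply: cintegrable_sum => // m /im.
move=> z z1; transitivity (cint mu D (fun x =>
  \sum_(m <- mpoly.msupp f | m \in mpoly.msupp f) mpoly.mcoeff m f *
   ((k x)%:C * u m (phi x) * ((absC2 (1 - inner z (phi x)))^-1 ^+ N.+1)%:C))).
  by apply: eq_cint => x _; rewrite uE mulr_suml; apply: eq_bigr => m _; rewrite !mulrA.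
have ib m : m \in mpoly.msupp f -> cintegrable mu D (fun x =>
    (k x)%:C * u m (phi x) * ((absC2 (1 - inner z (phi x)))^-1 ^+ N.+1)%:C).
  move=> mf; have i0 := im m 1 mf; have {}i0 : cintegrable mu D (fun x => (k x)%:C * u m (phi x)).
    by move: i0; apply: eq_cintegrable => // x _; rewrite mul1r.
  exact: (kernel_integrable mD mphi phiD i0 z1).
rewrite cint_sum//; last by move=> m mf; apply: cintegrableZ => //; exact: ib.
rewrite evalzE big_seq mulr_suml; apply: eq_bigr => m mf.
rewrite cintZ//; last exact: ib.
have [_ ->//] := hu m mf _ _ _ _ _ _ hB.
by rewrite evalz_monoE mulrA.
Qed.

End Sufficiency.

(** * Necessity *)

Section FiniteDifference.
Variable K : comPzRingType.
Implicit Types (g : nat -> K) (t : K).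

(** This is [(-1)^n] times the n-th forward difference of [g] at 0. *)
Definition altsum n g : K := \sum_(y < n.+1) (-1) ^+ y * 'C(n, y)%:R * g y.

Lemma altsum_ext n g h : (forall y, g y = h y) -> altsum n g = altsum n h.
Proof. by move=> gh; apply: eq_bigr => y _; rewrite gh. Qed.

Lemma altsumS n g : altsum n.+1 g = altsum n (fun y => g y - g y.+1).
Proof.
rewrite /altsum; under [RHS]eq_bigr do rewrite mulrBr.
rewrite sumrB big_ord_recl /= bin0 expr0 !mul1r.
under eq_bigr do rewrite /bump /= add1n binS natrD mulrDr mulrDl.
rewrite big_split /= addrA; congr (_ + _).
  rewrite big_ord_recr /= bin_small// mulr0 mul0r addr0.
  by rewrite [RHS]big_ord_recl /= bin0 expr0 !mul1r.
rewrite -sumrN; apply: eq_bigr => y _.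
by rewrite exprS mulN1r !mulNr.
Qed.

Lemma altsumN n g : altsum n (fun y => - g y) = - altsum n g.
Proof. by rewrite /altsum -sumrN; apply: eq_bigr => y _; rewrite mulrN. Qed.

Lemma altsum0 n : altsum n (fun=> 0) = 0.
Proof. by rewrite /altsum big1// => y _; rewrite mulr0. Qed.

(** A difference of order [n] kills polynomials of degree [N < n]; by Pascal each use of [altsumS]
    lowers the degree by one. *)
Lemma altsum_bin n r N : (N < n)%N -> altsum n (fun y => 'C(y + r, N)%:R) = 0.
Proof.
elim: N n => [|N IH] [//|n]; rewrite ltnS altsumS => Nn.
  by rewrite -[RHS](altsum0 n); apply: altsum_ext => y; rewrite !bin0 subrr.
rewrite (altsum_ext _ (h := fun y => - 'C(y + r, N)%:R)) ?altsumN ?IH ?oppr0// => y.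
by rewrite addSn binS natrD opprD addrA subrr add0r.
Qed.

(** The polynomial [C(y-1,N)] would be killed, but its value at [y = 0] is [(-1)^N] while the
    function here is 0 there. This one discrepancy is what isolates the top coefficient in the
    necessity proof. *)
Lemma altsum_bin_pred n N : (N < n)%N ->
  altsum n (fun y => if y is y'.+1 then 'C(y', N)%:R else 0) = (-1) ^+ N.+1.
Proof.
elim: N n => [|N IH] [//|n]; rewrite ltnS altsumS => Nn.
  rewrite /altsum big_ord_recl /= bin0 expr0 mulr1 mul1r expr1 bin0 sub0r big1 ?addr0// => i _.
  by rewrite !bin0 subrr mulr0.
rewrite (altsum_ext _ (h := fun y => - (if y is y'.+1 then 'C(y', N)%:R else 0))) ?altsumN ?IH//.
  by rewrite [RHS]exprS mulN1r.
case=> [|y]; first by rewrite bin0n/= subr0 oppr0.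
by rewrite binS natrD opprD addrA subrr add0r.
Qed.

Lemma bin_mul_bin j k i : (i <= k)%N -> ('C(j + k, j + i) * 'C(j + i, j) = 'C(j + k, j) * 'C(k, i))%N.
Proof.
move=> ik; apply/eqP; rewrite -(@eqn_pmul2r (j`! * i`! * (k - i)`!)) ?muln_gt0 ?fact_gt0//; apply/eqP.
have h1 := @bin_fact (j + k) (j + i); have h2 := @bin_fact (j + i) j.
have h3 := @bin_fact (j + k) j; have h4 := @bin_fact k i.
rewrite subnDl in h1; rewrite addKn in h2; rewrite addKn in h3.
transitivity ((j + k)`!).
  by rewrite -h1 ?leq_add2l// -h2 ?leq_addr//; ring.
by rewrite -h3 ?leq_addr// -h4//; ring.
Qed.

(** Since [C(n,y) C(y,j) = C(n,j) C(n-j,y-j)], the sum over [y >= j] is a binomial expansion of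
    [(1-t)^(n-j)]; terms with [y < j], where the exponent may be truncated, vanish. *)
Lemma altsum_binpow n j r N t : (N <= j + r)%N ->
  altsum n (fun y => 'C(y, j)%:R * t ^+ (y + r - N)) =
  (-1) ^+ j * 'C(n, j)%:R * (1 - t) ^+ (n - j) * t ^+ (j + r - N).
Proof.
move=> Njr; have [nj|jn] := ltnP n j.
  rewrite bin_small// mulr0 !mul0r /altsum big1// => y _.
  by rewrite [X in _ * (X%:R * _)]bin_small ?mul0r ?mulr0// (leq_ltn_trans _ nj)// -ltnS.
rewrite -{1}(subnKC jn); set k := (n - j)%N.
rewrite /altsum -addnS big_split_ord /= big1 ?add0r; last first.
  by move=> y _; rewrite ['C(y, j)]bin_small ?mul0r ?mulr0.
have -> : n = (j + k)%N by rewrite /k subnKC.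
rewrite exprBn_comm ?/GRing.comm ?mul1r ?mulr1// mulr_sumr mulr_suml; apply: eq_bigr => i _.
have ik : (i <= k)%N by rewrite -ltnS.
have -> : (j + i + r - N = i + (j + r - N))%N by lia.
rewrite expr1n mulr1 !exprD -mulr_natr.
have := congr1 (GRing.natmul (1 : K)) (bin_mul_bin j ik); rewrite !natrM => e.
transitivity ((-1) ^+ j * (-1) ^+ i * t ^+ i * t ^+ (j + r - N) * ('C(j + k, j + i)%:R * 'C(j + i, j)%:R)).
  by ring.
by rewrite e; ring.
Qed.

End FiniteDifference.

Section Newton.
Variable F : numFieldType.

(** Finite expansion in the binomial basis, in which differences are computed by [altsum_binpow]. *)
Definition newton (g : nat -> F) := exists s (a : nat -> F), forall y, g y = \sum_(j < s) a j * 'C(y, j)%:R.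

Lemma newton_mul g c : newton g -> newton (fun y => (y%:R + c) * g y).
Proof.
move=> [s [a ga]].
exists s.+1, (fun j => (if (j < s)%N then (j%:R + c) * a j else 0) + (if j is j'.+1 then j%:R * a j'
  else 0)) => y.
under eq_bigr do rewrite mulrDl.
rewrite big_split /= ga mulr_sumr big_ord_recr /= ltnn mul0r addr0.
rewrite [X in _ = _ + X]big_ord_recl /= mul0r add0r -big_split /=; apply: eq_bigr => j _.
rewrite ltn_ord /bump /= add1n.
have h : j.+1%:R * 'C(y, j.+1)%:R = (y%:R - j%:R) * 'C(y, j)%:R :> F.
  have [jy|yj] := leqP j y; first by rewrite -natrB// -!natrM mul_bin_left.
  by rewrite !bin_small// ?mulr0// ltnW.
rewrite [j.+1%:R * _ * _]mulrAC h; ring.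
Qed.

Lemma newton_bin g r N : newton g -> newton (fun y => 'C(y + r, N)%:R * g y).
Proof.
move=> ng; elim: N => [|N IH].
  by case: ng => s [a ga]; exists s, a => y; rewrite bin0 mul1r.
have [s [a ga]] := newton_mul (r%:R - N%:R) IH.
exists s, (fun j => a j / N.+1%:R) => y.
under eq_bigr do rewrite mulrAC.
rewrite -mulr_suml -ga.
have h : N.+1%:R * 'C(y + r, N.+1)%:R = (y%:R + (r%:R - N%:R)) * 'C(y + r, N)%:R :> F.
  rewrite addrA -natrD; have [Ny|yN] := leqP N (y + r); first by rewrite -natrB// -!natrM mul_bin_left.
  by rewrite !bin_small// ?mulr0// ltnW.
have n0 : N.+1%:R != 0 :> F by rewrite pnatr_eq0.
by apply: (mulIf n0); rewrite divfK// mulrA -h mulrAC [N.+1%:R * _]mulrC.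
Qed.

(** The expansion is triangular: [g j] involves only [a 0], ..., [a j], with coefficient 1 at
    [a j]. *)
Lemma newton_vanish (s : nat) (a : nat -> F) g M : (forall y, g y = \sum_(j < s) a j * 'C(y, j)%:R) ->
  (forall y, (y < M)%N -> g y = 0) -> forall j, (j < s)%N -> (j < M)%N -> a j = 0.
Proof.
move=> ga g0 j; elim/ltn_ind: j => j IH js jM.
have := ga j; rewrite g0// (bigD1 (Ordinal js))//= binn mulr1 big1 ?addr0// => i ij.
have [ji|ij'] := ltnP j i; first by rewrite bin_small// mulr0.
rewrite IH ?mul0r//; last by apply: leq_ltn_trans jM.
by rewrite ltn_neqAle ij' andbT; apply: contra ij => /eqP e; apply/eqP/val_inj.
Qed.

End Newton.

Section BinomialTerm.
Variable R : realType.

Lemma cvg_finsum (I : Type) (si : seq I) (F : I -> nat -> R) (l : I -> R) :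
  (forall i, F i n @[n --> \oo] --> l i) ->
  \sum_(i <- si) F i n @[n --> \oo] --> \sum_(i <- si) l i.
Proof.
move=> h; elim: si => [|i s IH].
  by rewrite big_nil; under eq_fun do rewrite big_nil; exact: cvg_cst.
by rewrite big_cons; under eq_fun do rewrite big_cons; apply: cvgD.
Qed.

(** It is one of the nonnegative terms in the expansion of [(1 - t + t)^n = 1]. *)
Lemma binomial_term_le1 n j (t : R) : 0 <= t <= 1 -> 'C(n, j)%:R * t ^+ j * (1 - t) ^+ (n - j) <= 1.
Proof.
move=> /andP[t0 t1]; have [nj|jn] := ltnP n j; first by rewrite bin_small// !mul0r.
have : (1 - t + t) ^+ n = 1 by rewrite subrK expr1n.
rewrite exprDn (bigD1 (Ordinal (jn : (j < n.+1)%N)))//= => e.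
rewrite -[leRHS]e -[leLHS]addr0; apply: lerD.
  by rewrite -mulrA mulr_natl [t ^+ j * _]mulrC.
by apply: sumr_ge0 => i _; rewrite mulrn_wge0// mulr_ge0 ?exprn_ge0 ?subr_ge0.
Qed.

Lemma binomial_term_cvg0 j (t : R) : 0 < t <= 1 ->
  'C(n, j)%:R * t ^+ j * (1 - t) ^+ (n - j) @[n --> \oo] --> (0 : R).
Proof.
move=> /andP[t0 t1]; rewrite -(cvg_shiftn j).
have h : 0 <= 1 - t < 1 by rewrite subr_ge0 t1/= gtrBl.
have -> : (fun n => 'C(n + j, j)%:R * t ^+ j * (1 - t) ^+ (n + j - j)) =
   (fun n => t ^+ j * ('C(j + n, j)%:R * (1 - t) ^+ n)).
  by apply/funext => n; rewrite addnK addnC; ring.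
have H : t ^+ j * ('C(j + n, j)%:R * (1 - t) ^+ n) @[n --> \oo] --> t ^+ j * 0.
  by apply: cvgM; [exact: cvg_cst|exact: nbterm_cvg0].
by move: H; rewrite mulr0.
Qed.

End BinomialTerm.

(** * The limit of the finite differences *)

Section NecessityCore.
Context d0 (T : measurableType d0) (R : realType) (mu : {measure set T -> \bar R}).
Variables (D : set T) (mD : measurable D) (U lam : T -> R[i]) (N d r : nat).
Hypotheses (iU : cintegrable mu D U) (mlam : cmeas D lam).
Hypothesis lam1 : forall x, D x -> cabs (lam x) < 1.
Hypothesis lam0 : {ae mu, forall x, D x -> lam x != 0}.
Hypotheses (N0 : (0 < N)%N) (rd : (2 * N <= 2 * r + d)%N).
Variables (I : Type) (si : seq I) (c : I -> R[i]) (q : I -> nat).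
Hypothesis qr : forall i, (q i <= r.+1)%N.
Hypothesis momE : forall Y, (N <= Y)%N ->
  'C(Y + d, N)%:R * 'C(Y, N)%:R * cint mu D (fun x => U x * (lam x ^+ d * (lam x * (lam x)^^*) ^+ (Y - N))) =
  \sum_(i <- si) c i * 'C(Y - q i, N)%:R.

(** The weights of [momE] at [Y = y + r]; the trailing 1 is the constant function from which
    [newton_bin] is applied twice. *)
Let g (y : nat) : R[i] := 'C(y + (r + d), N)%:R * ('C(y + r, N)%:R * 1).
Let w y x : R[i] := lam x ^+ d * (lam x * (lam x)^^*) ^+ (y + r - N).

Let mw y : cmeas D (w y).
Proof. by apply: cmeasM; apply: cmeasX => //; apply: cmeasM => //; exact: cmeas_conj. Qed.

Let cabs_w y x : D x -> cabs (w y x) <= 1.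
Proof.
move=> Dx; have h := lam1 Dx; have h0 := cabs_ge0 (lam x).
have h1 := ltW h; rewrite /w cabsM !cabsX cabsM cabs_conj.
by rewrite mulr_ile1 ?exprn_ge0 ?exprn_ile1 ?mulr_ge0 ?mulr_ile1.
Qed.

Let iUw y : cintegrable mu D (fun x => U x * w y x).
Proof. by apply: (@cintegrable_bounded _ _ _ _ _ _ _ 1) => // x Dx; exact: cabs_w. Qed.

Let S n x : R[i] := altsum n (fun y => g y * w y x).

(** Terms with [q i <= r] are polynomials in [y] and drop out by [altsum_bin]; those with
    [q i = r + 1] have the shape of [altsum_bin_pred]. For [y + r < N], where [momE] is silent, both
    sides are 0. *)
Let value n : (N < n)%N -> cint mu D (fun x => U x * S n x) =
  (-1) ^+ N.+1 * \sum_(i <- si | q i == r.+1) c i.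
Proof.
move=> Nn; have mom y : g y * cint mu D (fun x => U x * w y x) = \sum_(i <- si) c i * 'C(y + r - q i, N)%:R.
  have [Ny|yN] := leqP N (y + r); first by rewrite -momE// /g mulr1 addnA.
  rewrite /g [X in _ * (X%:R * _)]bin_small// !mul0r mulr0 mul0r big1// => i _.
  by rewrite bin_small ?mulr0// (leq_ltn_trans (leq_subr _ _)).
transitivity (altsum n (fun y => g y * cint mu D (fun x => U x * w y x))).
  transitivity (cint mu D (fun x => \sum_(y < n.+1) (-1) ^+ y * 'C(n, y)%:R * g y * (U x * w y x))).
    by apply: eq_cint => x _; rewrite /S /altsum mulr_sumr; apply: eq_bigr => y _; ring.
  rewrite cint_sum//; last by move=> y _; exact: cintegrableZ.
  by apply: eq_bigr => y _; rewrite cintZ// [RHS]mulrA.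
rewrite (altsum_ext _ mom) /altsum.
under eq_bigr do rewrite mulr_sumr.
rewrite exchange_big /= mulr_sumr [RHS]big_mkcond /=; apply: eq_bigr => i _.
transitivity (c i * altsum n (fun y => 'C(y + r - q i, N)%:R)).
  by rewrite /altsum mulr_sumr; apply: eq_bigr => y _; rewrite mulrCA.
have [e|ne] := eqVneq (q i) r.+1.
  rewrite -(altsum_bin_pred _ Nn) mulrC; congr (_ * _); apply: altsum_ext => -[|y].
    by rewrite e add0n subnS subnn bin_small.
  by rewrite e addSnnS addnK.
have qi : (q i <= r)%N by rewrite -ltnS ltn_neqAle ne qr.
rewrite -[RHS](mulr0 (c i)) -(altsum_bin _ (r - q i) Nn); congr (_ * _).
by apply: altsum_ext => y; rewrite addnBA.
Qed.

(** By [altsum_binpow] the j-th term carries [|lam|^(d + 2(j+r-N))], which is at most [|lam|^(2j)]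
    because [2N <= 2r + d]. Indices [j < N - r], where the exponent would be truncated, have
    [a j = 0] since [g] vanishes for [y < N - r]. *)
Let bound : exists s (a : nat -> R[i]), forall n x, D x ->
  cabs (S n x) <= \sum_(j < s) cabs (a j) * ('C(n,
    j)%:R * absC2 (lam x) ^+ j * (1 - absC2 (lam x)) ^+ (n - j)).
Proof.
have [s [a ga]] : newton g.
  apply: newton_bin; apply: newton_bin; exists 1%N, (fun=> 1) => y.
  by rewrite big_ord1 bin0 mul1r.
have a0 : forall j, (j < s)%N -> (j < N - r)%N -> a j = 0.
  apply: (newton_vanish ga) => y; rewrite ltn_subRL addnC => yN.
  by rewrite /g [X in _ * (X%:R * _)]bin_small// mul0r mulr0.
exists s, a => n x Dx; have l1 := lam1 Dx; have l0 := cabs_ge0 (lam x).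
set t := absC2 (lam x); have tE : t = cabs (lam x) ^+ 2 by rewrite cabs_sqr.
have t0 : 0 <= t by rewrite tE exprn_ge0.
have t1 : t <= 1 by rewrite tE exprn_ile1// ltW.
have -> : S n x = \sum_(j < s) a j * (lam x ^+ d * altsum n (fun y => 'C(y, j)%:R * (t%:C) ^+ (y + r - N))).
  rewrite /S /altsum; under [RHS]eq_bigr do rewrite mulr_sumr mulr_sumr.
  rewrite exchange_big /=; apply: eq_bigr => y _; rewrite ga !mulr_suml mulr_sumr.
  apply: eq_bigr => j _; rewrite /w /t absC2E; ring.
apply: le_trans (cabs_sum _ _ _) _; apply: ler_sum => j _.
rewrite cabsM; have [jM|Mj] := ltnP j (N - r); first by rewrite a0// cabs0 !mul0r.
rewrite ler_wpM2l ?cabs_ge0// altsum_binpow; last by rewrite addnC -leq_subLR.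
have tC : 1 - t%:C = (1 - t)%:C :> R[i] by rewrite rmorphB /= rmorph1.
rewrite tC !cabsM !cabsX cabsN cabs1 expr1n mul1r cabs_nat !cabs_real !ger0_norm ?subr_ge0//.
rewrite [leLHS]mulrCA -[leRHS]mulrA [leRHS]mulrCA.
rewrite [leRHS]mulrC; apply: ler_wpM2l.
  by rewrite mulr_ge0// exprn_ge0// subr_ge0.
rewrite tE -!exprM -exprD; apply: ler_wiXn2l => //; first exact: ltW.
by move: rd Mj; lia.
Qed.

(* Take the alternating sum of [momE] over [Y = y + r] against [(-1)^y C(n, y)]. On the
   right only the terms with [q_i = r + 1] survive. On the left the integrand is at most a
   constant times [|U|], since [2 N <= 2 r + d], and tends to [0] where [lam <> 0]. *)
Lemma necessity_core : \sum_(i <- si | q i == r.+1) c i = 0.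
Proof.
have [s [a Sle]] := bound.
pose A := \sum_(j < s) cabs (a j).
have t01 x : D x -> 0 <= absC2 (lam x) <= 1.
  move=> Dx; rewrite -cabs_sqr exprn_ge0 ?cabs_ge0//= exprn_ile1 ?cabs_ge0// ltW//; exact: lam1.
have mS n : cmeas D (S n).
  by apply: cmeas_sum => y _; apply: cmeasM; [exact: cmeas_cst|apply: cmeasM; [exact: cmeas_cst|exact: mw]].
have mU := cintegrable_cmeas iU.
have [||||||_ h] := @cint_dominated _ _ _ mu D (fun n x => U x * S n x) (fun=> 0) (fun x =>
  A * cabs (U x)) => //.
- by move=> n; exact: cmeasM.
- apply: filterS lam0 => x l0 Dx; have /andP[t0 t1] := t01 x Dx.
  rewrite -[X in ccvg _ X](mulr0 (U x)); apply: ccvgM; first exact: ccvg_cst.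
  apply: (@ccvg_squeeze _ _ _ (fun n => \sum_(j < s) cabs (a j) *
      ('C(n, j)%:R * absC2 (lam x) ^+ j * (1 - absC2 (lam x)) ^+ (n - j)))).
    by move=> n; rewrite subr0; exact: Sle.
  suff : \sum_(j < s) cabs (a j) * ('C(n, j)%:R * absC2 (lam x) ^+ j * (1 - absC2 (lam x)) ^+ (n - j))
      @[n --> \oo] --> \sum_(j < s) cabs (a j) * 0.
    by rewrite big1// => j _; rewrite mulr0.
  apply: cvg_finsum => j; apply: cvgM; first exact: cvg_cst.
  by apply: binomial_term_cvg0; rewrite t1 andbT lt_neqAle t0 andbT eq_sym absC2_eq0 l0.
- under eq_fun do rewrite EFinM; apply: integrableZl => //; exact: integrable_cabs.
- move=> n x Dx; rewrite cabsM mulrC ler_wpM2r ?cabs_ge0//; apply: le_trans (Sle n x Dx) _.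
  apply: ler_sum => j _; rewrite -[leRHS]mulr1 ler_wpM2l ?cabs_ge0//.
  exact: binomial_term_le1 (t01 _ Dx).
have h' : ccvg (fun n => cint mu D (fun x => U x * S (n + N.+1)%N x)) (cint mu D (fun=> 0)).
  by case: h => h1 h2; split; [move: h1|move: h2]; rewrite -(cvg_shiftn N.+1).
have e n : cint mu D (fun x => U x * S (n + N.+1)%N x) = (-1) ^+ N.+1 * \sum_(i <- si | q i == r.+1) c i.
  by rewrite value// addnS ltnS leq_addl.
rewrite (funext e) cint0 in h'.
have := ccvg_unique h' (@ccvg_cst _ _) => /esym/eqP.
by rewrite mulf_eq0 signr_eq0 /= => /eqP.
Qed.

End NecessityCore.

Lemma product_measure_null d1 d2 (T1 : measurableType d1) (T2 : measurableType d2) (R : realType)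
  (m1 : {sigma_finite_measure set T1 -> \bar R}) (m2 : {sigma_finite_measure set T2 -> \bar R})
  (A : set (T1 * T2)) : measurable A -> (forall y, m1 (ysection A y) = 0%E) -> (m1 \x m2)%E A = 0%E.
Proof.
move=> mA A0.
have -> : (m1 \x m2)%E A = (\int[m1]_x (m2 \o xsection A) x)%E by [].
rewrite -(@indic_fubini_tonelli_FE _ _ _ _ R m2 _ mA) (@indic_fubini_tonelli _ _ _ _ _ m1 m2 _ mA).
rewrite (@indic_fubini_tonelli_GE _ _ _ _ R m1 _ mA).
by apply: integral0_eq => y _ /=.
Qed.

Section NullSet.
Variables (R : realType) (n : nat).

Lemma lebCm_point (p : R * R) : lebCm R [set p] = 0%E.
Proof.
have -> : [set p] = [set p.1] `*` [set p.2].
  by apply/seteqP; split => [x ->|[a b] [/= -> ->]]//; case: p.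
change ((leb R \x leb R)%E ([set p.1] `*` [set p.2]) = 0%E).
rewrite product_measure1E//.
by rewrite -[leb R [set p.1]]/(@lebesgue_measure R [set p.1]) lebesgue_measure_set1 mul0e.
Qed.

(** With the other coordinates fixed, [<z,x> = 0] determines the first coordinate, so every section
    has at most one point. *)
Lemma ae_inner_neq0 (z : cvec R n.+1) : z ord0 != 0 ->
  {ae dVm R n.+1, forall x, ballT n.+1 x -> inner z (toC x) != 0}.
Proof.
move=> z0; pose A := [set x : n.+1.-tuple (R * R) | inner z (toC x) = 0].
have mA : measurable A.
  have mi : cmeas setT (fun x : n.+1.-tuple (R * R) => inner z (toC x)).
    apply: cmeas_sum => j _; apply: cmeasM; first exact: cmeas_cst.
    exact: (cmeas_conj (@cmeas_toC R n.+1 j)).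
  have := measurable_absC2 mi measurableT (measurable_set1 0).
  rewrite setTI; congr measurable; apply/seteqP; split => x /=.
    by move/eqP; rewrite absC2_eq0 => /eqP.
  by rewrite /A /= => ->; apply/eqP; rewrite absC2_eq0.
have lA : lebCnm R n.+1 A = 0%E.
  rewrite lebCnmS; apply: (@product_measure_null _ _ _ _ R (lebCm R) (lebCnm R n)) => [|y].
    by rewrite -[X in measurable X]setTI; apply: measurable_consT => //.
  set B := ysection _ _.
  have sub : forall p p', B p -> B p' -> p = p'.
    have key p : B p -> z ord0 * ((p.1 +i* p.2)^^*) = - \sum_(i < n) z (lift ord0 i) * (toC y i)^^*.
      have E : inner z (toC (consT (p, y))) =
          z ord0 * ((p.1 +i* p.2)^^*) + \sum_(i < n) z (lift ord0 i) * (toC y i)^^*.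
        by rewrite innerE big_ord_recl toC_consT0; congr (_ + _); apply: eq_bigr => i _; rewrite toC_consTS.
      rewrite /B /ysection /= inE => Bp; apply/eqP; rewrite -addr_eq0 -E.
      exact/eqP.
    move=> p p' /key e /key e'; have := etrans e (esym e') => /(mulfI z0).
    by move/(congr1 (@conjc R)); rewrite !conjcK; case: p {e} => ? ?; case: p' {e'} => ? ? [-> ->].
  have [->|/set0P[p Bp]] := eqVneq B set0; first by rewrite measure0.
  have -> : B = [set p] by apply/seteqP; split => [p' Bp'|_ ->//]; exact: sub.
  exact: lebCm_point.
exists A; split => //.
  by rewrite /dVm /= /mscale lA mule0.
by move=> x /= /not_implyP[_ /negP]; rewrite negbK => /eqP.
Qed.

End NullSet.

(** * Vanishing of the top bihomogeneous components *)

Section Necessity.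
Import -(notations) mpoly.
Variables (R : realType) (n : nat).
Local Notation N := n.+1.
Local Notation mnm := (mpoly.multinom (N + N)).
Local Notation X m := (@mpoly.mpolyX (N + N) R[i] m).
Variables (f : zpoly R N) (u : cvec R N -> R[i]).
Hypothesis iu : cintegrable (dVm R N) (ballT N) (fun x => u (toC x)).
Hypothesis uf : forall z, normsq z < 1 ->
  cint (dVm R N) (ballT N) (fun x => u (toC x) * ((absC2 (1 - inner z (toC x)))^-1 ^+ N.+1)%:C) =
  evalz f z * ((1 - normsq z)^-1 ^+ N.+1)%:C.

(** The flag [sw] exchanges the roles of [z] and its conjugate, so that the larger degree is [D1]
    and [d = D1 - D2] is a natural number. *)
Let D1 (sw : bool) (m : mnm) := if sw then rdeg m else ldeg m.
Let D2 (sw : bool) (m : mnm) := if sw then ldeg m else rdeg m.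

Let mB := @measurable_ballT R N.

(** On the sphere, [shcoef] at [Y = N + y] reduces to [C(Y-q,N)], so [moment_coefficients]
    restricted to the diagonal [d] is the hypothesis [momE] of [necessity_core]. *)
Lemma diagonal_top_vanish (sw : bool) (d r : nat) (z : cvec R N) : (2 * N <= 2 * r + d)%N ->
  (forall m, m \in mpoly.msupp f -> D1 sw m = (D2 sw m + d)%N -> (D2 sw m <= r.+1)%N) ->
  normsq z = 1 -> z ord0 != 0 ->
  \sum_(m <- mpoly.msupp f | (D1 sw m == D2 sw m + d)%N && (D2 sw m == r.+1))
    mpoly.mcoeff m f * evalz (X m) z = 0.
Proof.
move=> rd top z1 z0; have z1' : normsq z <= 1 by rewrite z1.
pose si := [seq m <- mpoly.msupp f | D1 sw m == (D2 sw m + d)%N].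
(* [necessity_core] requires [q] to be bounded by [r.+1] on all indices; the truncation changes
   nothing on [si]. *)
pose q m := minn (D2 sw m) r.+1.
pose lam (x : N.-tuple (R * R)) : R[i] := if sw then inner (toC x) z else inner z (toC x).
have conjl x : (lam x)^^* = if sw then inner z (toC x) else inner (toC x) z.
  by rewrite /lam; case: (sw); rewrite inner_conj.
have qE m : m \in si -> q m = D2 sw m.
  by rewrite mem_filter => /andP[/eqP h mf]; apply/minn_idPl/top.
have := @necessity_core _ _ R (dVm R N) (ballT N) mB (fun x => u (toC x)) lam N d r iu
  _ _ _ (ltn0Sn n) rd _ si (fun m => mpoly.mcoeff m f * evalz (X m) z) q _ _.
rewrite big_seq_cond big_filter_cond => /= H.
rewrite -[RHS]H.
- rewrite [LHS]big_seq_cond; apply: eq_bigl => m; rewrite mem_filter.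
  case: (boolP (m \in mpoly.msupp f)) => mf; rewrite ?andbF//= andbT; case: eqP => //= e.
  by rewrite qE// mem_filter mf e eqxx.
- rewrite /lam; case: (sw); first exact: (cmeas_innerr (@toC_meas R N)).
  exact: (cmeas_innerl (@toC_meas R N)).
- move=> x Bx; rewrite /lam; case: (sw).
    exact: (@cabs_inner_phir _ _ R (ballT N) N (@toC R N) (fun x h => h) z x z1' Bx).
  exact: (@cabs_inner_phi _ _ R (ballT N) N (@toC R N) (fun x h => h) z x z1' Bx).
- apply: filterS (ae_inner_neq0 z0) => x h Bx; rewrite /lam; case: (sw); last exact: h.
  by rewrite -inner_conj conjc_eq0; exact: h.
- by move=> m; exact: geq_minr.
- move=> Y NY; pose y := (Y - N)%N; have YE : Y = (N + y)%N by rewrite /y subnKC.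
  pose a := if sw then y else (y + d)%N; pose b := if sw then (y + d)%N else y.
  have := moment_coefficients mB (@toC_meas R N) (fun x h => h) iu uf a b z1'.
  rewrite z1 => ex.
  transitivity ('C(N + a, N)%:R * 'C(N + b, N)%:R *
     moment (dVm R N) (ballT N) (@toC R N) (fun x => u (toC x)) a b z).
    have -> : 'C(Y + d, N)%:R * 'C(Y, N)%:R = 'C(N + a, N)%:R * 'C(N + b, N)%:R :> R[i].
      by rewrite /a /b YE; case: (sw); rewrite addnA// mulrC.
    congr (_ * _); apply: eq_cint => x _; rewrite conjl -/y /lam /a /b.
    by case: (sw); rewrite exprD exprMn; ring.
  rewrite ex big_filter [RHS]big_mkcond /= big_seq [RHS]big_seq; apply: eq_bigr => m mf.
  rewrite evalz_monoE; case: ifPn => [/eqP e|ne].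
    congr (_ * _); rewrite qE ?mem_filter ?e ?eqxx// /shcoef.
    have [h|h] := leqP (D2 sw m) y.
      rewrite ifT; last by move: e h; rewrite /a /b /D1 /D2; case: (sw) => e h; apply/and3P; split; lia.
      rewrite expr1n mulr1; congr ('C(_, _)%:R).
      by move: e h; rewrite YE /a /D1 /D2; case: (sw); lia.
    rewrite ifF; first by rewrite bin_small// YE; lia.
    apply/negbTE; move: h; rewrite /a /b /D1 /D2; case: (sw) => h; apply/negP => /and3P[h1 h2 _]; lia.
  rewrite /shcoef ifF ?mulr0//; apply: contraNF ne.
  rewrite /a /b /D1 /D2; case: (sw) => /and3P[h1 h2 /eqP h3]; apply/eqP; lia.
Qed.

Lemma necessity m : ldeg m != 0%N -> rdeg m != 0%N -> m \in mpoly.msupp f -> (ldeg m + rdeg m <= 2 * N + 1)%N.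
Proof.
move=> lm rm mf; rewrite leqNgt; apply/negP => big.
pose sw := (ldeg m < rdeg m)%N.
pose d := (D1 sw m - D2 sw m)%N.
have D12 : D1 sw m = (D2 sw m + d)%N by rewrite /d /D1 /D2 /sw; case: (ltnP (ldeg m) (rdeg m)) => ?; lia.
have D0 : (0 < D2 sw m)%N by rewrite /D2 /sw; case: (ltnP (ldeg m) (rdeg m)) => _; rewrite lt0n.
have Ds : (2 * N + 1 < D1 sw m + D2 sw m)%N by rewrite /D1 /D2 /sw;
  case: (ltnP (ldeg m) (rdeg m)) => _; move: big; lia.
pose A v := has (fun m' => (D1 sw m' == D2 sw m' + d)%N && (D2 sw m' == v)) (mpoly.msupp f).
have Am : A (D2 sw m) by apply/hasP; exists m => //; rewrite D12 !eqxx.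
have Ab v : A v -> (v <= \max_(m' <- mpoly.msupp f) D2 sw m')%N.
  by move=> /hasP[m' mf' /andP[_ /eqP <-]]; exact: (@leq_bigmax_seq _ _ _ (fun m' => D2 sw m') m').
case: (ex_maxnP (ex_intro A _ Am) Ab) => v /hasP[m1 m1f Qm1] vmax.
(* Both degrees of [m] are positive, so [v > 0] and [r.+1 = v]; and [2 v + d >= D1 + D2 >= 2N + 2]
   for [m] gives [2N <= 2r + d]. *)
have mv := vmax _ Am; pose r := v.-1.
have rE : r.+1 = v by rewrite /r prednK// (leq_trans D0).
have rd : (2 * N <= 2 * r + d)%N by move: D12 Ds D0 mv; rewrite -rE; lia.
have top m' : m' \in mpoly.msupp f -> D1 sw m' = (D2 sw m' + d)%N -> (D2 sw m' <= r.+1)%N.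
  by move=> mf' e; rewrite rE; apply: vmax; apply/hasP; exists m' => //; rewrite e !eqxx.
rewrite -rE in Qm1.
pose Q (m' : mnm) := (D1 sw m' == D2 sw m' + d)%N && (D2 sw m' == r.+1).
pose g : zpoly R N := \sum_(m' <- mpoly.msupp f | Q m') mpoly.mcoeff m' f *: X m'.
have g0 : g = 0.
  (* Vanishing is known only for [z ord0 != 0]; multiplying [g] by this variable makes the product
     vanish everywhere. *)
  have XX0 : X (mpoly.mnm1 (lshift N ord0)) != 0 :> zpoly R N.
    by rewrite -mpoly.msize_poly_eq0 mpoly.msizeX.
  apply: (mulfI XX0); rewrite mulr0; apply: evalz_eq0 => z; rewrite evalzM evalz_XL.
  have [->|z0] := eqVneq (z ord0) 0; first by rewrite mul0r.
  have nz : 0 < normsq z.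
    apply: lt_le_trans (absC2_coord_le z ord0).
    by rewrite lt_neqAle absC2_ge0 andbT eq_sym absC2_eq0.
  pose x : R[i] := ((Num.sqrt (normsq z))^-1)%:C.
  have x0 : x != 0 by rewrite /x (inj_eq (@complexI R)) invr_eq0 gt_eqF// sqrtr_gt0.
  have n1 : normsq (fun j => x * z j) = 1.
    by rewrite normsq_scale /x absC2_real exprVn sqr_sqrtr ?ltW// mulVf ?gt_eqF.
  have H := @diagonal_top_vanish sw d r (fun j => x * z j) rd top n1 (mulf_neq0 x0 z0).
  have : (x ^+ (if sw then r.+1 else (r.+1 + d)%N) * x^^* ^+ (if sw then (r.+1 + d)%N else r.+1)) *
    evalz g z = 0.
    rewrite -[RHS]H /g evalz_sum mulr_sumr; apply: eq_bigr => m' /andP[/eqP e1 /eqP e2].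
    rewrite evalzZ !evalz_monoE mono_scale -/(ldeg m') -/(rdeg m').
    have -> : ldeg m' = (if sw then r.+1 else (r.+1 + d)%N) by move: e1 e2; rewrite /D1 /D2;
      case: (sw) => e1 e2; lia.
    have -> : rdeg m' = (if sw then (r.+1 + d)%N else r.+1) by move: e1 e2; rewrite /D1 /D2;
      case: (sw) => e1 e2; lia.
    by ring.
  move/eqP; rewrite !mulf_eq0 !expf_eq0 conjc_eq0 (negbTE x0) !andbF /= => /eqP ->.
  by rewrite mulr0.
have : mpoly.mcoeff m1 g = mpoly.mcoeff m1 f.
  rewrite /g raddf_sum big_mkcond (bigD1_seq m1) ?mpoly.msupp_uniq//= /Q Qm1 mpoly.mcoeffZ
    mpoly.mcoeffX eqxx mulr1.
  rewrite big1 ?addr0// => m' ne; case: ifP => // _.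
  by rewrite mpoly.mcoeffZ mpoly.mcoeffX (negbTE ne) mulr0.
rewrite g0 mpoly.mcoeff0 => e; move: m1f; rewrite mpoly.mcoeff_msupp -e eqxx.
by [].
Qed.

End Necessity.

(** * Automorphisms of the ball *)

Section Moebius.
Variables (R : realType) (N : nat) (w : cvec R N).
Hypothesis w1 : normsq w < 1.
Implicit Types (z y xi : cvec R N).

Let W : R[i] := (normsq w)%:C.
Let s : R[i] := (Num.sqrt (1 - normsq w))%:C.
(** This is [<P_w y, z>]. For [w = 0] it is 0, and the formulas below then agree with
    [phi 0 z = - z]. *)
Let P y z : R[i] := inner y w * inner w z / W.

Let s2 : s ^+ 2 = 1 - W.
Proof.
rewrite /s -rmorphXn /= sqr_sqrtr ?subr_ge0 ?(ltW w1)//.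
by rewrite rmorphB /= rmorph1.
Qed.

Let w0_inner : normsq w = 0 -> forall z, inner w z = 0.
Proof.
move=> h z; apply/eqP; rewrite -cabs_eq0 -(@sqrf_eq0 R).
by rewrite eq_le exprn_ge0 ?cabs_ge0// andbT (le_trans (cabs_inner_sqr _ _))// h mul0r.
Qed.

Lemma one_sub_inner_neq0 z z' : normsq z < 1 -> normsq z' < 1 -> 1 - inner z z' != 0.
Proof.
move=> z1 z'1; apply: subr1_neq0; have h := cabs_inner_sqr z z'.
by have := normsq_ge0 z; have := normsq_ge0 z'; have := cabs_ge0 (inner z z'); nra.
Qed.

Lemma inner_phil y z : normsq y < 1 ->
  (1 - inner y w) * inner (phi w y) z = inner w z - P y z - s * (inner y z - P y z).
Proof.
move=> y1; have nz := one_sub_inner_neq0 y1 w1; rewrite /phi; case: eqP => w0.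
  rewrite /P /s w0_inner// -[inner y w]inner_conj w0_inner// conjc0 w0 !subr0 sqrtr1.
  rewrite rmorph1 !mul0r !mul1r !subr0 sub0r !innerE -sumrN.
  by apply: eq_bigr => j _; rewrite mulNr.
rewrite [inner (fun j => _) z]innerE mulr_sumr.
transitivity (\sum_j (w j * (z j)^^* - inner y w / W * (w j * (z j)^^*) -
   s * (y j * (z j)^^* - inner y w / W * (w j * (z j)^^*)))).
  apply: eq_bigr => j _; rewrite -/W -/s [LHS]mulrA [(1 - _) * (_ / _)]mulrC divfK//.
  move: (inner y w) W s (w j) (y j) ((z j)^^*) => a b c e g h; ring.
rewrite !sumrB -!mulr_sumr sumrB -!mulr_sumr /P -!innerE.
by rewrite [inner y w * inner w z / W]mulrAC.
Qed.

Lemma inner_phir y z : normsq z < 1 ->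
  (1 - inner w z) * inner y (phi w z) = inner y w - P y z - s * (inner y z - P y z).
Proof.
move=> z1; have /(congr1 (@conjc R)) := inner_phil y z1.
have Pc : (P z y)^^* = P y z.
  by rewrite /P !conjM !inner_conj conjV conjc_real [inner w z * _]mulrC.
move: Pc; move: (P z y) => p Pc.
by rewrite !(conjM, conjB) conj1 !inner_conj Pc conjc_real.
Qed.

Lemma one_sub_inner_phi y z : normsq y < 1 -> normsq z < 1 ->
  (1 - inner y w) * (1 - inner (phi w y) z) = (1 - inner w z) * (1 - inner y (phi w z)).
Proof.
move=> y1 z1; rewrite !mulrBr !mulr1 inner_phil// inner_phir//.
by move: (inner y w) (inner w z) (inner y z) (P y z) => a b c p; ring.
Qed.

(** Expand [<phi_w y, phi_w z>] in the first argument, then in the second; what remains follows from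
    [s^2 = 1 - |w|^2] and [W P(y,z) = <y,w> <w,z>]. *)
Lemma one_sub_inner_phi2 y z : normsq y < 1 -> normsq z < 1 ->
  (1 - inner y w) * (1 - inner w z) * (1 - inner (phi w y) (phi w z)) = (1 - W) * (1 - inner y z).
Proof.
move=> y1 z1.
have e1 := inner_phil (phi w z) y1; have e2 := inner_phir y z1; have e3 := inner_phir w z1.
have wP : P w z = inner w z.
  rewrite /P inner_self -/W; have [w0|w0] := eqVneq (normsq w) 0; first by rewrite w0_inner// mulr0 mul0r.
  by rewrite mulrAC divff ?mul1r// /W (inj_eq (@complexI R)).
have e4 : (1 - inner w z) * inner w (phi w z) = W - inner w z.
  by rewrite e3 wP inner_self subrr mulr0 subr0.
have e5 : (1 - inner w z) * P y (phi w z) = inner y w - P y z.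
  transitivity (inner y w * ((1 - inner w z) * inner w (phi w z)) / W); first by rewrite /P; ring.
  rewrite e4 /P.
  have [w0|w0] := eqVneq (normsq w) 0.
    by rewrite w0_inner// -[inner y w]inner_conj w0_inner// conjc0 !mul0r subr0.
  have W0 : W != 0 by rewrite /W (inj_eq (@complexI R)).
  by field.
have -> : (1 - inner y w) * (1 - inner w z) * (1 - inner (phi w y) (phi w z)) =
   (1 - inner y w) * (1 - inner w z) - (1 - inner w z) * ((1 - inner y w) * inner (phi w y) (phi w z)).
  by ring.
rewrite e1.
have -> : (1 - inner w z) * (inner w (phi w z) - P y (phi w z) - s * (inner y (phi w z) - P y (phi w z))) =
  (1 - inner w z) * inner w (phi w z) - (1 - inner w z) * P y (phi w z)
  - s * ((1 - inner w z) * inner y (phi w z) - (1 - inner w z) * P y (phi w z)) by ring.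
rewrite e4 e5 e2.
have WP : W * P y z = inner y w * inner w z.
  rewrite /P mulrC; have [w0|w0] := eqVneq (normsq w) 0; first by rewrite w0_inner// !mulr0 !mul0r.
  by rewrite divfK// /W (inj_eq (@complexI R)).
have -> : inner y w - P y z - s * (inner y z - P y z) - (inner y w - P y z) = - s * (inner y z - P y z)
  by ring.
have -> : s * (- s * (inner y z - P y z)) = - (s ^+ 2 * (inner y z - P y z)) by ring.
rewrite s2; move: WP; move: (inner y w) (inner w z) (inner y z) (P y z) W => a b c p V e.
have -> : (1 - V) * (1 - c) = 1 - V - (c - V * c) by ring.
transitivity ((1 - a) * (1 - b) - (V - b - (a - p) - - ((1 - V) * (c - p))) + (V * p - a * b)).
  by rewrite e subrr addr0.
by ring.
Qed.

Lemma one_sub_normsq_phi z : normsq z < 1 ->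
  absC2 (1 - inner z w) * (1 - normsq (phi w z)) = (1 - normsq w) * (1 - normsq z).
Proof.
move=> z1; have := one_sub_inner_phi2 z1 z1; rewrite !inner_self => e.
apply: (@complexI R); rewrite !(rmorphM (real_complex R)) !rmorphB !rmorph1 /= -e.
by rewrite absC2E conjB conj1 inner_conj.
Qed.

Lemma normsq_phi_lt1 z : normsq z < 1 -> normsq (phi w z) < 1.
Proof.
move=> z1; have h := one_sub_normsq_phi z1.
have p : 0 < absC2 (1 - inner z w).
  by rewrite lt_neqAle absC2_ge0 andbT eq_sym absC2_eq0 one_sub_inner_neq0.
by rewrite -subr_gt0 -(pmulr_rgt0 _ p) h mulr_gt0// subr_gt0.
Qed.

Lemma cmeas_phi d (T : measurableType d) (D : set T) (v : T -> cvec R N) :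
  (forall j, cmeas D (fun x => v x j)) -> forall j, cmeas D (fun x => phi w (v x) j).
Proof.
move=> mv j; rewrite /phi; case: (normsq w == 0); first exact: cmeasN.
have mi : cmeas D (fun x => inner (v x) w).
  by apply: cmeas_sum => i _; apply: cmeasM => //; exact: cmeas_cst.
have mP : cmeas D (fun x => inner (v x) w / (normsq w)%:C * w j).
  by apply: cmeasM; [apply: cmeasM => //; exact: cmeas_cst|exact: cmeas_cst].
apply: cmeasM; last by apply: cmeas_inv; apply: cmeasB => //; exact: cmeas_cst.
apply: cmeasB; first by apply: cmeasB => //; exact: cmeas_cst.
by apply: cmeasM; [exact: cmeas_cst|exact: cmeasB].
Qed.

(** This is the real Jacobian of [phi_w]; here only its kernel identities are used. *)
Definition moebius_weight xi : R := ((1 - normsq w) / absC2 (1 - inner xi w)) ^+ N.+1.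

Lemma moebius_weight_ge0 xi : 0 <= moebius_weight xi.
Proof. by rewrite /moebius_weight exprn_ge0// divr_ge0 ?absC2_ge0// subr_ge0 ltW. Qed.

Lemma weight_kernel xi z : normsq xi < 1 -> normsq z < 1 ->
  moebius_weight xi * (absC2 (1 - inner z (phi w xi)))^-1 ^+ N.+1 =
  ((1 - normsq w) / absC2 (1 - inner z w)) ^+ N.+1 * (absC2 (1 - inner (phi w z) xi))^-1 ^+ N.+1.
Proof.
move=> x1 z1; rewrite /moebius_weight -!exprMn; congr (_ ^+ _).
have e := congr1 (@absC2 R) (one_sub_inner_phi x1 z1); rewrite !absC2M in e.
have c y y' : absC2 (1 - inner y y') = absC2 (1 - inner y' y).
  by rewrite -absC2_conj conjB conj1 inner_conj.
rewrite (c z (phi w xi)) (c z w) (c (phi w z) xi) -!mulrA; congr (_ * _).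
by rewrite -!invfM e.
Qed.

Lemma weight_kernel2 xi z : normsq xi < 1 -> normsq z < 1 ->
  moebius_weight xi * (absC2 (1 - inner (phi w z) (phi w xi)))^-1 ^+ N.+1 =
  (absC2 (1 - inner z w) / (1 - normsq w)) ^+ N.+1 * (absC2 (1 - inner z xi))^-1 ^+ N.+1.
Proof.
move=> x1 z1; rewrite /moebius_weight -!exprMn; congr (_ ^+ _).
have e := congr1 (@absC2 R) (one_sub_inner_phi2 z1 x1).
have w1' : 1 - normsq w != 0 by rewrite subr_eq0 gt_eqF.
have {}e : absC2 (1 - inner z w) * absC2 (1 - inner w xi) * absC2 (1 - inner (phi w z) (phi w xi)) =
   (1 - normsq w) ^+ 2 * absC2 (1 - inner z xi).
  by rewrite -absC2_real -!absC2M e (rmorphB (real_complex R)) rmorph1.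
have c y y' : absC2 (1 - inner y y') = absC2 (1 - inner y' y).
  by rewrite -absC2_conj conjB conj1 inner_conj.
have p1 : absC2 (1 - inner z w) != 0 by rewrite absC2_eq0 one_sub_inner_neq0.
have p2 : absC2 (1 - inner w xi) != 0 by rewrite absC2_eq0 one_sub_inner_neq0.
have p3 : absC2 (1 - inner (phi w z) (phi w xi)) != 0 by rewrite absC2_eq0 one_sub_inner_neq0//
  normsq_phi_lt1.
have p4 : absC2 (1 - inner z xi) != 0 by rewrite absC2_eq0 one_sub_inner_neq0.
rewrite (c xi w); move: e w1' p1 p2 p3 p4.
move: (absC2 _) (absC2 _) (absC2 _) (absC2 _) (1 - normsq w) => a b g h v e v0 a0 b0 g0 h0.
have -> : v / g / b = (v ^+ 2 * a) / (v * a * g * b) by field; rewrite v0 h0 b0 g0.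
by rewrite -e; field; rewrite v0 h0 b0 g0.
Qed.

End Moebius.

(** * Berezin transforms and composition with automorphisms *)

Section Berezin.
Import -(notations) mpoly.
Variables (R : realType) (N : nat).
Implicit Types (z : cvec R N) (u : cvec R N -> R[i]).

Let mB := @measurable_ballT R N.

Lemma dVm_sigma_finite : sigma_finite setT (dVm R N).
Proof.
have [F FT Foo] := sigma_finiteT (lebCnm R N); exists F => // i; have [mF Fi] := Foo i; split => //.
by rewrite /dVm /= /mscale lte_mul_pinfty.
Qed.

Let dVs : {sigma_finite_measure set _ -> \bar R} := sigma_finite_of dVm_sigma_finite.

Lemma berezin_kernel u z : L1ball u -> normsq z < 1 ->
  berezin u z = ((1 - normsq z) ^+ N.+1)%:C *
    cint (dVm R N) (ballT N) (fun x => u (toC x) * ((absC2 (1 - inner z (toC x)))^-1 ^+ N.+1)%:C).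
Proof.
move=> /L1ballE iu z1; rewrite berezinE -cintZ//.
  by apply: eq_cint => x _; rewrite exprVn (rmorphM (real_complex R)) -mulrA [u _ * _]mulrC.
exact: (kernel_integrable mB (@toC_meas R N) (fun x h => h) iu z1).
Qed.

Lemma berezin_eqP u (f : zpoly R N) z : L1ball u -> normsq z < 1 ->
  (cint (dVm R N) (ballT N) (fun x => u (toC x) * ((absC2 (1 - inner z (toC x)))^-1 ^+ N.+1)%:C) =
   evalz f z * ((1 - normsq z)^-1 ^+ N.+1)%:C) <-> evalz f z = berezin u z.
Proof.
move=> iu z1; rewrite berezin_kernel//.
have nz : ((1 - normsq z) ^+ N.+1)%:C != 0 :> R[i].
  by rewrite (inj_eq (@complexI R)) expf_neq0// subr_eq0 gt_eqF.
have e : ((1 - normsq z)^-1 ^+ N.+1)%:C = (((1 - normsq z) ^+ N.+1)%:C)^-1 :> R[i].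
  by rewrite exprVn fmorphV.
rewrite e; split => [->|->]; first by rewrite mulrC divfK.
by rewrite mulrAC divff ?mul1r.
Qed.

Section Range.
Variable Q : zpoly R N.
Hypothesis hQ : forall m, m \in mpoly.msupp Q ->
  (ldeg m == 0%N) || (rdeg m == 0%N) || (ldeg m + rdeg m <= 2 * N + 1)%N.

Lemma berezin_range : exists u : cvec R N -> R[i], L1ball u /\
  forall z, normsq z < 1 -> berezin u z = evalz Q z.
Proof.
have [u hu] := sufficiency hQ; exists u.
have [iu uk] := hu _ _ dVs _ (@toC R N) (fun=> 1) (And5 mB (@toC_meas R N) (fun x h => h)
  (fun _ _ => ler01) (conj (@dVm_cst1 R N) (@dVm_kernel R N))).
have L1 : L1ball u by apply/L1ballE; move: iu; apply: eq_cintegrable => // x _; rewrite mul1r.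
split => // z z1; apply/esym/(berezin_eqP _ L1 z1); rewrite -uk//.
by apply: eq_cint => x _; rewrite mul1r.
Qed.

Variables (w : cvec R N).
Hypothesis w1 : normsq w < 1.

Lemma cintegrable_weight : cintegrable (dVm R N) (ballT N) (fun x => ((moebius_weight w (toC x))%:C : R[i])).
Proof.
have h := kernel_integrable mB (@toC_meas R N) (fun x h => h) (@dVm_cst1 R N) w1.
have := cintegrableZ (((1 - normsq w) ^+ N.+1)%:C) mB h; apply: eq_cintegrable => // x _.
rewrite mul1r -(rmorphM (real_complex R)) -exprMn /moebius_weight.
by rewrite -absC2_conj conjB conj1 inner_conj.
Qed.

(** By [weight_kernel] and the kernel integral of the volume at [phi_w z], the weighted volume with
    [phi_w] is a ball model. The lifted identity, taken at [phi_w z], becomes the Berezin transform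
    of [u0] composed with [phi_w] at [z], by [weight_kernel2]. *)
Lemma berezin_composition : exists u : cvec R N -> R[i], L1ball u /\
  forall z, normsq z < 1 -> berezin u z = evalz Q (phi w z).
Proof.
have [u0 hu0] := sufficiency hQ.
pose ph x : cvec R N := phi w (@toC R N x); pose k x := moebius_weight w (@toC R N x).
have mph : forall j, cmeas (ballT N) (fun x => ph x j) by apply: cmeas_phi; exact: toC_meas.
have phD x : ballT N x -> normsq (ph x) < 1 by move=> Bx; exact: normsq_phi_lt1.
have k0 x : ballT N x -> 0 <= k x by move=> _; exact: moebius_weight_ge0.
have kK z : normsq z < 1 -> cint dVs (ballT N) (fun x =>
  (k x)%:C * ((absC2 (1 - inner z (ph x)))^-1 ^+ N.+1)%:C) =
    evalz 1 z * ((1 - normsq z)^-1 ^+ N.+1)%:C.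
  move=> z1; have pz1 := normsq_phi_lt1 w1 z1.
  transitivity (cint (dVm R N) (ballT N) (fun x => (((1 - normsq w) / absC2 (1 - inner z w)) ^+ N.+1)%:C *
     (1 * ((absC2 (1 - inner (phi w z) (toC x)))^-1 ^+ N.+1)%:C))).
    apply: eq_cint => x Bx; rewrite mul1r -!(rmorphM (real_complex R)); congr (_%:C).
    exact: weight_kernel.
  rewrite cintZ//; last exact: (kernel_integrable mB (@toC_meas R N) (fun x h => h) (@dVm_cst1 R N) pz1).
  rewrite dVm_kernel// !evalz1 !mul1r -(rmorphM (real_complex R)) -exprMn; congr ((_ ^+ _)%:C).
  have e := one_sub_normsq_phi w1 z1.
  have p1 : absC2 (1 - inner z w) != 0 by rewrite absC2_eq0 one_sub_inner_neq0.
  have p2 : 1 - normsq w != 0 by rewrite subr_eq0 gt_eqF.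
  have p3 : 1 - normsq z != 0 by rewrite subr_eq0 gt_eqF.
  have p4 : 1 - normsq (phi w z) != 0 by rewrite subr_eq0 gt_eqF.
  apply: (mulfI p3); rewrite divff//; apply: (mulIf (mulf_neq0 p1 p4)); rewrite mul1r [RHS]e.
  move: p1 p4; move: (absC2 _) (1 - normsq (phi w z)) => a b a0 b0; field.
  by rewrite a0 b0.
have [iu uk] := hu0 _ _ dVs _ ph k (And5 mB mph phD k0 (conj cintegrable_weight kK)).
exists (fun z => u0 (phi w z)).
have kE x : ballT N x -> k x != 0.
  move=> Bx; rewrite /k /moebius_weight expf_neq0// mulf_neq0 ?invr_eq0 ?absC2_eq0 ?one_sub_inner_neq0//.
  by rewrite subr_eq0 gt_eqF.
have w0 : 0 < 1 - normsq w by rewrite subr_gt0.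
have L1 : L1ball (fun z => u0 (phi w z)).
  apply/L1ballE.
  have mk : cmeas (ballT N) (fun x => (((absC2 (1 - inner (toC x) w) / (1 - normsq w)) ^+ N.+1)%:C : R[i])).
    apply: cmeas_real; apply: measurable_funX; apply: measurable_funM; last exact: measurable_cst.
    apply: measurable_absC2; apply: cmeasB; first exact: cmeas_cst.
    exact: (cmeas_innerr (@toC_meas R N)).
  (* Integrability is known with the weight; its inverse is bounded because [|1 - <xi,w>| <= 2] on
     the ball. *)
  have := cintegrable_bounded mB iu mk (M := (2 ^+ 2 / (1 - normsq w)) ^+ N.+1) _.
  move=> h; have {}h := h _; apply: (eq_cintegrable mB _ (h _)) => x Bx.
    rewrite mulrAC -(rmorphM (real_complex R)) /k /moebius_weight -exprMn -mulrA mulKf ?absC2_eq0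
      ?one_sub_inner_neq0//.
    by rewrite divff ?gt_eqF// expr1n mul1r.
  have x0 := absC2_ge0 (1 - inner (toC x) w).
  rewrite cabs_real ger0_norm; last by rewrite exprn_ge0// divr_ge0// ltW.
  apply: lerXn2r; [by rewrite nnegrE divr_ge0// ltW|by rewrite nnegrE divr_ge0 ?exprn_ge0// ltW|].
  rewrite ler_pM2r ?invr_gt0//.
  rewrite -cabs_sqr; apply: lerXn2r; rewrite ?nnegrE ?cabs_ge0//.
  apply: le_trans (cabsB _ _) _; rewrite cabs1 -[leRHS]natr1 lerD// ltW//.
  exact: (cabs_inner_phir (fun x h => h) (ltW w1) Bx).
split => // z z1; rewrite berezin_kernel//.
have pz1 := normsq_phi_lt1 w1 z1.
have e := one_sub_normsq_phi w1 z1.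
have := uk _ pz1.
have p1 : absC2 (1 - inner z w) != 0 by rewrite absC2_eq0 one_sub_inner_neq0.
have p2 : 1 - normsq w != 0 by rewrite gt_eqF.
have p3 : 1 - normsq z != 0 by rewrite subr_eq0 gt_eqF.
have p4 : 1 - normsq (phi w z) != 0 by rewrite subr_eq0 gt_eqF.
pose c1 : R[i] := ((absC2 (1 - inner z w) / (1 - normsq w)) ^+ N.+1)%:C.
have ik := kernel_integrable mB (@toC_meas R N) (fun x h => h) ((L1ballE _).1 L1) z1.
have -> : cint dVs (ballT N) (fun x =>
  (k x)%:C * u0 (ph x) * ((absC2 (1 - inner (phi w z) (ph x)))^-1 ^+ N.+1)%:C) =
   c1 * cint (dVm R N) (ballT N) (fun x =>
     u0 (phi w (toC x)) * ((absC2 (1 - inner z (toC x)))^-1 ^+ N.+1)%:C).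
  rewrite -cintZ//; apply: eq_cint => x Bx; rewrite mulrAC -(rmorphM (real_complex R)) weight_kernel2//.
  by rewrite /c1 (rmorphM (real_complex R)) -/(ph x); ring.
set I := cint _ _ _; move=> h.
have c10 : c1 != 0 by rewrite /c1 (inj_eq (@complexI R)) expf_neq0// mulf_neq0// invr_eq0.
apply: (mulfI c10); rewrite mulrCA h mulrCA -(rmorphM (real_complex R)) mulrC; congr (_%:C * _).
rewrite -exprMn; congr (_ ^+ _); apply: (mulIf p4); rewrite divfK//.
apply: (mulIf p2); rewrite mulrAC divfK//.
by rewrite e mulrC.
Qed.

End Range.
End Berezin.

(** * The degree condition in terms of monomials *)

Section Degrees.
Import -(notations) mpoly.
Variables (R : realType) (N : nat).
Hypothesis N0 : (1 <= N)%N.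
Implicit Types (f : zpoly R N) (m : mpoly.multinom (N + N)).
Local Notation U i := (@mpoly.mnm1 (N + N) i).

Lemma mcoeff_dz_dzbar f (j l : 'I_N) m :
  (mpoly.mcoeff m (dz j (dzbar l f)) != 0) =
  (mpoly.mnm_add (mpoly.mnm_add m (U (lshift N j))) (U (rshift N l)) \in mpoly.msupp f).
Proof.
rewrite mpoly.mcoeff_msupp /dz /dzbar !mpoly.mcoeff_deriv -mulrnA -mulr_natl mulf_eq0.
by rewrite pnatr_eq0 muln_eq0.
Qed.

(** A mixed derivative lowers both degrees by one and kills exactly the monomials with one of them
    0; no other cancellation occurs, as distinct monomials stay distinct. [N >= 1] keeps [2N - 1]
    from being truncated. *)
Lemma mixed_degreeP f : (forall j l : 'I_N, tdeg_le (dz j (dzbar l f)) (2 * N - 1)) <->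
  (forall m, m \in mpoly.msupp f -> (ldeg m == 0%N) || (rdeg m == 0%N) || (ldeg m + rdeg m <= 2 * N + 1)%N).
Proof.
split => h.
  move=> m mf; have [//|l0 /=] := eqVneq (ldeg m) 0%N; have [//|r0 /=] := eqVneq (rdeg m) 0%N.
  have [j mj] : exists j, m (lshift N j) != 0%N.
    apply/existsP; apply: contraNT l0; rewrite negb_exists => /forallP k0.
    by rewrite /ldeg big1// => i _; apply/eqP; have := k0 i; rewrite negbK.
  have [l ml] : exists l, m (rshift N l) != 0%N.
    apply/existsP; apply: contraNT r0; rewrite negb_exists => /forallP k0.
    by rewrite /rdeg big1// => i _; apply/eqP; have := k0 i; rewrite negbK.
  pose m' := mpoly.mnm_sub (mpoly.mnm_sub m (U (lshift N j))) (U (rshift N l)).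
  have mE : mpoly.mnm_add (mpoly.mnm_add m' (U (lshift N j))) (U (rshift N l)) = m.
    apply/mpoly.mnmP => i; rewrite !mpoly.mnmDE !mpoly.mnmBE !mpoly.mnm1E.
    have [<-|_] := eqVneq (lshift N j) i; first by rewrite eq_rlshift; lia.
    by have [<-|_] := eqVneq (rshift N l) i; lia.
  have := h j l m'; rewrite mcoeff_dz_dzbar mE => /(_ mf).
  have e : mpoly.mdeg m = (mpoly.mdeg m' + 2)%N.
    by rewrite -[in LHS]mE !mpoly.mdegD !mpoly.mdeg1 -addnA.
  by rewrite -mdeg_lr e; move: N0; lia.
move=> j l m; rewrite mcoeff_dz_dzbar => /h; rewrite -mdeg_lr !ldegD !rdegD ldegL ldegR rdegL rdegR.
by rewrite !mpoly.mdegD !mpoly.mdeg1; move: N0; lia.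
Qed.

Lemma tdeg_le_mixed f : tdeg_le f (2 * N + 1) -> forall m, m \in mpoly.msupp f ->
  (ldeg m == 0%N) || (rdeg m == 0%N) || (ldeg m + rdeg m <= 2 * N + 1)%N.
Proof. by move=> h m; rewrite mpoly.mcoeff_msupp => /h; rewrite mdeg_lr => ->; rewrite orbT. Qed.

End Degrees.

Theorem theorem5p1 (R : realType) (N : nat) (hN : (1 <= N)%N) :
  (forall f : zpoly R N,
     (exists u : cvec R N -> R[i],
        L1ball u /\ forall z, ball_N N z -> evalz f z = berezin u z)
     <-> (forall j l : 'I_N, tdeg_le (dz j (dzbar l f)) (2 * N - 1)))
  /\
  (forall (s : nat) (w : 'I_s -> cvec R N) (Q : 'I_s -> zpoly R N),
     (forall k, ball_N N (w k)) ->
     (forall k, tdeg_le (Q k) (2 * N + 1)) ->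
     exists u : cvec R N -> R[i],
       L1ball u /\
       forall z, ball_N N z ->
         berezin u z = \sum_(k < s) evalz (Q k) (phi (w k) z)).
Proof.
split => [f|s w Q w1 Qd].
  rewrite (mixed_degreeP hN); split => [[u [L1 uf]] m mf|hf].
    have [//|l0 /=] := eqVneq (ldeg m) 0%N; have [//|r0 /=] := eqVneq (rdeg m) 0%N.
    (* [necessity] is stated in dimension [n.+1], where the coordinate [ord0] exists. *)
    case: N hN f u L1 uf m mf l0 r0 => // n _ f u L1 uf m mf l0 r0.
    apply: (@necessity R n f u ((L1ballE _).1 L1) _ m l0 r0 mf) => z z1.
    by apply/(berezin_eqP _ L1 z1); exact: uf.
  have [u [L1 uf]] := berezin_range hf.
  by exists u; split => // z z1; rewrite uf.
have hu k := cid (berezin_composition (tdeg_le_mixed (Qd k)) (w1 k)).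
pose u k := projT1 (hu k).
have L1u k : L1ball (u k) by case: (projT2 (hu k)).
have L1 : L1ball (fun z => \sum_(k < s) u k z).
  apply/L1ballE; apply: cintegrable_sum => [|k _]; first exact: measurable_ballT.
  exact/L1ballE.
exists (fun z => \sum_(k < s) u k z); split => // z z1.
rewrite berezin_kernel//.
under eq_cint do rewrite mulr_suml.
have mB := @measurable_ballT R N.
rewrite cint_sum//; last first.
  by move=> k _; exact: (kernel_integrable mB (@toC_meas R N) (fun x h => h) ((L1ballE _).1 (L1u k)) z1).
rewrite mulr_sumr; apply: eq_bigr => k _; rewrite -berezin_kernel//.
by case: (projT2 (hu k)) => _; apply.
Qed.
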